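(* For every $\varepsilon>0$ there exists a unique solution $u^{\varepsilon}\in H_0^1(\Omega)$ of the boundary value problem $$-\operatorname{div}\left(\mathbf{a}^{\varepsilon}\nabla u^{\varepsilon}\right)+g(u^{\varepsilon})=f \ \text{ in }\Omega,\qquad u^{\varepsilon}=0\ \text{ on }\partial\Omega,$$ in the sense that $$\int_{\Omega}\mathbf{a}^{\varepsilon}\nabla u^{\varepsilon}\cdot\nabla v\,dx+\int_{\Omega}g(u^{\varepsilon})\,v\,dx=\int_{\Omega}f\,v\,dx\qquad\text{for all }v\in H_0^1(\Omega).$$ Moreover, there is a constant $C>0$, independent of $\varepsilon$, such that for all $\varepsilon>0$ $$\|\nabla u^{\varepsilon}\|_{L^2(\Omega)}^2\le C\left(\|f\|_{L^{2_*}(\Omega)}^{2_*}+|g(0)|^{2_*}+1\right).$$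
   Context: Let $d\ge 2$, let $\Omega\subset\mathbb{R}^d$ be an open bounded set with smooth boundary, and let $Y=[0,1]^d$ be the unit cell. Denote by $e^1,\dots,e^d$ the canonical basis of $\mathbb{R}^d$. Coefficients: let $\lambda,\Lambda>0$ and let $\mathbf{a}$ be a (measurable, possibly discontinuous) $d\times d$ symmetric-matrix-valued function on $\mathbb{R}^d$ such that: (periodicity) $\mathbf{a}(z+m e^k)=\mathbf{a}(z)$ for all $z\in\mathbb{R}^d$, $m\in\mathbb{Z}$, $k\in\{1,\dots,d\}$; (boundedness) $\|\mathbf{a}\|_{L^\infty}\le\Lambda$; (ellipticity) $\mathbf{a}(x)\xi\cdot\xi\ge\lambda|\xi|^2$ for all $x,\xi\in\mathbb{R}^d$. For $\varepsilon>0$ set $\mathbf{a}^{\varepsilon}(x)=\mathbf{a}(x/\varepsilon)$. Exponents: if $d\ge3$, $2_*=\frac{2d}{d+2}$ and $2^*=\frac{2d}{d-2}$; if $d=2$, $2^*$ is an arbitrary fixed (finite) number $\ge2$ and $2_*=\frac{2^*}{2^*-1}$ is its conjugate exponent. Nonlinearity: $g:\mathbb{R}\to\mathbb{R}$ is continuous and non-decreasing, and there are $C_g>0$, $1\le q\le 2^*$ and $h\in L^{2_*}(\Omega)$ such that $|g(u)|\le C_g\left(|u|^{q-1}+h(x)\right)$ for all $u\in\mathbb{R}$ and a.e. $x\in\Omega$. Source: $f\in L^{2_*}(\Omega)$. *)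

(* Defs.v *)
From HB Require Import structures.
From mathcomp Require Import all_boot all_order all_algebra.
From mathcomp Require Import all_classical all_reals all_analysis.

Set Implicit Arguments.
Unset Strict Implicit.
Unset Printing Implicit Defensive.
Import Order.TTheory GRing.Theory Num.Theory.
Import numFieldNormedType.Exports.
Local Open Scope classical_set_scope.
Local Open Scope ring_scope.

(* The library has no measurable structure on 'rV[R]_n; we use the sigma-algebra
   generated by the coordinates, i.e. the Borel sets of R^n. *)
Definition rV_display : measure_display -> measure_display.
Proof. exact. Qed.

Section rV_measurable.
Context {R : realType} {n : nat}.

Definition rV_coord (i : 'I_n) (x : 'rV[R]_n) : measurableTypeR R := x ord0 i.

Let rV_set0 : g_sigma_preimage rV_coord set0.
Proof. exact: sigma_algebra0. Qed.

Let rV_setC A : g_sigma_preimage rV_coord A -> g_sigma_preimage rV_coord (~` A).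
Proof. exact: sigma_algebraC. Qed.

Let rV_bigcup (F : (set 'rV[R]_n)^nat) :
  (forall i, g_sigma_preimage rV_coord (F i)) ->
  g_sigma_preimage rV_coord (\bigcup_i (F i)).
Proof. exact: sigma_algebra_bigcup. Qed.

HB.instance Definition _ := @isMeasurable.Build
  (rV_display default_measure_display) 'rV[R]_n (g_sigma_preimage rV_coord) rV_set0 rV_setC rV_bigcup.

Lemma measurable_rV_coord (i : 'I_n) : measurable_fun setT (rV_coord i).
Proof.
move=> _ Y mY; rewrite setTI; apply: sub_sigma_algebra => /=.
rewrite -bigcup_seq/=; exists i => /=; first by rewrite mem_index_enum.
by exists Y => //; rewrite setTI.
Qed.

Lemma measurable_fun_rVP d (T : measurableType d) (f : T -> 'rV[R]_n) :
  (forall i, measurable_fun setT (rV_coord i \o f)) -> measurable_fun setT f.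
Proof.
move=> mf _ A mA.
suff : g_sigma_preimage (fun i => rV_coord i \o f) `<=` measurable.
  by rewrite g_sigma_preimage_comp; apply; exists A.
apply: smallest_sub; first exact: sigma_algebra_measurable.
rewrite -bigcup_seq; apply: bigcup_sub => i _.
by move=> B [C mC <-]; exact: mf.
Qed.

End rV_measurable.

Section lebesgue_measure_rV.
Context {R : realType}.

Definition rV_cons n (p : measurableTypeR R * 'rV[R]_n) : 'rV[R]_n.+1 :=
  row_mx (p.1%:M : 'rV_1) p.2.

Definition rV_uncons n (x : 'rV[R]_n.+1) : measurableTypeR R * 'rV[R]_n :=
  (x ord0 ord0, @rsubmx _ 1 1 n x).

Lemma rV_consK n : cancel (@rV_cons n) (@rV_uncons n).
Proof.
move=> [t x]; rewrite /rV_uncons /rV_cons; congr pair; last first.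
  exact: (@row_mxKr _ 1 1 n).
have -> : (ord0 : 'I_n.+1) = lshift n (ord0 : 'I_1) by apply/val_inj.
by rewrite (@row_mxEl _ 1 1 n) mxE eqxx mulr1n.
Qed.

Lemma rV_unconsK n : cancel (@rV_uncons n) (@rV_cons n).
Proof.
move=> x; rewrite /rV_cons /= -[RHS](@hsubmxK _ 1 1 n).
congr (@row_mx _ 1 1 n _ _); apply/rowP => i.
by rewrite !ord1 !mxE eqxx mulr1n; congr (x _ _); apply/val_inj.
Qed.

Lemma measurable_rV_cons n : measurable_fun setT (@rV_cons n).
Proof.
apply: measurable_fun_rVP => i.
case: (unliftP ord0 i) => [j|] ->.
  have -> : rV_coord (lift ord0 j) \o @rV_cons n =
            rV_coord j \o (@snd (measurableTypeR R) _).
    apply/funext => p /=; rewrite /rV_coord /rV_cons.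
    have -> : lift ord0 j = rshift 1 j by apply/val_inj.
    by rewrite (@row_mxEr _ 1 1 n).
  by apply: measurableT_comp => //; exact: measurable_rV_coord.
have -> : rV_coord (ord0 : 'I_n.+1) \o @rV_cons n = fst.
  by apply/funext => p; exact: (congr1 fst (rV_consK p)).
exact: measurable_fst.
Qed.

Lemma measurable_rV_uncons n : measurable_fun setT (@rV_uncons n).
Proof.
apply/measurable_fun_pair => /=.
  exact: (measurable_rV_coord (ord0 : 'I_n.+1)).
apply: measurable_fun_rVP => i.
have -> : rV_coord i \o (fun x : 'rV[R]_n.+1 => @rsubmx _ 1 1 n x) =
          rV_coord (rshift 1 i : 'I_n.+1).
  by apply/funext => x /=; rewrite /rV_coord mxE.
exact: measurable_rV_coord.
Qed.

Section step.
Variables (n : nat)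
  (m1 : {sigma_finite_measure set (measurableTypeR R) -> \bar R})
  (m : {sigma_finite_measure set 'rV[R]_n -> \bar R}).

Definition lebesgue_rV_step : set 'rV[R]_n.+1 -> \bar R :=
  pushforward (m1 \x m)%E (@rV_cons n).

Let push : {measure set 'rV[R]_n.+1 -> \bar R} :=
  @measure_function_pushforward__canonical__measure_function_Measure
    _ _ _ _ R (m1 \x m)%E (@rV_cons n) (@measurable_rV_cons n).

HB.instance Definition _ := isMeasure.Build _ _ _ lebesgue_rV_step
  (measure0 push) (measure_ge0 push) (@measure_semi_sigma_additive _ _ _ push).

Let step_sigma_finite : sigma_finite setT lebesgue_rV_step.
Proof.
have /sigma_finiteP[F [TF ndF Foo]] := sigma_finiteT m1.
have /sigma_finiteP[G [TG ndG Goo]] := sigma_finiteT m.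
exists (fun k => @rV_uncons n @^-1` (F k `*` G k)).
  apply/esym; rewrite -subTset => x _.
  have [k _ Fk] : (\bigcup_k F k) (x ord0 ord0) by rewrite -TF.
  have [l _ Gl] : (\bigcup_l G l) (@rsubmx _ 1 1 n x) by rewrite -TG.
  exists (maxn k l) => //; split.
    by move: Fk; exact/subsetPset/ndF/leq_maxl.
  by move: Gl; exact/subsetPset/ndG/leq_maxr.
move=> k; have [mF Fk] := Foo k; have [mG Gk] := Goo k; split.
  rewrite -[X in measurable X]setTI; apply: measurable_rV_uncons => //.
  exact: measurableX.
rewrite /lebesgue_rV_step /pushforward -comp_preimage.
rewrite (_ : _ \o _ = id) ?preimage_id; last exact/funext/rV_consK.
by rewrite product_measure1E// lte_mul_pinfty// ge0_fin_numE.
Qed.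

HB.instance Definition _ :=
  Measure_isSigmaFinite.Build _ _ _ lebesgue_rV_step step_sigma_finite.

End step.

(* Lebesgue measure on R^n, by iterated products; see lebesgue_rV_box. *)
Fixpoint lebesgue_rV n : {sigma_finite_measure set 'rV[R]_n -> \bar R} :=
  match n with
  | 0%N => dirac (0 : 'rV[R]_0)
  | n'.+1 => lebesgue_rV_step lebesgue_measure (lebesgue_rV n')
  end.

Lemma measurable_rV_box n (A : 'I_n -> set (measurableTypeR R)) :
  (forall i, measurable (A i)) ->
  measurable [set x : 'rV[R]_n | forall i, A i (x ord0 i)].
Proof.
move=> mA; rewrite (_ : mkset _ = \bigcap_(i in [set: 'I_n]) (rV_coord i @^-1` A i)).
  apply: fin_bigcap_measurable => [|i _]; first exact: finite_finset.
  by rewrite -[X in measurable X]setTI; exact: measurable_rV_coord.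
by apply/seteqP; split=> x /= Ax i => [_|]; exact: Ax.
Qed.

Lemma lebesgue_rV_box n (A : 'I_n -> set (measurableTypeR R)) :
  (forall i, measurable (A i)) ->
  lebesgue_rV n [set x | forall i, A i (x ord0 i)] =
  (\prod_(i < n) lebesgue_measure (A i))%E.
Proof.
elim: n A => [|n ih] A mA.
  rewrite big_ord0 /= diracE mem_set// => -[] //.
rewrite big_ord_recl -ih; last by move=> i; exact: mA.
rewrite /= /lebesgue_rV_step /pushforward.
rewrite (_ : _ @^-1` _ =
    A ord0 `*` [set x : 'rV[R]_n | forall i, A (lift ord0 i) (x ord0 i)]).
  rewrite product_measure1E//.
  by apply: (@measurable_rV_box n (fun i => A (lift ord0 i))) => i; exact: mA.
apply/seteqP; split=> -[t x] /=.
  move=> Atx; split=> [|i].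
    by move: (Atx ord0); rewrite [X in A _ X](congr1 fst (rV_consK (t, x))).
  have := Atx (lift ord0 i); rewrite /rV_cons.
  have -> : lift ord0 i = rshift 1 i by apply/val_inj.
  by rewrite (@row_mxEr _ 1 1 n).
move=> [At Ax] i; case: (unliftP ord0 i) => [j|] ->.
  have := Ax j; rewrite /rV_cons.
  have -> : lift ord0 j = rshift 1 j by apply/val_inj.
  by rewrite (@row_mxEr _ 1 1 n).
by rewrite [X in A _ X](congr1 fst (rV_consK (t, x))).
Qed.

End lebesgue_measure_rV.

Section euclidean.
Context {R : realType} {d : nat}.
Implicit Types x y : 'rV[R]_d.

Definition ebasis (i : 'I_d) : 'rV[R]_d := delta_mx ord0 i.

Definition dot x y : R := \sum_(i < d) x ord0 i * y ord0 i.

(* The library norm on 'rV[R]_d is the maximum norm. *)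
Definition enorm x : R := Num.sqrt (dot x x).

Definition mxapp (A : 'M[R]_d) x : 'rV[R]_d := (A *m x^T)^T.

End euclidean.

Section smooth.
Context {R : realType}.

Fixpoint Cn (k n : nat) (f : 'rV[R]_n -> R) : Prop :=
  match k with
  | 0%N => continuous f
  | k'.+1 => continuous f /\
      forall i, (forall x, derivable f x (ebasis i)) /\
                Cn k' (fun x => 'D_(ebasis i) f x)
  end.

Definition smooth n (f : 'rV[R]_n -> R) := forall k, Cn k f.

(* Near each boundary point, after relabelling (j) and possibly reversing (s)
   a coordinate axis, the open set Omega is the strict epigraph of a smooth
   function of the d - 1 other coordinates. *)
Definition smooth_boundary d (Omega : set 'rV[R]_d) :=
  forall x0, closure Omega x0 -> ~ Omega x0 ->
  exists (j : 'I_d) (s : bool) (gamma : 'rV[R]_d.-1 -> R),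
    smooth gamma /\
    \forall x \near x0, Omega x <-> gamma (col' j x) < (-1) ^+ s * x ord0 j.

End smooth.

Section sobolev.
Context {R : realType} {d : nat}.
Variable Omega : set 'rV[R]_d.
Local Notation leb := (lebesgue_rV d).
Implicit Types u v w f phi : 'rV[R]_d -> R.

(* Lebesgue measurability on Omega: equality almost everywhere with a Borel
   function. Integrals of nonnegative functions are defined in the library for
   all functions, as suprema over simple functions below, and agree for two
   functions that are equal almost everywhere. *)
Definition lmeasurable f :=
  exists2 f', measurable_fun [set: 'rV[R]_d] f' & f = f' %[ae leb in Omega].

Definition Lpnorm (p : R) f : \bar R := 'N[leb]_(p%:E)[EFin \o (f \_ Omega)].

Definition Lp (p : R) f := lmeasurable f /\ (Lpnorm p f < +oo)%E.

Definition test_fun phi :=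
  [/\ smooth phi, compact (closure [set x | phi x != 0]) &
      closure [set x | phi x != 0] `<=` Omega].

Definition loc_integrable f := lmeasurable f /\
  forall K, compact K -> K `<=` Omega -> (\int[leb]_(x in K) `|f x|%:E < +oo)%E.

Definition is_weak_pd (i : 'I_d) u w :=
  [/\ loc_integrable u, loc_integrable w &
    forall phi, test_fun phi ->
      (\int[leb]_(x in Omega) (u x * 'D_(ebasis i) phi x)%:E =
       - \int[leb]_(x in Omega) (w x * phi x)%:E)%E].

(* The weak partial derivative, unique up to equality almost everywhere;
   the junk value 0 is taken when it does not exist. *)
Definition weak_pd (i : 'I_d) u : 'rV[R]_d -> R :=
  xget (fun=> 0) [set w | is_weak_pd i u w].

Definition weak_grad u (x : 'rV[R]_d) : 'rV[R]_d := \row_i weak_pd i u x.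

Definition H1 u := Lp 2 u /\ forall i, exists2 w, is_weak_pd i u w & Lp 2 w.

Definition H1norm u : \bar R :=
  sqrte (Lpnorm 2 u ^+ 2 + Lpnorm 2 (enorm \o weak_grad u) ^+ 2)%E.

(* The closure of the test functions in H1. *)
Definition H10 u := H1 u /\
  forall e : R, 0 < e -> exists2 phi, test_fun phi & (H1norm (u \- phi)%R < e%:E)%E.

(* u in H10 solves - div (A grad u) + g(u) = f weakly. *)
Definition weak_solution (A : 'rV[R]_d -> 'M[R]_d) (g : R -> R) f u :=
  H10 u /\
  forall v, H10 v ->
    (\int[leb]_(x in Omega) (dot (mxapp (A x) (weak_grad u x)) (weak_grad v x))%:E
     + \int[leb]_(x in Omega) (g (u x) * v x)%:E
     = \int[leb]_(x in Omega) (f x * v x)%:E)%E.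

End sobolev.

(* ps is the exponent 2^* and pc the exponent 2_*; for d = 2, ps is any real
   number >= 2. *)
Definition sobolev_exponents (R : realType) (d : nat) (ps pc : R) : Prop :=
  if d == 2%N then 2 <= ps /\ pc = ps / (ps - 1)
  else ps = 2 * d%:R / (d%:R - 2) /\ pc = 2 * d%:R / (d%:R + 2).

(* Main.v *)
Require Import Defs.
From mathcomp Require Import all_boot all_order all_algebra.
From mathcomp Require Import all_classical all_reals all_analysis.
From mathcomp Require Import measurable_realfun ring lra.

Set Implicit Arguments.
Unset Strict Implicit.
Unset Printing Implicit Defensive.
Import Order.TTheory GRing.Theory Num.Theory.
Import numFieldNormedType.Exports.
Local Open Scope classical_set_scope.
Local Open Scope ring_scope.

(** The equation is the Euler-Lagrange equation of the energy [J(u) = 1/2 (A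
    grad u, grad u) + int G(u) - int f u], where [G] is a primitive of the
    non-decreasing function [g]. Since [G] is convex and [A] is elliptic, [J] is
    strongly convex in the gradient: its defect of midpoint convexity dominates
    the squared gradient norm of the difference ([energy_midpoint]). A
    minimising sequence of test functions is therefore Cauchy for the gradient
    norm, so that no weak compactness is involved, and its limit solves the
    equation ([euler_lagrange_test], [pair_existence]). Uniqueness and the
    gradient bound come from testing with the difference of two solutions and
    with the solution, using that [g] is monotone ([pair_uniqueness],
    [pair_estimate]).

    A sequence that converges at a geometric rate in [L^p] has a dominating
    function in [L^p]: [|f_k - f| <= 2^-k M] almost everywhere
    ([fast_cauchy_cvg], [dcvg]). Along such sequences every passage to the
    limit, including the one in the nonlinear term of critical growth, is an
    instance of dominated convergence. This leads to [H10pair]: a function, a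
    gradient, and test functions that approximate both at a geometric rate. The
    members of H10 are exactly the functions that occur in such pairs
    ([H10pair_H10], [H10_H10pair]), and weak solutions can be described in terms
    of pairs ([weak_solution_pair]).

    On test functions, the gradient controls the function by the Sobolev
    inequality [sobolev_test], which is derived from the inequality of Gagliardo
    and Nirenberg applied to a power of the function; the latter is proved by
    induction on the dimension from the fundamental theorem of calculus on lines
    ([line_bound], [gagliardo_nirenberg]). Weak derivatives are unique by the
    fundamental lemma of the calculus of variations, for which [exp(-c/t)]
    provides smooth bumps converging to indicators of boxes
    ([fundamental_lemma]).

    The estimate is uniform in [eps] because the rescaled coefficients have the
    same ellipticity constant and the same bound; dilations preserve null sets
    ([ae_dilation]). The norm [K] of the linear functionals with densities [f]
    and [g 0] on H10 does not involve the coefficients ([pair_bound]), and the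
    gradient of the solution is bounded in terms of [K / lam]; the factor beside
    the constant in the theorem is at least one. The function [h] of the growth
    condition disappears by evaluation at one good point of the domain
    ([superposition_growth]). *)

(** * Integrals of functions equal almost everywhere *)

Section AeIntegral.
Context d (T : measurableType d) (R : realType).
Variable mu : {measure set T -> \bar R}.
Import HBNNSimple.

Lemma sup_sintegral_off_null_le (N : set T) (f g : T -> \bar R) :
  measurable N -> mu N = 0 -> (forall x, (0 <= g x)%E) ->
  (forall x, ~ N x -> (f x <= g x)%E) ->
  (ereal_sup [set sintegral mu h |
     h in [set h : {nnsfun T >-> R} | forall x, ((h x)%:E <= f x)%E]] <=
   ereal_sup [set sintegral mu h |
     h in [set h : {nnsfun T >-> R} | forall x, ((h x)%:E <= g x)%E]])%E.
Proof.
move=> mN N0 g0 fg; apply: ge_ereal_sup => _ [h /= hf <-].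
have mCN : measurable (~` N) by exact: measurableC.
apply: ereal_sup_ubound => /=; exists (proj_nnsfun h mCN) => [x|].
  rewrite /= /proj_nnsfun /=.
  rewrite /mindic. have [xN|xN] := pselect (N x).
    by rewrite indicE memNset ?mulr0//= => /(_ xN).
  by rewrite indicE mem_set ?mulr1// (le_trans (hf x))// fg.
rewrite -!integralT_nnsfun; apply: ge0_ae_eq_integral => //.
- by apply/measurable_EFinP; exact: measurable_funPT.
- by apply/measurable_EFinP; exact: measurable_funPT.
- by move=> x _; rewrite lee_fin.
- by move=> x _; rewrite lee_fin.
exists N; split => // x /= hx; apply: contrapT => Nx; apply: hx => _.
by rewrite /comp /= /mindic indicE mem_set ?mulr1.
Qed.

(** Holds for non-measurable functions as well: every simple function below [f]
    can be set to zero on the exceptional null set, where it is below [g], without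
    changing its integral.  The integrals in the notion of weak solution are of
    this kind, their integrands being Borel only up to null sets. *)
Lemma ae_eq_integral_any (D : set T) (f g : T -> \bar R) :
  f = g %[ae mu in D] -> (\int[mu]_(x in D) f x = \int[mu]_(x in D) g x)%E.
Proof.
move=> [N [mN N0 fgN]].
have fg x : ~ N x -> D x -> f x = g x.
  by move=> Nx Dx; apply: contrapT => e; apply: Nx; apply: fgN => /(_ Dx).
have e x : ~ N x -> (f \_ D) x = (g \_ D) x.
  by move=> Nx; rewrite !patchE; case: ifPn => // /[!inE] /(fg _ Nx).
rewrite /integral; congr (_ - _)%E; apply/eqP; rewrite eq_le;
  apply/andP; split; apply: (@sup_sintegral_off_null_le N) => // x /e;
  by rewrite ?funeposE ?funenegE => ->.
Qed.

End AeIntegral.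

Section RealIntegral.
Context d (T : measurableType d) (R : realType).
Variables (mu : {measure set T -> \bar R}) (D : set T).
Hypothesis mD : measurable D.
Implicit Types (f g : T -> R).

Lemma le_integrable_ae f g : measurable_fun D f ->
  mu.-integrable D (EFin \o g) -> {ae mu, forall x, D x -> `|f x| <= g x} ->
  mu.-integrable D (EFin \o f).
Proof.
move=> mf ig fg; apply/integrableP; split; first exact/measurable_EFinP.
have mg : measurable_fun D g by apply/measurable_EFinP; exact: measurable_int ig.
apply: (@le_lt_trans _ _ (\int[mu]_(x in D) `|(g x)%:E|)%E); last first.
  by case/integrableP : ig.
apply: ae_ge0_le_integral => //.
- by do 2 apply: measurableT_comp => //.
- by do 2 apply: measurableT_comp => //.
apply: filterS fg => x h /h {}h.
by rewrite lee_fin (le_trans h)// ler_norm.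
Qed.

Lemma le_Rintegral_ae f g :
  mu.-integrable D (EFin \o f) -> mu.-integrable D (EFin \o g) ->
  {ae mu, forall x, D x -> f x <= g x} ->
  \int[mu]_(x in D) f x <= \int[mu]_(x in D) g x.
Proof.
move=> if_ ig fg; pose m x := Num.max (f x) (g x).
have mf : measurable_fun D f by apply/measurable_EFinP; exact: measurable_int if_.
have mg : measurable_fun D g by apply/measurable_EFinP; exact: measurable_int ig.
have mg_eq : {ae mu, forall x, D x -> m x = g x}.
  by apply: filterS fg => x h /h fx; rewrite /m max_r.
have im : mu.-integrable D (EFin \o m).
  apply: (@le_integrable_ae _ (fun x => `|g x|)).
  - exact: measurable_maxr.
  - exact: integrable_norm.
  - by apply: filterS mg_eq => x h /h ->.
have -> : \int[mu]_(x in D) g x = \int[mu]_(x in D) m x.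
  rewrite /Rintegral; congr fine; apply: ae_eq_integral_any.
  by apply: filterS mg_eq => x h /h ->.
by apply: le_Rintegral => // x _; rewrite /m le_max lexx.
Qed.

Lemma Rintegral_dominated_cvg (f_ : nat -> T -> R) f g :
  (forall n, measurable_fun D (f_ n)) -> measurable_fun D f ->
  mu.-integrable D (EFin \o g) ->
  {ae mu, forall x, D x -> f_ ^~ x @ \oo --> f x} ->
  (forall n, {ae mu, forall x, D x -> `|f_ n x| <= g x}) ->
  mu.-integrable D (EFin \o f) /\
  \int[mu]_(x in D) f_ n x @[n --> \oo] --> \int[mu]_(x in D) f x.
Proof.
move=> mf_ mf ig cf dom.
have [|||||i1 i2 i3] := @dominated_convergence _ _ _ mu D mD
  (fun n => EFin \o f_ n) (EFin \o f) (EFin \o g).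
- by move=> n; exact/measurable_EFinP.
- exact/measurable_EFinP.
- apply: filterS cf => x h /h {}h; apply: cvg_EFin => //; exact: nearW.
- exact: ig.
- apply: filterS (ae_foralln dom) => x h n Dx.
  by rewrite /= lee_fin h.
split => //.
have fi : (\int[mu]_(x in D) (EFin \o f) x)%E \is a fin_num.
  exact: integrable_fin_num.
by apply: fine_cvg; rewrite fineK.
Qed.

End RealIntegral.

(** * Fast Cauchy sequences in Lebesgue spaces *)

(** Both [u n - 2 C 2^-n] and [u n + 2 C 2^-n] are monotone, in opposite
    directions, and they enclose the limit. *)
Lemma geometric_increments_cvg (R : realType) (u : nat -> R) (C : R) :
  (forall n, `|u n.+1 - u n| <= C * 2^-1 ^+ n) ->
  exists l, u @ \oo --> l /\ forall n, `|u n - l| <= 2 * C * 2^-1 ^+ n.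
Proof.
move=> uC; pose e n : R := 2 * C * 2^-1 ^+ n.
have eS n : e n = e n.+1 + C * 2^-1 ^+ n by rewrite /e exprS; field.
have e0 n : 0 <= e n.
  by have := le_trans (normr_ge0 _) (uC n); rewrite /e; nra.
have uS n : - (C * 2^-1 ^+ n) <= u n.+1 - u n <= C * 2^-1 ^+ n.
  by rewrite -ler_norml.
have incr : {homo (fun n => u n - e n) : n m / (n <= m)%N >-> n <= m}.
  by apply/nondecreasing_seqP => n; have /andP[] := uS n; have := eS n; lra.
have decr : {homo (fun n => u n + e n) : n m / (n <= m)%N >-> m <= n}.
  by apply/nonincreasing_seqP => n; have /andP[] := uS n; have := eS n; lra.
have c1 : cvgn (fun n => u n - e n).
  apply: nondecreasing_is_cvgn => //; exists (u 0%N + e 0%N) => _ [n _ <-].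
  by have := decr 0%N n isT; have := e0 n; lra.
have ecv : e @ \oo --> (0 : R).
  apply: (@cvg_geometric R (2 * C) 2^-1).
  by rewrite ger0_norm ?invr_ge0// invf_lt1// ltr1n.
pose l := limn (fun n => u n - e n).
have ul : u @ \oo --> l.
  have -> : u = (fun n => u n - e n) \+ e by apply/funext => n /=; rewrite subrK.
  by rewrite -[l]addr0; exact: cvgD.
exists l; split => // n; rewrite ler_norml.
have b1 : u n - e n <= l by exact: nondecreasing_cvgn_le.
have cu : u \+ e @ \oo --> l.
  by rewrite -[l]addr0; exact: cvgD.
have b2 : l <= u n + e n.
  have := nonincreasing_cvgn_ge decr (cvgP _ cu) n.
  by rewrite (cvg_lim _ cu).
by rewrite -/(e n); apply/andP; split; lra.
Qed.

Lemma measurable_powR_fun d (T : measurableType d) (R : realType) (D : set T)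
  (f : T -> R) (p : R) :
  measurable_fun D f -> measurable_fun D (fun x => f x `^ p).
Proof. by move=> mf; apply: (measurableT_comp (measurable_powR p) mf). Qed.

Lemma nneseries_half_le (R : realType) (c : R) : 0 <= c ->
  (\sum_(0 <= n <oo) (c * 2^-1 ^+ n)%:E <= (2 * c)%:E)%E.
Proof.
move=> c0; have h (n : nat) : 0 <= c * 2^-1 ^+ n.
  by rewrite mulr_ge0// exprn_ge0// invr_ge0.
apply: lime_le; first by apply: is_cvg_nneseries => n _ _; rewrite lee_fin.
apply: nearW => n; rewrite sumEFin lee_fin.
suff -> : \sum_(0 <= i < n) c * 2^-1 ^+ i = 2 * c - 2 * (c * 2^-1 ^+ n).
  by rewrite lerBlDr lerDl mulr_ge0.
elim: n => [|n ih]; first by rewrite big_nil expr0; ring.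
by rewrite big_nat_recr//= ih exprS; field.
Qed.

Section FastCauchy.
Context d (T : measurableType d) (R : realType).
Variables (mu : {measure set T -> \bar R}) (D : set T).
Hypothesis mD : measurable D.

(** Completeness of [L^p] together with a dominating function.  The trick is to
    dominate [2^n |f_(n+1) - f_n|] by the single function
    [(sum_n (2^n |f_(n+1) - f_n|)^p)^(1/p)], whose p-th power is integrable by
    monotone convergence alone, without Minkowski's inequality. *)
Lemma fast_cauchy_cvg (p K : R) (f : nat -> T -> R) :
  1 <= p -> 0 <= K -> (forall n, measurable_fun setT (f n)) ->
  (forall n, (\int[mu]_(x in D) (`|f n.+1 x - f n x| `^ p)%:E <=
     ((K * 4^-1 ^+ n) `^ p)%:E)%E) ->
  exists l M : T -> R, [/\ measurable_fun setT l, measurable_fun setT M,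
    forall x, 0 <= M x, (\int[mu]_(x in D) (M x `^ p)%:E < +oo)%E &
    forall n, {ae mu, forall x, D x -> `|f n x - l x| <= M x * 2^-1 ^+ n}].
Proof.
move=> p1 K0 mf fK.
have p0 : 0 < p by exact: lt_le_trans p1.
pose t n x : R := (2 ^+ n * `|f n.+1 x - f n x|) `^ p.
have t0 n x : (0 <= (t n x)%:E)%E by rewrite lee_fin powR_ge0.
have mt n : measurable_fun setT (fun x => (t n x)%:E).
  apply/measurable_EFinP/measurable_powR_fun.
  apply: measurable_funM => //; apply: measurableT_comp => //.
  exact: measurable_funB.
pose E x : \bar R := (\sum_(0 <= n <oo) (t n x)%:E)%E.
have E0 x : (0 <= E x)%E by exact: nneseries_ge0.
have mE : measurable_fun setT E.
  by apply: (@ge0_emeasurable_sum _ _ _ _ (fun n x => (t n x)%:E) xpredT).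
have iE : (\int[mu]_(x in D) E x < +oo)%E.
  rewrite integral_nneseries//; last by move=> n; exact: measurable_funTS.
  apply: (@le_lt_trans _ _ (\sum_(0 <= n <oo) (K `^ p * 2^-1 ^+ n)%:E)%E).
    apply: lee_nneseries => [n _ _|n _]; first exact: integral_ge0.
    rewrite (eq_integral (fun x =>
      ((2 ^+ n) `^ p)%:E * (`|f n.+1 x - f n x| `^ p)%:E)%E); last first.
      by move=> x _; rewrite /t powRM// ?exprn_ge0.
    rewrite ge0_integralZl_EFin//; last first.
      apply/measurable_EFinP/measurable_funTS/measurable_powR_fun.
      by apply: measurableT_comp => //; exact: measurable_funB.
    apply: (@le_trans _ _ (((2 ^+ n) `^ p)%:E * ((K * 4^-1 ^+ n) `^ p)%:E)%E).
      by apply: lee_wpmul2l; rewrite ?lee_fin ?powR_ge0.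
    rewrite -EFinM lee_fin -powRM ?exprn_ge0// ?mulr_ge0// ?exprn_ge0 ?invr_ge0//.
    have -> : 2 ^+ n * (K * 4^-1 ^+ n) = K * 2^-1 ^+ n.
      by rewrite mulrCA; congr (_ * _); rewrite -exprMn; congr (_ ^+ _); field.
    rewrite powRM// ?exprn_ge0 ?invr_ge0//.
    apply: ler_wpM2l; first exact: powR_ge0.
    rewrite -[leRHS]powRr1 ?exprn_ge0 ?invr_ge0//.
    by apply: ger_powR => //; rewrite exprn_gt0 ?invr_gt0//= exprn_ile1// invf_le1// ler1n.
  apply: (le_lt_trans (nneseries_half_le _)); last exact: ltry.
  exact: powR_ge0.
pose B := [set x | (E x < +oo)%E].
have mB : measurable B.
  rewrite -[B]setTI; exact: emeasurable_fun_infty_o.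
pose S x : R := (fine (E x)) `^ p^-1 * \1_B x.
have mS : measurable_fun setT S.
  apply: measurable_funM; last exact: measurable_indic.
  by apply: measurable_powR_fun; apply: measurableT_comp.
have S0 x : 0 <= S x by rewrite mulr_ge0 ?powR_ge0.
have SB x n : B x -> `|f n.+1 x - f n x| <= S x * 2^-1 ^+ n.
  move=> Bx; rewrite -ler_pdivrMr ?exprn_gt0 ?invr_gt0//.
  rewrite -exprVn invrK mulrC /S indicE mem_set// mulr1.
  have tE : t n x <= fine (E x).
    rewrite -lee_fin fineK; last by rewrite ge0_fin_numE.
    have := @nneseries_lim_ge _ (fun k => (t k x)%:E) xpredT 0 n.+1
      (fun k _ _ => t0 k x).
    apply: le_trans; rewrite big_nat_recr//= leeDr//.
    exact: sume_ge0.
  have := @ge0_ler_powR _ p^-1 _ _ _ _ _ tE; rewrite ?nnegrE.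
  rewrite -powRrM mulfV ?gt_eqF// powRr1 ?mulr_ge0 ?exprn_ge0//.
  by apply => //; rewrite ?invr_ge0 ?powR_ge0 ?fine_ge0// ltW.
pose g n x := f n x * \1_B x.
have gS x n : `|g n.+1 x - g n x| <= S x * 2^-1 ^+ n.
  rewrite /g -mulrBl normrM indicE; case: (boolP (x \in B)) => [/set_mem Bx|_].
    by rewrite normr1 mulr1 SB.
  by rewrite normr0 mulr0 mulr_ge0 ?exprn_ge0 ?invr_ge0.
have /choice[l lP] x := geometric_increments_cvg (gS x).
exists l, (fun x => 2 * S x); split.
- apply: (@measurable_fun_cvg _ _ _ _ g) => [n|x _]; last exact: (lP x).1.
  by apply: measurable_funM => //; exact: measurable_indic.
- exact: measurable_funM.
- by move=> x; rewrite mulr_ge0.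
- apply: (@le_lt_trans _ _ (\int[mu]_(x in D) ((2 `^ p)%:E * E x))%E).
    apply: ge0_le_integral => //.
    + by move=> x _; rewrite lee_fin powR_ge0.
    + apply/measurable_EFinP/measurable_funTS/measurable_powR_fun.
      exact: measurable_funM.
    + by apply: measurable_funTS; apply: measurable_funeM.
    move=> x _; rewrite powRM// EFinM; apply: lee_wpmul2l.
      by rewrite lee_fin powR_ge0.
    rewrite /S indicE; case: (boolP (x \in B)) => [/set_mem Bx|_].
      rewrite mulr1 -powRrM mulVf ?gt_eqF// powRr1 ?fine_ge0// fineK//.
      by rewrite ge0_fin_numE.
    by rewrite mulr0 powR0 ?gt_eqF.
  rewrite ge0_integralZl_EFin//; last exact: measurable_funTS.
  by rewrite lte_mul_pinfty// lee_fin powR_ge0.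
move=> n.
have : mu.-integrable D E.
  apply/integrableP; split; first exact: measurable_funTS.
  by under eq_integral => x _ do rewrite gee0_abs//.
move=> /(integrable_ae mD); apply: filterS => x h /h; rewrite ge0_fin_numE// => Bx.
have [_ /(_ n)] := lP x; rewrite /g indicE mem_set// mulr1.
by rewrite mulrAC.
Qed.
End FastCauchy.

(** * Borel sets of R^n *)

Section BorelRV.
Context {R : realType} {n : nat}.
Implicit Types (U : set 'rV[R]_n) (c x : 'rV[R]_n).

Definition obox c (e : R) : set 'rV[R]_n :=
  [set x | forall i, `|x ord0 i - c ord0 i| < e].

Definition cbox c (e : R) : set 'rV[R]_n :=
  [set x | forall i, `|x ord0 i - c ord0 i| <= e].

Lemma measurable_obox c e : measurable (obox c e).
Proof.
rewrite (_ : obox c e = [set x : 'rV[R]_n | forall i,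
    `](c ord0 i - e), (c ord0 i + e)[%classic (x ord0 i)]).
  apply: (@measurable_rV_box R n
    (fun i => `](c ord0 i - e), (c ord0 i + e)[%classic)) => i.
  exact: measurable_itv.
by apply/seteqP; split => x h i; move: (h i); rewrite /= in_itv/= -ltr_distlC distrC.
Qed.

Lemma nbhs_rVP U x : nbhs x U <-> exists2 e : R, 0 < e & obox x e `<=` U.
Proof.
rewrite -filter_from_ballE; split => -[e e0 h]; exists e => // y yx; apply: h.
  by split=> // i j; rewrite (ord1 i); have := yx j; rewrite /ball/= distrC.
by case: yx => _ yx i; have := yx ord0 i; rewrite /ball/= distrC.
Qed.

Let ratbox (p : 'rV[rat]_n * nat) := (map_mx (@ratr R) p.1, p.2.+1%:R^-1 : R).

(** Cubes with rational centres and radii [1/k] form a countable base; each is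
    taken with a closed cube of the same radius inside the open set, for use with
    compactness. *)
Lemma open_rV_boxes U : open U ->
  exists c : nat -> 'rV[R]_n, exists e : nat -> R, exists P : nat -> Prop,
    [/\ forall k, 0 < e k, forall k, P k -> cbox (c k) (e k) `<=` U &
        U `<=` \bigcup_(k in [set k | P k]) obox (c k) (e k)].
Proof.
move=> oU.
pose T := ('rV[rat]_n * nat)%type.
pose p k : T := odflt (0, 0%N) (unpickle k).
exists (fun k => (ratbox (p k)).1), (fun k => (ratbox (p k)).2),
  (fun k => cbox (ratbox (p k)).1 (ratbox (p k)).2 `<=` U); split => //.
- by move=> k; rewrite /ratbox/= invr_gt0 ltr0n.
- move=> x Ux; have /nbhs_rVP[e e0 eU] : nbhs x U by exact: open_nbhs_nbhs.
  have [k ke] : exists k : nat, k.+1%:R^-1 < e / 2 :> R.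
    have := @near_infty_natSinv_lt R (PosNum (divr_gt0 e0 (ltr0Sn R 1))).
    by case=> N _ /(_ N (leqnn N)) h; exists N.
  have k0 : 0 < k.+1%:R^-1 :> R by rewrite invr_gt0.
  have /choice[q qP] i : exists q : rat, `|x ord0 i - ratr q| < k.+1%:R^-1.
    have [|q] := @rat_in_itvoo R (x ord0 i - k.+1%:R^-1) (x ord0 i + k.+1%:R^-1).
      by rewrite ltrD2l gtrN.
    by rewrite in_itv/= -ltr_distlC; exists q.
  have pE : p (pickle ((\row_i q i, k) : T)) = (\row_i q i, k).
    by rewrite /p pickleK.
  exists (pickle ((\row_i q i, k) : T)) => /=; rewrite pE /ratbox /=.
    move=> y yq; apply: eU => i; have := yq i; have := qP i; rewrite !mxE.
    have := ler_distD (ratr (q i)) (y ord0 i) (x ord0 i).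
    move: (k.+1%:R^-1) ke => r ke h1 h2 h3; apply: (le_lt_trans h1).
    by rewrite (distrC (ratr (q i)) (x ord0 i)); lra.
  by move=> i; rewrite !mxE.
Qed.

Lemma open_measurable_rV U : open U -> measurable U.
Proof.
move=> oU; have [c [e [P [e0 PU UP]]]] := open_rV_boxes oU.
rewrite (_ : U = \bigcup_(k in [set k | P k]) obox (c k) (e k)).
  by apply: bigcup_measurable => k _; exact: measurable_obox.
apply/seteqP; split => // x [k Pk xk]; apply: (PU k Pk) => i.
exact/ltW/xk.
Qed.

Lemma closed_measurable_rV U : closed U -> measurable U.
Proof.
move=> cU; rewrite -[U]setCK; apply: measurableC; apply: open_measurable_rV.
exact: closed_openC.
Qed.

Lemma continuous_measurable_rV (f : 'rV[R]_n -> R) :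
  continuous f -> measurable_fun setT f.
Proof.
move=> cf; apply: (measurability _ (RGenOpens.measurableE R)).
move=> _ [_ [a [b ->] <-]]; rewrite setTI; apply: open_measurable_rV.
by apply: open_comp => [x _|]; [exact: cf|exact: interval_open].
Qed.

Lemma bounded_rV_measure U : bounded_set U ->
  exists r : R, U `<=` cbox 0 r /\ (lebesgue_rV n (cbox 0 r) < +oo)%E.
Proof.
move=> [M [Mr MU]]; exists (`|M| + 1); split.
  move=> x Ux i; rewrite mxE subr0.
  have /= h := MU (`|M| + 1).
  apply: le_trans (h _ _ Ux); last by rewrite (le_lt_trans (ler_norm M))// ltrDl.
  rewrite /Num.norm/= mx_normrE.
  by apply: (le_bigmax _ (fun ij => `|x ij.1 ij.2|) (ord0, i)).
rewrite (_ : cbox _ _ = [set x : 'rV[R]_n | forall i,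
    `[- (`|M| + 1), `|M| + 1]%classic (x ord0 i)]).
  rewrite (@lebesgue_rV_box R n (fun=> `[- (`|M| + 1), `|M| + 1]%classic)).
    suff /andP[] : ((0 <= \prod_(i < n) lebesgue_measure
        `[(- (`|M| + 1))%R, (`|M| + 1)%R])%E &&
      (\prod_(i < n) lebesgue_measure `[(- (`|M| + 1))%R, (`|M| + 1)%R] < +oo)%E)
      by [].
    elim/big_ind : _ => [|x y /andP[x0 xoo] /andP[y0 yoo]|i _].
    - by rewrite lee01 ltry.
    - by rewrite mule_ge0//= lte_mul_pinfty// ge0_fin_numE.
    - rewrite measure_ge0/= lebesgue_measure_itv/=; case: ifP => _ //.
      by rewrite -EFinB ltry.
  by move=> i; exact: measurable_itv.
by apply/seteqP; split => x h i; move: (h i); rewrite /= mxE subr0 in_itv/= ler_norml.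
Qed.

End BorelRV.

(** * Iterated integrals *)

Section IteratedIntegral.
Context {R : realType}.
Local Notation mu1 := (@lebesgue_measure R).

Lemma measurable_rV_cons2 n (t : measurableTypeR R) :
  measurable_fun setT (fun x : 'rV[R]_n => rV_cons (t, x)).
Proof.
apply: (measurableT_comp (@measurable_rV_cons R n)).
exact: measurable_fun_pair.
Qed.

Lemma integral_lebesgue_rVS n (F : 'rV[R]_n.+1 -> \bar R) :
  measurable_fun setT F -> (forall x, 0 <= F x)%E ->
  (\int[lebesgue_rV n.+1]_x F x =
   \int[mu1 \x lebesgue_rV n]_p F (rV_cons p))%E.
Proof.
move=> mF F0.
have h := @ge0_integral_pushforward _ _ _ _ R (@rV_cons R n)
  (@measurable_rV_cons R n) (mu1 \x lebesgue_rV n)%E setT F measurableT mF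
  (fun y _ => F0 y).
rewrite preimage_setT in h; rewrite -[RHS]h.
apply: eq_measure_integral => //; exact: measurable_rV_cons.
Qed.

Lemma tonelli_rVS n (F : 'rV[R]_n.+1 -> \bar R) :
  measurable_fun setT F -> (forall x, 0 <= F x)%E ->
  (\int[lebesgue_rV n.+1]_x F x =
   \int[mu1]_t \int[lebesgue_rV n]_x F (rV_cons (t, x)))%E.
Proof.
move=> mF F0; rewrite integral_lebesgue_rVS// fubini_tonelli1//.
exact: (measurableT_comp mF (@measurable_rV_cons R n)).
Qed.

Lemma tonelli_rVS' n (F : 'rV[R]_n.+1 -> \bar R) :
  measurable_fun setT F -> (forall x, 0 <= F x)%E ->
  (\int[lebesgue_rV n.+1]_x F x =
   \int[lebesgue_rV n]_x \int[mu1]_t F (rV_cons (t, x)))%E.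
Proof.
move=> mF F0; rewrite integral_lebesgue_rVS// fubini_tonelli2//.
exact: (measurableT_comp mF (@measurable_rV_cons R n)).
Qed.

Lemma measurable_section_integral n (F : 'rV[R]_n.+1 -> \bar R) :
  measurable_fun setT F -> (forall x, 0 <= F x)%E ->
  measurable_fun setT
    (fun t : measurableTypeR R => \int[lebesgue_rV n]_x F (rV_cons (t, x)))%E.
Proof.
move=> mF F0.
apply: (@measurable_fun_fubini_tonelli_F _ _ _ _ R (lebesgue_rV n)
  (F \o @rV_cons R n)); last by move=> p; exact: F0.
exact: (measurableT_comp mF (@measurable_rV_cons R n)).
Qed.

Lemma measurable_section_integral' n (F : 'rV[R]_n.+1 -> \bar R) :
  measurable_fun setT F -> (forall x, 0 <= F x)%E ->
  measurable_fun setT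
    (fun x : 'rV[R]_n => \int[mu1]_t F (rV_cons (t, x)))%E.
Proof.
move=> mF F0.
apply: (@measurable_fun_fubini_tonelli_G _ _ _ _ R mu1
  (F \o @rV_cons R n)); last by move=> p; exact: F0.
exact: (measurableT_comp mF (@measurable_rV_cons R n)).
Qed.

Definition setc n (i : 'I_n) (x : 'rV[R]_n) (s : R) : 'rV[R]_n :=
  \row_j (if j == i then s else x ord0 j).

Lemma rV_cons0 n (t : measurableTypeR R) (x : 'rV[R]_n) :
  rV_cons (t, x) ord0 ord0 = t.
Proof. exact: (congr1 fst (rV_consK (t, x))). Qed.

Lemma rV_consS n (t : measurableTypeR R) (x : 'rV[R]_n) (j : 'I_n) :
  rV_cons (t, x) ord0 (lift ord0 j) = x ord0 j.
Proof.
have -> : lift ord0 j = rshift 1 j by apply/val_inj.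
exact: (@row_mxEr _ 1 1 n).
Qed.

Lemma setc_cons0 n (t : measurableTypeR R) (x : 'rV[R]_n) s :
  setc ord0 (rV_cons (t, x)) s = rV_cons ((s : measurableTypeR R), x).
Proof.
apply/rowP => k; rewrite mxE; case: (unliftP ord0 k) => [j|] ->.
  by rewrite !rV_consS.
by rewrite eqxx rV_cons0.
Qed.

Lemma setc_consS n (t : measurableTypeR R) (x : 'rV[R]_n) s j :
  setc (lift ord0 j) (rV_cons (t, x)) s = rV_cons (t, setc j x s).
Proof.
apply/rowP => k; rewrite mxE; case: (unliftP ord0 k) => [l|] ->.
  by rewrite !rV_consS mxE (inj_eq lift_inj).
by rewrite !rV_cons0.
Qed.

End IteratedIntegral.

(** * The Gagliardo-Nirenberg inequality *)

(** Hoelder's inequality with upper bounds in place of norms, so that no root of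
    an integral appears. *)
Lemma hoelder_le d (T : measurableType d) (R : realType)
  (mu : {measure set T -> \bar R}) (f g : T -> R) (p q a b : R) :
  measurable_fun setT f -> measurable_fun setT g ->
  (forall x, 0 <= f x) -> (forall x, 0 <= g x) ->
  0 < p -> 0 < q -> p^-1 + q^-1 = 1 -> 0 <= a -> 0 <= b ->
  (\int[mu]_x (f x `^ p)%:E <= (a `^ p)%:E)%E ->
  (\int[mu]_x (g x `^ q)%:E <= (b `^ q)%:E)%E ->
  (\int[mu]_x (f x * g x)%:E <= (a * b)%:E)%E.
Proof.
move=> mf mg f0 g0 p0 q0 pq a0 b0 fa gb.
have norm_le (h : T -> R) (e c : R) : (forall x, 0 <= h x) -> 0 < e -> 0 <= c ->
    (\int[mu]_x (h x `^ e)%:E <= (c `^ e)%:E)%E ->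
    ('N[mu]_e%:E[EFin \o h] <= c%:E)%E.
  move=> h0 e0 c0 hc; rewrite unlock /=.
  have -> : c%:E = ((c `^ e)%:E `^ e^-1)%E.
    by rewrite poweR_EFin -powRrM mulfV ?gt_eqF// powRr1.
  have -> : (\int[mu]_x (`|(h x)%:E| `^ e) = \int[mu]_x (h x `^ e)%:E)%E.
    by apply: eq_integral => x _; rewrite gee0_abs ?lee_fin// poweR_EFin.
  apply: gt0_ler_poweR => //.
  - by rewrite invr_ge0 ltW.
  - rewrite in_itv/= leey andbT; apply: integral_ge0 => x _.
    by rewrite lee_fin powR_ge0.
  - by rewrite in_itv/= leey andbT lee_fin powR_ge0.
have := hoelder mu mf mg p0 q0 pq; rewrite Lnorm1.
under eq_integral do rewrite /= ger0_norm ?mulr_ge0//.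
move=> /le_trans; apply; rewrite EFinM.
by apply: lee_pmul; rewrite ?Lnorm_ge0//; exact: norm_le.
Qed.

Section GagliardoNirenberg.
Context {R : realType}.
Local Notation mu1 := (@lebesgue_measure R).

(** What is retained of a compactly supported function [w] and of the moduli
    [W i] of its partial derivatives: along every line parallel to an axis, [w]
    is at most the integral of the corresponding [W i].  This property passes
    to slices, which makes the induction on the dimension possible. *)
Definition line_bound n (w : 'rV[R]_n -> R) (W : 'I_n -> 'rV[R]_n -> R) :=
  [/\ measurable_fun setT w, forall i, measurable_fun setT (W i),
      forall x, 0 <= w x, forall i x, 0 <= W i x &
      forall i x, ((w x)%:E <= \int[mu1]_s (W i (setc i x s))%:E)%E].

Lemma line_bound_slice n (w : 'rV[R]_n.+1 -> R) W (t : measurableTypeR R) :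
  line_bound w W ->
  line_bound (fun x => w (rV_cons (t, x)))
             (fun j x => W (lift ord0 j) (rV_cons (t, x))).
Proof.
move=> [mw mW w0 W0 wW]; split => //.
- exact: (measurableT_comp mw (measurable_rV_cons2 t)).
- by move=> i; exact: (measurableT_comp (mW _) (measurable_rV_cons2 t)).
- move=> i x; apply: (le_trans (wW (lift ord0 i) _)).
  by under eq_integral do rewrite setc_consS.
Qed.

Definition total_variation n (W : 'I_n -> 'rV[R]_n -> R) : \bar R :=
  (\sum_(i < n) \int[lebesgue_rV n]_x (W i x)%:E)%E.

(** The weighted form is the one that can be proved by induction on the
    dimension: on a slice, the weight takes care of the derivative in the
    direction transversal to it. *)
Definition weighted_GN n := forall (w : 'rV[R]_n.+1 -> R) W (F : 'rV[R]_n.+1 -> R) r,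
  line_bound w W -> measurable_fun setT F -> (forall x, 0 <= F x) -> 0 < r ->
  (\int[lebesgue_rV n.+1]_x (F x)%:E <= r%:E)%E ->
  (\int[lebesgue_rV n.+1]_x (w x * F x `^ n.+1%:R^-1)%:E <=
   total_variation W * (r `^ n.+1%:R^-1)%:E)%E.

Lemma weighted_GN0 : weighted_GN 0.
Proof.
move=> w W F r [mw mW w0 W0 wW] mF F0 r0 Fr.
have wS x : ((w x)%:E <= total_variation W)%E.
  rewrite /total_variation big_ord_recl big_ord0 adde0 tonelli_rVS'//; last 2 first.
  - exact/measurable_EFinP.
  - by move=> y; rewrite lee_fin.
  rewrite integral_dirac//; last first.
    apply: (@measurable_section_integral' _ _ (fun x => (W ord0 x)%:E)).
      exact/measurable_EFinP.
    by move=> y; rewrite lee_fin.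
  rewrite diracE in_setT mul1e.
  have -> : x = rV_cons ((x ord0 ord0 : measurableTypeR R), 0).
    rewrite -[LHS]rV_unconsK; congr rV_cons; congr pair.
    by apply/rowP => -[].
  by have := wW ord0 (rV_cons ((x ord0 ord0 : measurableTypeR R), 0));
    under eq_integral do rewrite setc_cons0.
have S0 : (0 <= total_variation W)%E.
  by apply: sume_ge0 => i _; apply: integral_ge0 => x _; rewrite lee_fin.
rewrite invr1 powRr1; last exact: ltW.
apply: (@le_trans _ _ (\int[lebesgue_rV 1]_x (total_variation W * (F x)%:E))%E).
  apply: ge0_le_integral => //.
  - by move=> x _; rewrite lee_fin mulr_ge0 ?powR_ge0.
  - apply/measurable_EFinP/measurable_funM => //; exact: measurable_powR_fun.
  - by apply: emeasurable_funM => //; exact/measurable_EFinP.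
  - move=> x _; rewrite powRr1// EFinM; apply: lee_wpmul2r => //.
    by rewrite lee_fin.
rewrite ge0_integralZl//.
- exact: lee_wpmul2l.
- exact/measurable_EFinP.
- by move=> x _; rewrite lee_fin.
Qed.

(** The weighted inequality on the slices [t = const], with weight the integral
    of [W ord0] over the remaining coordinate, which dominates [w]. *)
Lemma GN_step n : weighted_GN n ->
  forall (w : 'rV[R]_n.+2 -> R) W s, line_bound w W -> 0 < s ->
  (total_variation W <= s%:E)%E ->
  (\int[lebesgue_rV n.+2]_x (w x `^ (1 + n.+1%:R^-1))%:E <=
   (s `^ (1 + n.+1%:R^-1))%:E)%E.
Proof.
move=> ih w W s lw s0 Ws; have [mw mW w0 W0 wW] := lw.
set c := n.+1%:R^-1.
have c0 : 0 <= c by rewrite invr_ge0.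
pose F x := (\int[mu1]_t (W ord0 (rV_cons (t, x)))%:E)%E.
have mWE i : measurable_fun setT (fun x => (W i x)%:E) by exact/measurable_EFinP.
have WE0 i x : (0 <= (W i x)%:E)%E by rewrite lee_fin.
have mF : measurable_fun setT F.
  exact: (@measurable_section_integral' _ _ (fun x => (W ord0 x)%:E)).
have F0 x : (0 <= F x)%E by exact: integral_ge0.
have sumE : total_variation W = (\int[lebesgue_rV n.+1]_x F x +
   \sum_(j < n.+1) \int[lebesgue_rV n.+2]_x (W (lift ord0 j) x)%:E)%E.
  by rewrite /total_variation big_ord_recl tonelli_rVS'.
have sum0 : (0 <= \sum_(j < n.+1)
    \int[lebesgue_rV n.+2]_x (W (lift ord0 j) x)%:E)%E.
  by apply: sume_ge0 => i _; exact: integral_ge0.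
have Fs : (\int[lebesgue_rV n.+1]_x F x <= s%:E)%E.
  by apply: le_trans Ws; rewrite sumE leeDl.
have sums : (\sum_(j < n.+1)
    \int[lebesgue_rV n.+2]_x (W (lift ord0 j) x)%:E <= s%:E)%E.
  by apply: le_trans Ws; rewrite sumE leeDr// integral_ge0.
have Ffin : {ae lebesgue_rV n.+1, forall x, setT x -> F x \is a fin_num}.
  apply: integrable_ae => //; apply/integrableP; split => //.
  under eq_integral => x _ do rewrite gee0_abs//.
  by rewrite (le_lt_trans Fs)// ltry.
have mF' : measurable_fun setT (fine \o F) by exact: measurableT_comp.
have mpow (m : nat) (g : 'rV[R]_m -> R) (p : R) : measurable_fun setT g ->
    measurable_fun setT (fun x => (g x `^ p)%:E).
  by move=> mg; apply/measurable_EFinP/measurable_powR_fun.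
rewrite tonelli_rVS//; last 2 first.
- exact: mpow.
- by move=> x; rewrite lee_fin powR_ge0.
have inner t : (\int[lebesgue_rV n.+1]_x (w (rV_cons (t, x)) `^ (1 + c))%:E <=
    total_variation (fun j x => W (lift ord0 j) (rV_cons (t, x))) *
    (s `^ c)%:E)%E.
  apply: le_trans (ih _ _ (fine \o F) s (line_bound_slice t lw) _ _ _ _) => //.
  - have [mwt _ _ _ _] := line_bound_slice t lw.
    apply: ae_ge0_le_integral => //.
    + by move=> x _; rewrite lee_fin powR_ge0.
    + exact: mpow.
    + by move=> x _; rewrite lee_fin mulr_ge0 ?powR_ge0.
    + apply/measurable_EFinP/measurable_funM => //.
      exact: measurable_powR_fun.
    apply: filterS Ffin => x /(_ I) xfin _.
    have wF : w (rV_cons (t, x)) <= fine (F x).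
      rewrite -lee_fin fineK//; have := wW ord0 (rV_cons (t, x)).
      by under eq_integral do rewrite setc_cons0.
    rewrite lee_fin powRD; last by rewrite paddr_eq0// oner_eq0.
    rewrite powRr1//; apply: ler_wpM2l => //.
    by apply: ge0_ler_powR => //; rewrite nnegrE ?fine_ge0.
  - by move=> x; rewrite /= fine_ge0.
  - apply: le_trans Fs; apply: ge0_le_integral => //.
    + by move=> x _; rewrite lee_fin fine_ge0.
    + exact/measurable_EFinP.
    + by move=> x _ /=; case: (F x) (F0 x) => [y|//|//] _ /=; rewrite ?leey.
apply: (@le_trans _ _ (\int[mu1]_t
    (total_variation (fun j x => W (lift ord0 j) (rV_cons (t, x))) *
    (s `^ c)%:E))%E).
  apply: ge0_le_integral => //.
  - by move=> t _; apply: integral_ge0 => x _; rewrite lee_fin powR_ge0.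
  - apply: (@measurable_section_integral _ _ (fun x => (w x `^ (1 + c))%:E)).
      exact: mpow.
    by move=> x; rewrite lee_fin powR_ge0.
  - apply: emeasurable_funM => //; apply: emeasurable_sum => j.
    exact: (@measurable_section_integral _ _ (fun x => (W (lift ord0 j) x)%:E)).
rewrite ge0_integralZr//; last 3 first.
- apply: emeasurable_sum => j.
  exact: (@measurable_section_integral _ _ (fun x => (W (lift ord0 j) x)%:E)).
- by move=> t _; apply: sume_ge0 => j _; exact: integral_ge0.
- by rewrite lee_fin powR_ge0.
rewrite ge0_integral_sum//; last 2 first.
- by move=> j;
  exact: (@measurable_section_integral _ _ (fun x => (W (lift ord0 j) x)%:E)).
- by move=> j t _; exact: integral_ge0.
rewrite powRD; last by rewrite (gt_eqF s0) implybT.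
rewrite powRr1 ?(ltW s0)// EFinM; apply: lee_wpmul2r; first by rewrite lee_fin powR_ge0.
by apply: le_trans sums; apply: lee_sum => j _; rewrite [leRHS]tonelli_rVS.
Qed.

(** Hoelder's inequality between the unweighted bound of [GN_step] and the
    weight. *)
Lemma weighted_GN_all n : weighted_GN n.
Proof.
elim: n => [|n ih]; first exact: weighted_GN0.
move=> w W F r lw mF F0 r0 Fr; have [mw mW w0 W0 wW] := lw.
have tv0 : (0 <= total_variation W)%E.
  by apply: sume_ge0 => i _; apply: integral_ge0 => x _; rewrite lee_fin.
have [fin|] := boolP (total_variation W \is a fin_num); last first.
  rewrite ge0_fin_numE// -leNgt leye_eq => /eqP ->.
  by rewrite mulyr gtr0_sg ?mul1e ?leey// powR_gt0.
(* the bound of the previous lemma holds with any real above the total variation *)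
suff h s : 0 < s -> (total_variation W <= s%:E)%E ->
    (\int[lebesgue_rV n.+2]_x (w x * F x `^ n.+2%:R^-1)%:E <=
      (s * r `^ n.+2%:R^-1)%:E)%E.
  have rc0 : 0 < r `^ n.+2%:R^-1 by rewrite powR_gt0.
  rewrite -(fineK fin) -EFinM; apply/lee_addgt0Pr => e e0.
  have := h (fine (total_variation W) + e / r `^ n.+2%:R^-1).
  rewrite mulrDl divfK ?gt_eqF// EFinD; apply.
    by rewrite ltr_wpDl ?divr_gt0 ?fine_ge0.
  by rewrite fineK// leeDl// lee_fin ltW// divr_gt0.
move=> {fin} s0 sW; have := GN_step ih lw s0 sW; set p := 1 + _ => hp.
have pE : p = n.+2%:R / n.+1%:R.
  by rewrite /p -[n.+2]addn1 natrD mulrDl divff ?mul1r.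
apply: (@hoelder_le _ _ _ _ _ _ p n.+2%:R) => //.
- exact: measurable_powR_fun.
- by move=> x; exact: powR_ge0.
- by rewrite pE divr_gt0.
- by rewrite pE invf_div -{2}[n.+2%:R^-1]mul1r -mulrDl natr1 divff.
- exact: ltW.
- exact: powR_ge0.
- under eq_integral do rewrite -powRrM mulVf// powRr1//.
  by rewrite -powRrM mulVf// powRr1// ltW.
Qed.

Lemma gagliardo_nirenberg n (w : 'rV[R]_n.+2 -> R) W s :
  line_bound w W -> 0 < s -> (total_variation W <= s%:E)%E ->
  (\int[lebesgue_rV n.+2]_x (w x `^ (1 + n.+1%:R^-1))%:E <=
   (s `^ (1 + n.+1%:R^-1))%:E)%E.
Proof. exact: (GN_step (@weighted_GN_all n)). Qed.

End GagliardoNirenberg.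

(** * Differentiation along lines *)

Section SignedPower.
Context {R : realType}.
Implicit Types (a s : R).

(** The signed power [sgn s * |s|^a], written so that it is visibly
    differentiable away from the origin. *)
Definition spow a s : R := s * (s ^+ 2) `^ ((a - 1) / 2).

Lemma sqr_powR s a : (s ^+ 2) `^ (a / 2) = `|s| `^ a.
Proof.
by rewrite -(real_normK (num_real s)) -powR_mulrn// -powRrM mulrC divfK.
Qed.

Lemma norm_spow a s : 0 < a -> `|spow a s| = `|s| `^ a.
Proof.
move=> a0; rewrite normrM sqr_powR (ger0_norm (powR_ge0 _ _)).
exact: mulr_powRB1.
Qed.

Lemma is_derive_sqpow_neq0 (b : R) s : s != 0 ->
  is_derive s 1 (fun s : R => (s ^+ 2) `^ b) (b * (s ^+ 2) `^ (b - 1) * (2 * s)).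
Proof.
move=> s0; apply: (@is_derive1_comp R (fun x => x `^ b) (fun s => s ^+ 2)).
  by apply: is_derive1_powR; rewrite exprn_even_gt0//= orbF.
rewrite (_ : (fun s : R => s ^+ 2) = (id : R -> R) ^+ 2) ?exprfctE//.
apply: (is_derive_eq (@is_deriveX _ _ _ 2 _ _ _ (is_derive_id _ _))).
by rewrite /= expr1 /GRing.scale/= mulr1.
Qed.

Lemma is_derive_continuous (f : R -> R) s (df : R) :
  is_derive s 1 f df -> {for s, continuous f}.
Proof.
move=> fs; apply: differentiable_continuous; apply/derivable1_diffP.
exact: ex_derive.
Qed.

Lemma spow_continuous a : 0 < a -> continuous (spow a).
Proof.
move=> a0 s; have [->|s0] := eqVneq s 0; last first.
  apply: (@continuousM _ _ id (fun s => (s ^+ 2) `^ ((a - 1) / 2))).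
    exact: cvg_id.
  exact: is_derive_continuous (is_derive_sqpow_neq0 _ s0).
apply/cvgrPdist_lt => e e0.
have d0 : 0 < e `^ a^-1 by rewrite powR_gt0.
near=> t; have te : `|t| < e `^ a^-1 by near: t; exact: (@nbhs0_lt R R).
rewrite {1}/spow mul0r sub0r normrN norm_spow//.
have := @gt0_ltr_powR _ a a0 `|t| (e `^ a^-1).
rewrite !nnegrE normr_ge0 ltW// -powRrM mulVf ?gt_eqF// powRr1 ?ltW//.
exact.
Unshelve. all: by end_near. Qed.

Lemma is_derive_normpow a s : 1 < a ->
  is_derive s 1 (fun s : R => `|s| `^ a) (a * spow (a - 1) s).
Proof.
move=> a1; have [->|s0] := eqVneq s 0; last first.
  rewrite (_ : (fun s => _) = (fun s => (s ^+ 2) `^ (a / 2))); last first.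
    by apply/funext => x; rewrite sqr_powR.
  apply: (is_derive_eq (is_derive_sqpow_neq0 (a / 2) s0)).
  rewrite /spow; have -> : a / 2 - 1 = (a - 1 - 1) / 2 by field.
  by field.
have a10 : 0 < a - 1 by rewrite subr_gt0.
(* the difference quotient at the origin is itself a signed power *)
have qE (h : R) : h^-1 *: (((fun s : R => `|s| `^ a) \o shift (0 : R))
    (h *: (1 : R)) - `|(0 : R)| `^ a) = spow (a - 1) h.
  have [->|h0] := eqVneq h 0.
    by rewrite invr0 scale0r /spow mul0r.
  rewrite /= addr0 normr0 powR0 ?subr0; last by rewrite gt_eqF// (lt_trans ltr01).
  rewrite /GRing.scale/= mulr1 -sqr_powR /spow.
  have -> : (a - 1 - 1) / 2 = a / 2 - 1 by field.
  rewrite -(@mulr_powRB1 _ (h ^+ 2) (a / 2)) ?sqr_ge0//; last first.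
    by rewrite divr_gt0// (lt_trans ltr01).
  by rewrite mulrA expr2 mulKf.
have c : spow (a - 1) h @[h --> (0 : R)^'] --> spow (a - 1) 0.
  exact: cvg_within_filter (@spow_continuous _ a10 0).
rewrite {2}/spow mul0r in c; rewrite {1}/spow mul0r mulr0.
apply: DeriveDef; rewrite /derivable /derive (funext qE); first by apply: cvgP c.
exact: cvg_lim c.
Qed.

End SignedPower.

Section LineFTC.
Context {R : realType}.
Local Notation mu1 := (@lebesgue_measure R).
Variables (F f : R -> R) (M : R).
Hypotheses (Ff : forall s : R, is_derive s 1 F (f s)) (cf : continuous f).
Hypothesis FM : forall s : R, M < `|s| -> F s = 0.

Lemma FTC_itv a b : a < b ->
  (\int[mu1]_(s in `[a, b]) (f s)%:E)%E = (F b - F a)%:E.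
Proof.
move=> ab; have cF : continuous F by move=> s; exact: is_derive_continuous (Ff s).
rewrite EFinB; apply: (@continuous_FTC2 R f F) => //.
- exact: continuous_subspaceT.
- split.
  + by move=> x _; exact: ex_derive.
  + by apply: cvg_at_right_filter; exact: cF.
  + by apply: cvg_at_left_filter; exact: cF.
- by move=> x _; rewrite derive1E; exact: derive_val.
Qed.

Lemma derivative_vanishes s : M < `|s| -> f s = 0.
Proof.
move=> Ms; rewrite -(derive_val (is_derive := Ff s)).
rewrite (@near_eq_derive _ _ _ F (cst 0)) ?derive_cst//.
have := @norm_continuous _ _ s.
move=> /(_ [set y | M < y]) /=.
move=> h; near=> y; apply: FM; near: y; apply: h.
exact: lt_nbhsr.
Unshelve. all: by end_near. Qed.

(** [F] vanishes far to the left, so that [F t] is the integral of [f] over a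
    bounded interval ending at [t]. *)
Lemma norm_le_integral_derivative t :
  (`|F t|%:E <= \int[mu1]_s `|f s|%:E)%E.
Proof.
pose a := Num.min t (- `|M|) - 1.
have at_ : a < t.
  by rewrite /a ltrBlDr (@le_lt_trans _ _ t) ?ltrDl// ge_min lexx.
have Fa : F a = 0.
  apply: FM; have aM : a < - `|M|.
    by rewrite /a ltrBlDr (@le_lt_trans _ _ (- `|M|)) ?ltrDl// ge_min lexx orbT.
  rewrite -normrN (lt_le_trans _ (ler_norm _))// ltrNr.
  by rewrite (lt_le_trans aM)// lerN2 ler_norm.
have := FTC_itv at_; rewrite Fa subr0 => h.
have mf : measurable_fun setT f by exact: continuous_measurable_fun.
rewrite -abse_EFin -h.
apply: (le_trans (le_abse_integral _ _ _)) => //.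
  by apply/measurable_EFinP; exact: measurable_funTS.
apply: ge0_subset_integral => //.
by apply/measurable_EFinP; exact: measurableT_comp.
Qed.

Lemma integral_derivative_eq0 : (\int[mu1]_s (f s)%:E)%E = 0%E.
Proof.
pose m : R := `|M| + 1.
have M0 := normr_ge0 M; have MM := ler_norm M.
have m0 : - m < m by rewrite /m; lra.
transitivity (\int[mu1]_(s in `[(- m)%R, m]) (f s)%:E)%E; last first.
  by rewrite FTC_itv// !FM ?subrr// ?normrN; rewrite ger0_norm /m; lra.
rewrite [RHS]integral_mkcond; apply: eq_integral => s _.
rewrite patchE; case: ifPn => // /negP sm.
rewrite derivative_vanishes// ltNge; apply/negP => sM; apply: sm.
by rewrite inE/= in_itv/= -ler_norml (le_trans sM)// /m; lra.
Qed.

End LineFTC.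

(** * Compactly supported functions of class C1 *)

Section ContinuityRV.
Context {R : realType}.

Lemma cvg_rV (T : Type) (F : set_system T) (FF : Filter F) n
  (f : T -> 'rV[R]_n) (l : 'rV[R]_n) :
  (forall i, f x ord0 i @[x --> F] --> l ord0 i) -> f @ F --> l.
Proof.
move=> h U /nbhs_rVP[e e0 eU]; rewrite /nbhs /= /fmap /=.
have : \forall x \near F, forall i, `|f x ord0 i - l ord0 i| < e.
  apply: filter_forall => i; have /cvgrPdist_lt/(_ e e0) := h i.
  by apply: filterS => x; rewrite distrC.
by apply: filterS => x xe; exact: eU.
Qed.

Lemma setc_continuous n (i : 'I_n) (x : 'rV[R]_n) : continuous (setc i x).
Proof.
move=> s; apply: cvg_rV => j; rewrite /setc mxE.
under eq_fun do rewrite mxE.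
by case: ifP => _; [exact: cvg_id|exact: cvg_cst].
Qed.

Lemma rV_cons_continuous2 n (t : R) :
  continuous (fun x : 'rV[R]_n => rV_cons ((t : measurableTypeR R), x)).
Proof.
move=> y; apply: (@cvg_rV _ _ (nbhs_filter y)) => k; case: (unliftP ord0 k) => [j|] ->.
  under eq_fun do rewrite rV_consS; rewrite rV_consS; exact: coord_continuous.
by under eq_fun do rewrite rV_cons0; rewrite rV_cons0; exact: cvg_cst.
Qed.

Lemma setc_add n (i : 'I_n) (x : 'rV[R]_n) s h :
  setc i x (h + s) = h *: ebasis i + setc i x s.
Proof.
apply/rowP => j; rewrite !mxE eqxx/=; case: eqP => _.
  by rewrite mulr1.
by rewrite mulr0 add0r.
Qed.

Lemma rV_cons_addS n (t h : R) (x : 'rV[R]_n) j :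
  rV_cons ((t : measurableTypeR R), h *: ebasis j + x) =
  h *: ebasis (lift ord0 j) + rV_cons ((t : measurableTypeR R), x).
Proof.
apply/rowP => k; case: (unliftP ord0 k) => [l|] ->.
  rewrite rV_consS mxE [RHS]mxE rV_consS; congr (_ + _).
  by rewrite !mxE (inj_eq lift_inj).
by rewrite rV_cons0 [RHS]mxE rV_cons0 !mxE /= mulr0 add0r.
Qed.

End ContinuityRV.

Section C1c.
Context {R : realType}.
Local Notation mu1 := (@lebesgue_measure R).

Definition pd n (i : 'I_n) (phi : 'rV[R]_n -> R) (x : 'rV[R]_n) : R :=
  'D_(ebasis i) phi x.

(** The support condition refers to a cube because cubes are stable under
    passing to slices and are shared by two functions and their product. *)
Definition C1c n (M : R) (phi : 'rV[R]_n -> R) :=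
  [/\ continuous phi, forall i x, derivable phi x (ebasis i),
      forall i, continuous (pd i phi) & forall x, ~ cbox 0 M x -> phi x = 0].

Lemma is_derive_line n (i : 'I_n) (phi : 'rV[R]_n -> R) x (s : R) :
  derivable phi (setc i x s) (ebasis i) ->
  is_derive s 1 (fun s => phi (setc i x s)) (pd i phi (setc i x s)).
Proof.
move=> dphi.
have e (h : R) : h^-1 *: (((fun s => phi (setc i x s)) \o shift s) (h *: (1 : R)) -
    phi (setc i x s)) =
    h^-1 *: ((phi \o shift (setc i x s)) (h *: ebasis i) - phi (setc i x s)).
  have -> : h *: (1 : R) = h by exact: mulr1.
  by rewrite /= setc_add.
by apply: DeriveDef; rewrite /derivable /pd /derive (funext e).
Qed.

Lemma slice_derivable n (phi : 'rV[R]_n.+1 -> R) (t : R) x j :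
  derivable phi (rV_cons ((t : measurableTypeR R), x)) (ebasis (lift ord0 j)) ->
  derivable (fun x => phi (rV_cons ((t : measurableTypeR R), x))) x (ebasis j) /\
  pd j (fun x => phi (rV_cons ((t : measurableTypeR R), x))) x =
  pd (lift ord0 j) phi (rV_cons ((t : measurableTypeR R), x)).
Proof.
move=> dphi; pose psi x := phi (rV_cons ((t : measurableTypeR R), x)).
have e (h : R) : h^-1 *: ((psi \o shift x) (h *: ebasis j) - psi x) =
    h^-1 *: ((phi \o shift (rV_cons ((t : measurableTypeR R), x)))
      (h *: ebasis (lift ord0 j)) - psi x).
  by rewrite /= /psi rV_cons_addS.
by split; rewrite /derivable /pd /derive (funext e).
Qed.

Lemma C1c_slice n (phi : 'rV[R]_n.+1 -> R) M (t : R) : C1c M phi ->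
  C1c M (fun x => phi (rV_cons ((t : measurableTypeR R), x))).
Proof.
move=> [c d cd phiM]; split.
- move=> x; apply: (@continuous_comp _ _ _ (fun x => rV_cons (_, x)) phi).
    exact: rV_cons_continuous2.
  exact: c.
- by move=> i x; have [] := slice_derivable (d (lift ord0 i) (rV_cons (t, x))).
- move=> i; rewrite (_ : pd i _ = pd (lift ord0 i) phi \o (fun x => rV_cons (t, x))).
    move=> x; apply: continuous_comp; first exact: rV_cons_continuous2.
    exact: cd.
  by apply/funext => x; have [] := slice_derivable (d (lift ord0 i) (rV_cons (t, x))).
- move=> x xM; apply: phiM => xM'; apply: xM => i.
  by have := xM' (lift ord0 i); rewrite rV_consS !mxE.
Qed.

Lemma pd_vanishes n (phi : 'rV[R]_n -> R) M i x : C1c M phi ->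
  ~ cbox 0 M x -> pd i phi x = 0.
Proof.
move=> [c d cd phiM] /existsNP[j /negP]; rewrite -ltNge mxE subr0 => xj.
rewrite /pd (@near_eq_derive _ _ _ phi (cst 0)) ?derive_cst//.
apply/nbhs_rVP; exists (`|x ord0 j| - M); first by rewrite subr_gt0.
move=> y /(_ j) yx; apply: phiM => /(_ j); rewrite mxE subr0 => yM.
have := lerB_dist (x ord0 j) (y ord0 j); rewrite distrC => h.
by move: yx; rewrite ltNge => /negP; apply; lra.
Qed.

Lemma compact_cbox n (a : 'rV[R]_n) (M : R) : compact (cbox a M).
Proof.
rewrite (_ : cbox _ _ = [set x : 'rV[R]_n | forall i,
    `[(a ord0 i - M), (a ord0 i + M)]%classic (x ord0 i)]).
  by apply: (@rV_compact R n (fun i => `[(a ord0 i - M), (a ord0 i + M)]%classic)) => i;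
    exact: segment_compact.
by apply/seteqP; split => x h i; move: (h i); rewrite /= in_itv/= -ler_distlC distrC.
Qed.

Lemma continuous_supported_bounded n (psi : 'rV[R]_n -> R) M :
  continuous psi -> (forall x, ~ cbox 0 M x -> psi x = 0) ->
  exists2 B, 0 <= B & forall x, `|psi x| <= B.
Proof.
move=> cpsi psiM.
have /compact_bounded[B [_ hB]] : compact (psi @` cbox 0 M).
  apply: continuous_compact; last exact: compact_cbox.
  exact: continuous_subspaceT.
exists (`|B| + 1); first by rewrite addr_ge0.
move=> x; have [xM|/psiM->] := pselect (cbox 0 M x); last first.
  by rewrite normr0 addr_ge0.
apply: (hB (`|B| + 1)); last by exists x.
by rewrite (le_lt_trans (ler_norm B))// ltrDl.
Qed.

Lemma measurable_cbox n (a : 'rV[R]_n) (M : R) : measurable (cbox a M).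
Proof.
apply: closed_measurable_rV; apply: compact_closed; last exact: compact_cbox.
exact: norm_hausdorff.
Qed.

Lemma cbox_finite n (a : 'rV[R]_n) (M : R) : (lebesgue_rV n (cbox a M) < +oo)%E.
Proof.
have : bounded_set (cbox a M) by apply: compact_bounded; exact: compact_cbox.
move=> /bounded_rV_measure[r [MR]]; apply: le_lt_trans.
by apply: le_measure => //; rewrite inE; exact: measurable_cbox.
Qed.

Lemma continuous_supported_integrable n (psi : 'rV[R]_n -> R) M :
  continuous psi -> (forall x, ~ cbox 0 M x -> psi x = 0) ->
  (lebesgue_rV n).-integrable setT (EFin \o psi).
Proof.
move=> cpsi psiM; have [B B0 hB] := continuous_supported_bounded cpsi psiM.
have mpsi : measurable_fun setT psi by exact: continuous_measurable_rV.
rewrite (_ : EFin \o psi = (EFin \o psi) \_ (cbox 0 M)); last first.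
  apply/funext => x; rewrite patchE; case: ifPn => // /negP xM.
  by rewrite /= psiM// => h; apply: xM; rewrite inE.
apply/integrable_restrict => //; first exact: measurable_cbox.
rewrite setTI; apply: measurable_bounded_integrable => //.
- exact: measurable_cbox.
- exact: cbox_finite.
- exact: measurable_funTS.
- by exists B; split; [exact: num_real|move=> y By x _ /=; rewrite (le_trans (hB x))// ltW].
Qed.

Lemma fubini_rVS n (psi : 'rV[R]_n.+1 -> R) :
  (lebesgue_rV n.+1).-integrable setT (EFin \o psi) ->
  (\int[lebesgue_rV n.+1]_x (psi x)%:E =
   \int[mu1]_t \int[lebesgue_rV n]_x (psi (rV_cons (t, x)))%:E)%E /\
  (\int[lebesgue_rV n.+1]_x (psi x)%:E =
   \int[lebesgue_rV n]_x \int[mu1]_t (psi (rV_cons (t, x)))%:E)%E.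
Proof.
move=> ipsi; have mpsi := measurable_int _ ipsi.
have ip : (mu1 \x lebesgue_rV n)%E.-integrable setT
    ((EFin \o psi) \o @rV_cons R n).
  apply/integrableP; split.
    exact: (measurableT_comp mpsi (@measurable_rV_cons R n)).
  rewrite -(@integral_lebesgue_rVS _ _ (fun x => `|(psi x)%:E|)%E)//.
    by case/integrableP : ipsi.
  exact: measurableT_comp.
have E : (\int[lebesgue_rV n.+1]_x (psi x)%:E =
    \int[mu1 \x lebesgue_rV n]_p (psi (rV_cons p))%:E)%E.
  rewrite integralE [RHS]integralE.
  rewrite (integral_lebesgue_rVS (measurable_funepos mpsi))//.
  rewrite (integral_lebesgue_rVS (measurable_funeneg mpsi))//.
  by congr (_ - _)%E; apply: eq_integral => p _; rewrite ?funeposE ?funenegE.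
by split; rewrite E; [rewrite -(integral12_prod_meas1 ip)|
  rewrite -(integral21_prod_meas1 ip)].
Qed.

(** When one integrates first in the direction of differentiation, the inner
    integral is already zero. *)
Lemma integral_pd_eq0 n (phi : 'rV[R]_n -> R) M i : C1c M phi ->
  (\int[lebesgue_rV n]_x (pd i phi x)%:E = 0)%E.
Proof.
elim: n phi i => [phi [//]|n ih phi i Cphi].
have [c d cd phiM] := Cphi.
have int : (lebesgue_rV n.+1).-integrable setT (EFin \o pd i phi).
  apply: (@continuous_supported_integrable _ _ M) => //.
  by move=> x; exact: pd_vanishes.
have [F1 F2] := fubini_rVS int.
move: int F1 F2; case: (unliftP ord0 i) => [j|] -> int F1 F2.
  rewrite F1 integral0_eq// => t _.
  rewrite -[RHS](ih _ j (C1c_slice t Cphi)); apply: eq_integral => x _.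
  by rewrite (slice_derivable (d (lift ord0 j) (rV_cons (t, x)))).2.
rewrite F2 integral0_eq// => x _.
have := @integral_derivative_eq0 _
  (fun t : R => phi (setc ord0 (rV_cons ((0 : measurableTypeR R), x)) t))
  (fun t : R => pd ord0 phi (setc ord0 (rV_cons ((0 : measurableTypeR R), x)) t)) M.
under eq_integral do rewrite setc_cons0; apply.
- by move=> s; apply: is_derive_line.
- move=> s; apply: continuous_comp; first exact: setc_continuous.
  exact: cd.
- move=> s sM; apply: phiM => /(_ ord0); rewrite !mxE subr0.
  by rewrite leNgt sM.
Qed.

End C1c.

(** * Test functions *)

Section CnAlgebra.
Context {R : realType} {n : nat}.
Implicit Types (f g : 'rV[R]_n -> R).

Lemma CnS k f : Cn k.+1 f -> Cn k f.
Proof.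
elim: k f => [f []//|k ih f [cf df]].
by split=> // i; have [? ?] := df i; split => //; exact: ih.
Qed.

Lemma Cn_lin k (a : R) f g : Cn k f -> Cn k g -> Cn k (fun x => a * f x + g x).
Proof.
have clin (u v : 'rV[R]_n -> R) : continuous u -> continuous v ->
    continuous (fun x => a * u x + v x).
  move=> cu cv x; apply: (@continuousD _ _ _ (fun x => a * u x) v); last exact: cv.
  by apply: (@continuousM _ _ (cst a) u); [exact: cst_continuous|exact: cu].
elim: k f g => [|k ih] f g; first exact: clin.
move=> [cf df] [cg dg]; split; first exact: clin.
move=> i; have [f1 f2] := df i; have [g1 g2] := dg i.
have aff x : is_derive x (ebasis i) (fun x => a * f x + g x)
    (a * pd i f x + pd i g x).
  rewrite (_ : (fun x => _) = (a \*: f + g)); last by [].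
  apply: is_deriveD; [apply: is_deriveZ|]; exact: derivableP.
split; first by move=> x; exact: (ex_derive (is_derive := aff x)).
rewrite (_ : (fun x => _) = (fun x => a * pd i f x + pd i g x)); first exact: ih.
by apply/funext => x; exact: (derive_val (is_derive := aff x)).
Qed.

Lemma Cn_mul k f g : Cn k f -> Cn k g -> Cn k (fun x => f x * g x).
Proof.
elim: k f g => [|k ih] f g Cf Cg.
  by move=> x; apply: continuousM; [exact: Cf|exact: Cg].
have [cf df] := Cf; have [cg dg] := Cg; split.
  by move=> x; apply: continuousM; [exact: cf|exact: cg].
move=> i; have [f1 f2] := df i; have [g1 g2] := dg i.
have aff x : is_derive x (ebasis i) (fun x => f x * g x)
    (f x * pd i g x + g x * pd i f x).
  exact: (is_deriveM (derivableP (f1 x)) (derivableP (g1 x))).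
split; first by move=> x; exact: (ex_derive (is_derive := aff x)).
rewrite (_ : (fun x => _) =
    (fun x => 1 * (f x * pd i g x) + g x * pd i f x)); last first.
  apply/funext => x; rewrite mul1r.
  exact: (derive_val (is_derive := aff x)).
by apply: Cn_lin; [apply: (ih f (pd i g))|apply: (ih g (pd i f))] => //; exact: CnS.
Qed.

Lemma Cn_cst k (c : R) : Cn k (fun _ : 'rV[R]_n => c).
Proof.
elim: k c => [|k ih] c; first exact: cst_continuous.
split; first exact: cst_continuous.
move=> i; split; first by move=> x; exact: derivable_cst.
rewrite [X in Cn _ X](_ : _ = cst 0); first exact: (ih 0).
by apply/funext => x; rewrite derive_cst.
Qed.

End CnAlgebra.

Section TestFunctions.
Context {R : realType} {n : nat}.
Variable Omega : set 'rV[R]_n.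
Implicit Types (phi psi : 'rV[R]_n -> R).

Lemma test_fun_lin (a : R) phi psi : test_fun Omega phi -> test_fun Omega psi ->
  test_fun Omega (fun x => a * phi x + psi x).
Proof.
move=> [sf cf fO] [sg cg gO].
have sub : closure [set x | a * phi x + psi x != 0] `<=`
    closure [set x | phi x != 0] `|` closure [set x | psi x != 0].
  rewrite -closureU; apply: closureS => x /=.
  move=> h; have [fx|fx] := eqVneq (phi x) 0; last by left.
  by right; apply: contra_neq h => ->; rewrite fx mulr0 addr0.
split.
- by move=> k; apply: Cn_lin.
- apply: (subclosed_compact _ (compactU cf cg)) => //; exact: closed_closure.
- by move=> x /sub [/fO|/gO].
Qed.

Lemma test_fun0 : test_fun Omega (fun=> 0).
Proof.
have e : closure [set x : 'rV[R]_n | (fun=> 0 : R) x != 0] = set0.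
  rewrite (_ : mkset _ = set0) ?closure0//.
  by apply/seteqP; split => // x /=; rewrite eqxx.
split; rewrite ?e//; last exact: compact0.
by move=> k; exact: Cn_cst.
Qed.

Lemma pd_lin (a : R) phi psi i x : test_fun Omega phi -> test_fun Omega psi ->
  pd i (fun x => a * phi x + psi x) x = a * pd i phi x + pd i psi x.
Proof.
move=> [/(_ 1%N)/=[_ /(_ i)[df _]] _ _] [/(_ 1%N)/=[_ /(_ i)[dg _]] _ _].
rewrite /pd (_ : (fun x => _) = (a \*: phi + psi)) //.
by rewrite deriveD//; [rewrite deriveZ|exact: derivableZ].
Qed.

Lemma test_fun_C1c phi : test_fun Omega phi -> exists M, C1c M phi.
Proof.
move=> [/(_ 1%N)/=[cf df] /compact_bounded/bounded_rV_measure[M [BM _]] _].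
exists M; split => //.
- by move=> i x; exact: (df i).1.
- by move=> i; exact: (df i).2.
- move=> x xM; apply: contrapT => /eqP fx; apply: xM; apply: BM.
  exact: subset_closure.
Qed.

Lemma test_fun_out phi x : test_fun Omega phi -> ~ Omega x ->
  phi x = 0 /\ forall i, pd i phi x = 0.
Proof.
move=> [_ _ fO] Ox.
have xc : (~` closure [set x | phi x != 0]) x by move=> /fO.
have near0 : \near x, phi x = 0.
  have : open_nbhs x (~` closure [set x | phi x != 0]).
    by split => //; apply: closed_openC; exact: closed_closure.
  move=> /open_nbhs_nbhs; apply: filterS => y yc; apply: contrapT => /eqP fy.
  by apply: yc; exact: subset_closure.
split; first exact: nbhs_singleton near0.
by move=> i; rewrite /pd (@near_eq_derive _ _ _ phi (cst 0)) ?derive_cst.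
Qed.

Lemma test_fun_mul phi psi : test_fun Omega phi -> test_fun Omega psi ->
  test_fun Omega (fun x => phi x * psi x).
Proof.
move=> [sf cf fO] [sg _ _].
have sub : closure [set x | phi x * psi x != 0] `<=` closure [set x | phi x != 0].
  by apply: closureS => x /=; apply: contra_neq => ->; rewrite mul0r.
split; last exact: subset_trans fO.
- by move=> k; exact: Cn_mul.
- by apply: (subclosed_compact _ cf) => //; exact: closed_closure.
Qed.

Lemma pdM phi psi i x : test_fun Omega phi -> test_fun Omega psi ->
  pd i (fun x => phi x * psi x) x = phi x * pd i psi x + psi x * pd i phi x.
Proof.
move=> [/(_ 1%N)/=[_ /(_ i)[df _]] _ _] [/(_ 1%N)/=[_ /(_ i)[dg _]] _ _].
have D := is_deriveM (derivableP (df x)) (derivableP (dg x)).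
exact: (derive_val (is_derive := D)).
Qed.

Lemma integral_test_fun (F : 'rV[R]_n -> \bar R) :
  (forall x, ~ Omega x -> F x = 0%E) ->
  (\int[lebesgue_rV n]_(x in Omega) F x = \int[lebesgue_rV n]_x F x)%E.
Proof.
move=> F0; rewrite integral_mkcond; apply: eq_integral => x _.
by rewrite patchE; case: ifPn => // /negP xO; rewrite F0// => h; apply: xO; rewrite inE.
Qed.

(** The product rule, and the vanishing of the integral of a derivative. *)
Lemma integration_by_parts_pd phi psi i : test_fun Omega phi -> test_fun Omega psi ->
  (\int[lebesgue_rV n]_(x in Omega) (phi x * pd i psi x)%:E =
   - \int[lebesgue_rV n]_(x in Omega) (pd i phi x * psi x)%:E)%E.
Proof.
move=> tphi tpsi.
have [M [cf _ cdf fM]] := test_fun_C1c tphi.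
have [N [cg _ cdg gN]] := test_fun_C1c tpsi.
have [K CK] := test_fun_C1c (test_fun_mul tphi tpsi).
rewrite !integral_test_fun; last 2 first.
- by move=> x /(test_fun_out tpsi)[-> _]; rewrite mulr0.
- by move=> x /(test_fun_out tphi)[-> _]; rewrite mul0r.
have i1 : (lebesgue_rV n).-integrable setT (EFin \o (fun x => phi x * pd i psi x)).
  apply: (@continuous_supported_integrable _ _ _ M) => [x|x /fM /= ->].
    by apply: continuousM; [exact: cf|exact: cdg].
  by rewrite mul0r.
have i2 : (lebesgue_rV n).-integrable setT (EFin \o (fun x => pd i phi x * psi x)).
  apply: (@continuous_supported_integrable _ _ _ N) => [x|x /gN /= ->].
    by apply: continuousM; [exact: cdf|exact: cg].
  by rewrite mulr0.
have := integral_pd_eq0 i CK.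
under eq_integral do rewrite (pdM _ _ tphi tpsi) (mulrC (psi _)) EFinD.
rewrite (integralD _ i1 i2)// => h.
have f2 : (\int[lebesgue_rV n]_x (pd i phi x * psi x)%:E)%E \is a fin_num.
  exact: (@integrable_fin_num _ _ _ _ setT).
have f1 : (\int[lebesgue_rV n]_x (phi x * pd i psi x)%:E)%E \is a fin_num.
  exact: (@integrable_fin_num _ _ _ _ setT).
move: h; rewrite -(fineK f1) -(fineK f2) -EFinD -EFinN => -[/eqP].
by rewrite addr_eq0 => /eqP ->.
Qed.

End TestFunctions.

(** * The Sobolev inequality for test functions *)

Section Sobolev.
Context {R : realType}.

Lemma normpow_continuous (a : R) : 1 < a -> continuous (fun s : R => `|s| `^ a).
Proof. by move=> a1 s; exact: is_derive_continuous (is_derive_normpow s a1). Qed.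

Lemma setc_id n (i : 'I_n) (x : 'rV[R]_n) : setc i x (x ord0 i) = x.
Proof. by apply/rowP => j; rewrite mxE; case: eqP => [->|]. Qed.

(** Since [g > 1], the power of [|phi|] is differentiable along lines even where
    [phi] changes sign. *)
Lemma line_bound_normpow n (phi : 'rV[R]_n -> R) M (g : R) : 1 < g -> C1c M phi ->
  line_bound (fun x => `|phi x| `^ g)
    (fun i x => g * (`|phi x| `^ (g - 1) * `|pd i phi x|)).
Proof.
move=> g1 Cphi; have [c d cd phiM] := Cphi.
have g0 : 0 < g by exact: lt_trans g1.
have mphi : measurable_fun setT phi by exact: continuous_measurable_rV.
have mpd i : measurable_fun setT (pd i phi) by exact: continuous_measurable_rV.
split.
- by apply: measurable_powR_fun; exact: measurableT_comp.
- move=> i; apply: measurable_funM => //; apply: measurable_funM.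
    by apply: measurable_powR_fun; exact: measurableT_comp.
  exact: measurableT_comp.
- by move=> x; exact: powR_ge0.
- by move=> i x; rewrite mulr_ge0 ?mulr_ge0 ?powR_ge0// ltW.
move=> i x.
have := @norm_le_integral_derivative R
  (fun s => `|phi (setc i x s)| `^ g)
  (fun s => g * spow (g - 1) (phi (setc i x s)) * pd i phi (setc i x s))
  M _ _ _ (x ord0 i).
rewrite setc_id ger0_norm ?powR_ge0// => h.
apply: (le_trans (h _ _ _)) => {h}.
- move=> s; apply: (@is_derive1_comp R (fun s => `|s| `^ g)).
    exact: is_derive_normpow.
  exact: is_derive_line.
- move=> s; apply: (@continuousM _ _
    (fun s => g * spow (g - 1) (phi (setc i x s))) (fun s => pd i phi (setc i x s)));
    last by apply: continuous_comp; [exact: setc_continuous|exact: cd].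
  apply: (@continuousM _ _ (cst g)); first exact: cst_continuous.
  apply: (@continuous_comp _ _ _ (fun s => phi (setc i x s)) (spow (g - 1))).
    by apply: continuous_comp; [exact: setc_continuous|exact: c].
  by apply: spow_continuous; rewrite subr_gt0.
- move=> s sM; rewrite phiM ?normr0 ?powR0 ?gt_eqF// => /(_ i).
  by rewrite !mxE eqxx subr0 leNgt sM.
under eq_integral do rewrite 2!normrM (gtr0_norm g0) norm_spow ?subr_gt0// -mulrA.
by [].
Qed.

(** Trades the power [p] of [t = |phi x|] for the power [p + 2], below and above
    a height [K] that remains to be chosen. *)
Lemma powR_truncate (t p K : R) : 0 <= t -> 0 < p -> 0 < K ->
  t `^ p <= K `^ p + t `^ (p + 2) / K ^+ 2.
Proof.
move=> t0 p0 K0; have [tK|Kt] := leP t K.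
  rewrite -[leLHS]addr0 lerD ?divr_ge0 ?powR_ge0 ?sqr_ge0//.
  by apply: ge0_ler_powR => //; rewrite ?nnegrE ltW.
have t0' := lt_trans K0 Kt.
rewrite -[leLHS]add0r lerD ?powR_ge0// ler_pdivlMr ?exprn_gt0//.
rewrite powRD; last by rewrite (gt_eqF t0') implybT.
rewrite ler_wpM2l ?powR_ge0// powR_mulrn// ?ler_sqr ?nnegrE ?ltW//.
Qed.

Lemma integrable_normpow n (phi : 'rV[R]_n -> R) M (p : R) : 1 < p -> C1c M phi ->
  (lebesgue_rV n).-integrable setT (EFin \o (fun x => `|phi x| `^ p)).
Proof.
move=> p1 [c _ _ fM].
apply: (@continuous_supported_integrable _ _ _ M) => [x|x /fM ->].
  apply: (@continuous_comp _ _ _ phi (fun s : R => `|s| `^ p)); first exact: c.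
  exact: normpow_continuous.
by rewrite normr0 powR0// gt_eqF// (lt_trans ltr01).
Qed.

(** Gagliardo-Nirenberg applied to [|phi|^(p/2 + 1)], followed by the
    Cauchy-Schwarz inequality. *)
Lemma sobolev_power n (phi : 'rV[R]_n.+2 -> R) M (p N X : R) :
  2 <= p -> C1c M phi -> 0 < N -> 0 < X ->
  (\int[lebesgue_rV n.+2]_x (\sum_i (pd i phi x) ^+ 2)%:E <= (N ^+ 2)%:E)%E ->
  (\int[lebesgue_rV n.+2]_x (`|phi x| `^ p)%:E <= X%:E)%E ->
  (\int[lebesgue_rV n.+2]_x (`|phi x| `^ ((p / 2 + 1) * (1 + n.+1%:R^-1)))%:E <=
   (((n.+2%:R * (p / 2 + 1)) * (X `^ 2^-1 * N)) `^ (1 + n.+1%:R^-1))%:E)%E.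
Proof.
move=> p2 Cphi N0 X0 hN hX; have [c d cd phiM] := Cphi.
set g := p / 2 + 1.
have g1 : 1 < g by rewrite /g; lra.
have g0 : 0 < g by exact: lt_trans g1.
have mphi : measurable_fun setT phi by exact: continuous_measurable_rV.
have mpd i : measurable_fun setT (pd i phi) by exact: continuous_measurable_rV.
have := gagliardo_nirenberg (line_bound_normpow g1 Cphi).
under eq_integral do rewrite -powRrM.
apply.
  by rewrite !mulr_gt0 ?powR_gt0.
have pdN i : (\int[lebesgue_rV n.+2]_x (`|pd i phi x| `^ 2)%:E <= (N `^ 2)%:E)%E.
  rewrite (powR_mulrn _ (ltW N0)); apply: le_trans hN; apply: ge0_le_integral => //.
  - by apply/measurable_EFinP/measurable_powR_fun; exact: measurableT_comp.
  - apply/measurable_EFinP; apply: measurable_sum => j.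
    exact: measurable_funX.
  - move=> x _; rewrite lee_fin powR_mulrn// real_normK ?num_real//.
    rewrite (bigD1 i)//= lerDl sumr_ge0// => j _; exact: sqr_ge0.
have H i : (\int[lebesgue_rV n.+2]_x
    (g * (`|phi x| `^ (g - 1) * `|pd i phi x|))%:E <=
    (g * (X `^ 2^-1 * N))%:E)%E.
  have m1 : measurable_fun setT (fun x => `|phi x| `^ (g - 1)).
    by apply: measurable_powR_fun; exact: measurableT_comp.
  have m2 : measurable_fun setT (fun x => `|pd i phi x|) by exact: measurableT_comp.
  under eq_integral do rewrite EFinM.
  rewrite ge0_integralZl_EFin ?(ltW g0)//; last by apply/measurable_EFinP/measurable_funM.
  rewrite EFinM; apply: lee_wpmul2l; first by rewrite lee_fin ltW.
  apply: (@hoelder_le _ _ _ _ _ _ 2 2) => //.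
  - lra.
  - exact: powR_ge0.
  - exact: ltW.
  under eq_integral => x _.
    rewrite -powRrM (_ : (g - 1) * 2 = p); last by rewrite /g; field.
    over.
  by rewrite -powRrM mulVf// powRr1// ltW.
apply: (le_trans (lee_sum _ (fun i _ => H i))).
rewrite sumEFin lee_fin sumr_const card_ord.
by rewrite -[leLHS]mulr_natl (mulrA _ g).
Qed.

(** Absorbing the left-hand side when the exponents are critical. *)
Lemma absorb_power (X A e p : R) : 0 < X -> 0 < A -> 0 < e -> e < 2 ->
  p = e / (1 - e / 2) -> X <= (X `^ 2^-1 * A) `^ e -> X <= A `^ p.
Proof.
move=> X0 A0 e0 e2 -> XA; set b := 1 - e / 2.
have b0 : 0 < b by rewrite /b; lra.
have Xb : X `^ b <= A `^ e.
  rewrite -(ler_pM2l (powR_gt0 (e / 2) X0)) -powRD; last first.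
    by rewrite (gt_eqF X0) implybT.
  rewrite (_ : e / 2 + b = 1); last by rewrite /b; field.
  rewrite powRr1 ?(ltW X0)//; apply: le_trans XA _.
  by rewrite powRM ?powR_ge0 ?(ltW A0)// -powRrM (mulrC e).
have := @ge0_ler_powR _ b^-1 _ _ _ _ _ Xb; rewrite !nnegrE -!powRrM.
rewrite mulfV ?gt_eqF// powRr1 ?(ltW X0)//; apply; rewrite ?powR_ge0//.
by rewrite invr_ge0 ltW.
Qed.

Lemma sobolev_exponents_ge2 n (ps pc : R) :
  sobolev_exponents n.+2 ps pc -> 2 <= ps.
Proof.
rewrite /sobolev_exponents; case: n => [[]//|n] /= [-> _].
have n0 : 0 < n.+1%:R :> R by rewrite ltr0n.
rewrite (_ : n.+3%:R - 2 = n.+1%:R :> R); last by rewrite -!natr1; ring.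
by rewrite ler_pdivlMr// ler_pM2l// ler_nat; do 2 apply: leqW.
Qed.

Lemma critical_exponents (x : R) (p := 2 * (x + 2) / x) (e := 1 + (x + 1)^-1) :
  0 < x -> p = e / (1 - e / 2) /\ (p / 2 + 1) * e = p.
Proof.
move=> x0; have x1 : x != 0 by rewrite gt_eqF.
have x2 : x + 1 != 0 by rewrite gt_eqF//; lra.
by split; rewrite /p /e; field; rewrite ?x1 ?x2 ?andbT//=; rewrite gt_eqF//; lra.
Qed.

Definition sobolev_bound n (Omega : set 'rV[R]_n) (p C : R) :=
  forall phi N, test_fun Omega phi -> 0 < N ->
  (\int[lebesgue_rV n]_(x in Omega) (\sum_i (pd i phi x) ^+ 2)%:E <= (N ^+ 2)%:E)%E ->
  (\int[lebesgue_rV n]_(x in Omega) (`|phi x| `^ p)%:E <= ((C * N) `^ p)%:E)%E.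

(** In dimension at least three the exponents are critical, and [absorb_power]
    applies to [sobolev_power].  In dimension two, [sobolev_power] bounds the
    integral of [|phi|^(ps + 2)] by that of [|phi|^ps] times the squared gradient
    norm; truncation at a height proportional to the gradient norm makes the
    factor small enough to be absorbed, and the part below that height is
    integrated over a domain of finite measure. *)
Lemma sobolev_test n (Omega : set 'rV[R]_n.+2) (ps pc r : R) :
  sobolev_exponents n.+2 ps pc -> Omega `<=` cbox 0 r ->
  exists2 C, 0 < C & sobolev_bound Omega ps C.
Proof.
move=> exps Or; have ps2 := sobolev_exponents_ge2 exps.
pose c : R := n.+2%:R * (ps / 2 + 1).
have c0 : 0 < c by rewrite mulr_gt0//; lra.
pose V := fine (lebesgue_rV n.+2 (cbox 0 r)).
have VE : lebesgue_rV n.+2 (cbox 0 r) = V%:E.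
  by rewrite fineK// ge0_fin_numE//; exact: cbox_finite.
have V0 : 0 <= V by exact: fine_ge0.
pose C := 2 * c * (2 * V + 1) `^ ps^-1.
have V1 : 0 < 2 * V + 1 by lra.
have C0 : 0 < C by apply: mulr_gt0; [apply: mulr_gt0|apply: powR_gt0].
exists C => // phi N tphi N0; have [M Cphi] := test_fun_C1c tphi.
have ps0 : 0 < ps by lra.
rewrite (@integral_test_fun _ _ Omega (fun x => (\sum_i pd i phi x ^+ 2)%:E));
  last first.
  move=> x /(test_fun_out tphi)[_ p0]; rewrite big1// => i _.
  by rewrite p0 expr0n.
rewrite (@integral_test_fun _ _ Omega (fun x => (`|phi x| `^ ps)%:E)); last first.
  by move=> x /(test_fun_out tphi)[-> _]; rewrite normr0 powR0 ?gt_eqF.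
move=> hN.
have ips : (lebesgue_rV n.+2).-integrable setT (EFin \o (fun x => `|phi x| `^ ps)).
  by apply: (integrable_normpow _ Cphi); lra.
pose X := fine (\int[lebesgue_rV n.+2]_x (`|phi x| `^ ps)%:E)%E.
have XE : (\int[lebesgue_rV n.+2]_x (`|phi x| `^ ps)%:E)%E = X%:E.
  by rewrite fineK//; exact: (@integrable_fin_num _ _ _ _ setT).
have [X0|X0] := leP X 0; first by rewrite XE lee_fin (le_trans X0)// powR_ge0.
have A0 : 0 < c * N by rewrite mulr_gt0.
have := sobolev_power ps2 Cphi N0 X0 hN; rewrite XE => /(_ (lexx _)).
rewrite -/c (_ : c * (_ * _) = X `^ 2^-1 * (c * N)); last by ring.
rewrite lee_fin => hY.
case: n Omega exps Or @c c0 @V VE V0 @C V1 C0 phi tphi Cphi hN ips @X XE X0 A0 hY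
  => [|n] Omega exps Or c c0 V VE V0 C V1 C0 phi tphi Cphi hN ips X XE X0 A0 hY.
- (* Dimension two: at the height [K = 2 c N] the term to be absorbed is exactly
     one quarter of the left-hand side. *)
  have e2 : 1 + 1^-1 = 2 :> R by rewrite invr1.
  rewrite e2 in hY.
  pose K := 2 * (c * N).
  have K0 : 0 < K by rewrite mulr_gt0.
  have mphi : measurable_fun setT phi.
    by apply: continuous_measurable_rV; case: Cphi.
  have mp (e : R) : measurable_fun setT (fun x => `|phi x| `^ e).
    by apply: measurable_powR_fun; exact: measurableT_comp.
  pose B := cbox (0 : 'rV[R]_2) r.
  have mB : measurable B by exact: measurable_cbox.
  have XK : (X%:E <= (K `^ ps * V)%:E +
      ((X `^ 2^-1 * (c * N)) `^ 2 / K ^+ 2)%:E)%E.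
    rewrite -XE.
    apply: (@le_trans _ _ (\int[lebesgue_rV 2]_x ((K `^ ps * \1_B x)%:E +
        ((K ^+ 2)^-1)%:E * (`|phi x| `^ ((ps / 2 + 1) * 2))%:E))%E).
      apply: ge0_le_integral => //.
      - apply/measurable_EFinP; exact: mp.
      - apply: emeasurable_funD.
          by apply/measurable_EFinP/measurable_funM => //; exact: measurable_indic.
        by apply: measurable_funeM; apply/measurable_EFinP; exact: mp.
      move=> x _; rewrite -EFinM -EFinD lee_fin.
      have [xO|xO] := pselect (Omega x); last first.
        have [-> _] := test_fun_out tphi xO.
        by rewrite normr0 powR0 ?gt_eqF// addr_ge0 ?mulr_ge0 ?powR_ge0 ?invr_ge0 ?sqr_ge0.
      rewrite indicE mem_set ?mulr1; last exact: Or.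
      rewrite (_ : (ps / 2 + 1) * 2 = ps + 2); last by field.
      by rewrite [X in _ + X]mulrC; exact: powR_truncate.
    rewrite ge0_integralD//; last 4 first.
    - by move=> x _; rewrite lee_fin mulr_ge0 ?powR_ge0.
    - by apply/measurable_EFinP/measurable_funM => //; exact: measurable_indic.
    - by move=> x _; rewrite -EFinM lee_fin mulr_ge0 ?powR_ge0 ?invr_ge0 ?sqr_ge0.
    - by apply: measurable_funeM; apply/measurable_EFinP; exact: mp.
    apply: leeD.
      under eq_integral do rewrite EFinM.
      rewrite ge0_integralZl_EFin//; last 2 first.
      - by apply/measurable_EFinP; exact: measurable_indic.
      - exact: powR_ge0.
      by rewrite integral_indic// setIT EFinM -VE lexx.
    rewrite ge0_integralZl_EFin//; last 2 first.
    - by apply/measurable_EFinP; exact: mp.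
    - by rewrite invr_ge0 sqr_ge0.
    by rewrite [X in (_ <= X%:E)%E]mulrC EFinM; apply: lee_wpmul2l => //; rewrite lee_fin invr_ge0 sqr_ge0.
  move: XK; rewrite -EFinD lee_fin (powR_mulrn 2 (mulr_ge0 (powR_ge0 X 2^-1) (ltW A0))).
  have XX : (X `^ 2^-1) ^+ 2 = X.
    by rewrite -powR_mulrn ?powR_ge0// -powRrM mulVf// powRr1 ?(ltW X0).
  rewrite exprMn XX.
  rewrite (_ : X * (c * N) ^+ 2 / K ^+ 2 = X / 4); last first.
    by rewrite /K; field; rewrite (gt_eqF c0) (gt_eqF N0).
  move=> XV; have {}XV : X <= K `^ ps * (2 * V + 1).
    have := powR_ge0 K ps; nra.
  rewrite (le_trans XV)// (_ : C * N = K * (2 * V + 1) `^ ps^-1); last first.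
    by rewrite /C /K; ring.
  by rewrite powRM ?powR_ge0 ?(ltW K0)// -powRrM mulVf ?gt_eqF// powRr1 ?(ltW V1).
- have n0 : 0 < n.+1%:R :> R by rewrite ltr0n.
  have nE : n.+3%:R - 2 = n.+1%:R :> R by rewrite -!natr1; ring.
  move: exps; rewrite /sobolev_exponents/= nE => -[psE _].
  apply: (@le_trans _ _ ((c * N) `^ ps)); last first.
    apply: ge0_ler_powR; rewrite ?nnegrE ?(ltW A0) ?(ltW ps0)//.
      by rewrite mulr_ge0 ?(ltW C0) ?(ltW N0).
    have W1 : 1 <= (2 * V + 1) `^ ps^-1.
      have : 1 `^ ps^-1 <= (2 * V + 1) `^ ps^-1; last by rewrite powR1.
      apply: ge0_ler_powR; rewrite ?nnegrE ?invr_ge0 ?(ltW ps0) ?(ltW V1)//.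
      by lra.
    rewrite ler_pM2r// /C; move: ((2 * V + 1) `^ _) W1 => w W1; nra.
  have nn0 : 0 < n.+2%:R :> R by rewrite ltr0n.
  have E3 : n.+3%:R = n.+1%:R + 2 :> R by rewrite -!natr1; ring.
  have E2 : n.+2%:R = n.+1%:R + 1 :> R by rewrite -!natr1; ring.
  have e0 : 0 < 1 + n.+2%:R^-1 :> R by rewrite addr_gt0 ?invr_gt0.
  apply: (absorb_power X0 A0 e0).
  + rewrite (_ : 2 = 1 + 1); last by ring.
    by rewrite ltrD2l invf_lt1 ?ltr1n.
  + by rewrite psE E3 E2; exact: (critical_exponents n0).1.
  + move: hY; rewrite (_ : (ps / 2 + 1) * (1 + n.+2%:R^-1) = ps).
      by rewrite XE lee_fin.
    by rewrite psE E3 E2; exact: (critical_exponents n0).2.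
Qed.

End Sobolev.

(** * Smooth bumps *)

Section Eta.
Context {R : realType}.
Variables (c : R) (c0 : 0 < c).

(** The powers [t^-m] close the family under differentiation: the derivative
    [eta' m] is a combination of [eta m.+1] and [eta m.+2]. *)
Definition eta (m : nat) (t : R) : R :=
  if 0 < t then t^-1 ^+ m * expR (- (c * t^-1)) else 0.

Definition eta' (m : nat) (t : R) : R := c * eta m.+2 t - m%:R * eta m.+1 t.

Lemma eta_ge0 m t : 0 <= eta m t.
Proof.
by rewrite /eta; case: ifP => // t0; rewrite mulr_ge0 ?expR_ge0// exprn_ge0// invr_ge0 ltW.
Qed.

(** Decay at the origin, from [x^(m+1)/(m+1)! <= exp x] at [x = c/t]. *)
Lemma eta_le m : exists2 K, 0 < K & forall t, eta m t <= K * `|t|.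
Proof.
pose K : R := (m.+1)`!%:R / c ^+ m.+1.
have K0 : 0 < K by rewrite divr_gt0 ?exprn_gt0// ltr0n fact_gt0.
exists K => // t; rewrite /eta; case: ifP => t0; last by rewrite mulr_ge0// ltW.
rewrite gtr0_norm// expRN.
have ct : 0 < c * t^-1 by rewrite mulr_gt0 ?invr_gt0.
have h : (c * t^-1) ^+ m.+1 / (m.+1)`!%:R <= expR (c * t^-1).
  by apply: le_trans (expR_ge1Dxn m (ltW ct)); rewrite lerDr.
have f0 : 0 < (m.+1)`!%:R :> R by rewrite ltr0n fact_gt0.
rewrite ler_pdivrMr ?expR_gt0//.
have q0 : 0 < (c * t^-1) ^+ m.+1 / (m.+1)`!%:R by rewrite divr_gt0 ?exprn_gt0.
have Kt0 : 0 < K * t by rewrite mulr_gt0.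
apply: le_trans (ler_wpM2l (ltW Kt0) h).
rewrite /K exprMn le_eqVlt; apply/orP; left; apply/eqP.
have := expf_neq0 m.+1 (lt0r_neq0 c0); have := lt0r_neq0 f0; have := lt0r_neq0 t0.
rewrite (exprS t^-1); move: (t^-1 ^+ m) (c ^+ m.+1) (_`!%:R) => T C F t1 F1 C1.
by field; rewrite t1 F1 C1.
Qed.

Lemma eta_mulV m t : t^-1 * eta m t = eta m.+1 t.
Proof. by rewrite /eta; case: ifP => _; rewrite ?mulr0// mulrA exprS. Qed.

Lemma eta0 m : eta m 0 = 0.
Proof. by rewrite /eta ltxx. Qed.

Lemma eta_cvg0 m : eta m @ (0 : R) --> (0 : R).
Proof.
have [K K0 hK] := eta_le m; apply/cvgrPdist_lt => e e0; near=> t.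
rewrite sub0r normrN ger0_norm ?eta_ge0//; apply: (le_lt_trans (hK t)).
rewrite mulrC -ltr_pdivlMr//; near: t; apply: (@nbhs0_lt R R).
by rewrite divr_gt0.
Unshelve. all: by end_near. Qed.

Lemma is_derive_eta (m : nat) (t : R) : is_derive t 1 (eta m) (eta' m t).
Proof.
have [t0|t0|->] := ltgtP t 0.
- apply: (@near_eq_is_derive _ _ _ (cst 0)); last first.
    apply: (is_derive_eq (is_derive_cst _ _ _)).
    by rewrite /eta' /eta !ltNge (ltW t0)/= !mulr0 subr0.
  near=> s; have : s < 0 by near: s; exact: lt_nbhsl.
  by move=> s0; rewrite /eta [0 < s]ltNge (ltW s0).
- pose u (s : R) := s^-1 ^+ m * expR (- (c * s^-1)).
  apply: (@near_eq_is_derive _ _ _ u).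
    near=> s; have : 0 < s by near: s; exact: lt_nbhsr.
    by rewrite /eta /u => ->.
  have tn0 : t != 0 by rewrite gt_eqF.
  have dV : is_derive t 1 (fun s : R => s^-1) (- t ^- 2).
    have := @is_deriveV R id t 1 1 tn0 (is_derive_id _ _).
    by rewrite /GRing.scale/= mulr1.
  have dX : is_derive t 1 (fun s : R => s^-1 ^+ m) (m%:R * t^-1 ^+ m.-1 * (- t ^- 2)).
    have -> : (fun s : R => s^-1 ^+ m) = (fun s : R => s^-1) ^+ m.
      by apply/funext => s; rewrite exprfctE.
    exact: (@is_deriveX _ _ _ m _ _ _ dV).
  have dL : is_derive t 1 (fun s : R => - (c * s^-1)) (- (c * (- t ^- 2))).
    exact: (is_deriveN (is_deriveZ c dV)).
  have dE : is_derive t 1 (fun s : R => expR (- (c * s^-1)))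
      (expR (- (c * t^-1)) * (- (c * (- t ^- 2)))).
    exact: (@is_derive1_comp _ expR _ _ _ _ (is_derive_expR _) dL).
  apply: (is_derive_eq (is_deriveM dX dE)).
  rewrite /eta' /eta t0 /GRing.scale/=.
  rewrite -!exprVn.
  by case: m {u dX} => [|m] /=; rewrite !exprS; ring.
- have q (h : R) : h^-1 *: ((eta m \o shift (0 : R)) (h *: (1 : R)) - eta m 0) =
    eta m.+1 h.
    rewrite eta0 subr0 /= addr0 -eta_mulV; congr (_ * eta m _).
    exact: mulr1.
  have cv : eta m.+1 h @[h --> (0 : R)^'] --> (0 : R).
    exact: cvg_within_filter (@eta_cvg0 m.+1).
  rewrite /eta' !eta0 !mulr0 subr0.
  apply: DeriveDef; rewrite /derivable /derive (funext q); first by apply: cvgP cv.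
  exact: cvg_lim cv.
Unshelve. all: by end_near. Qed.

Lemma eta_continuous m : continuous (eta m).
Proof. by move=> t; exact: is_derive_continuous (is_derive_eta m t). Qed.

End Eta.

Section BumpRV.
Context {R : realType} {n : nat}.

Lemma is_derive_coord (H H' : R -> R) (s b : R) (i j : 'I_n) (x : 'rV[R]_n) :
  (forall t : R, is_derive t 1 H (H' t)) ->
  is_derive x (ebasis j) (fun x : 'rV[R]_n => H (s * x ord0 i + b))
    ((j == i)%:R * s * H' (s * x ord0 i + b)).
Proof.
move=> dH; have [->|ji] := eqVneq j i; last first.
  rewrite !mul0r; have q (h : R) : h^-1 *: (((fun x : 'rV[R]_n => H (s * x ord0 i + b))
      \o shift x) (h *: ebasis j) - H (s * x ord0 i + b)) = 0.
    by rewrite /= !mxE eqxx/= eq_sym (negbTE ji) mulr0 add0r subrr scaler0.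
  apply: DeriveDef; rewrite /derivable /derive (funext q).
    exact: is_cvg_cst.
  exact: lim_cst.
have dG : is_derive (x ord0 i : R) 1 (fun t => H (s * t + b))
    (H' (s * x ord0 i + b) * s).
  have dA : is_derive (x ord0 i : R) 1 (fun t : R => s * t + b) s.
    have := is_deriveD (is_deriveZ s (is_derive_id (x ord0 i : R) (1 : R)))
      (is_derive_cst b (x ord0 i : R) (1 : R)).
    by rewrite addr0 /GRing.scale/= mulr1.
  exact: (@is_derive1_comp R H (fun t => s * t + b) _ _ _ (dH _) dA).
have q (h : R) : h^-1 *: (((fun x : 'rV[R]_n => H (s * x ord0 i + b))
      \o shift x) (h *: ebasis i) - H (s * x ord0 i + b)) =
    h^-1 *: (((fun t => H (s * t + b)) \o shift (x ord0 i)) (h *: (1 : R)) -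
      H (s * x ord0 i + b)).
  by rewrite /= !mxE !eqxx.
rewrite mul1r mulrC; have [d1 d2] := dG.
by apply: DeriveDef; rewrite /derivable /derive (funext q).
Qed.

Lemma Cn_eta_coord (c : R) k m (s b : R) (i : 'I_n) : 0 < c ->
  Cn k (fun x : 'rV[R]_n => eta c m (s * x ord0 i + b)).
Proof.
move=> c0; have cont m' : continuous (fun x : 'rV[R]_n => eta c m' (s * x ord0 i + b)).
  move=> x; apply: (@continuous_comp _ _ _ (fun x : 'rV[R]_n => s * x ord0 i + b)).
    apply: (@continuousD _ _ _ (fun x : 'rV[R]_n => s * x ord0 i) (cst b)).
      apply: (@continuousM _ _ (cst s)); first exact: cst_continuous.
      exact: coord_continuous.
    exact: cst_continuous.
  exact: eta_continuous.
elim: k m => [|k ih] m; first exact: cont.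
split; first exact: cont.
move=> j; have D x := is_derive_coord s b i j x (is_derive_eta c0 m).
split; first by move=> x; exact: (ex_derive (is_derive := D x)).
rewrite [X in Cn _ X](_ : _ = fun x : 'rV[R]_n =>
   ((j == i)%:R * s * c) * eta c m.+2 (s * x ord0 i + b) +
   ((- ((j == i)%:R * s * m%:R)) * eta c m.+1 (s * x ord0 i + b) + 0)); last first.
  apply/funext => x; rewrite (derive_val (is_derive := D x)) /eta'; ring.
apply: Cn_lin; first exact: ih.
by apply: Cn_lin; [exact: ih|exact: Cn_cst].
Qed.

Definition rbox (l u : 'rV[R]_n) : set 'rV[R]_n :=
  [set x | forall i, l ord0 i < x ord0 i < u ord0 i].

(** As [c] tends to zero these functions tend to the indicator of the box. *)
Definition bump (l u : 'rV[R]_n) (c : R) (x : 'rV[R]_n) : R :=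
  \prod_(i < n) (eta c 0 (x ord0 i - l ord0 i) * eta c 0 (u ord0 i - x ord0 i)).

Lemma bump_smooth l u c : 0 < c -> smooth (bump l u c).
Proof.
move=> c0 k; rewrite /bump.
rewrite (_ : (fun x => _) = bump l u c)//.
have : forall s : seq 'I_n, Cn k (fun x : 'rV[R]_n => \prod_(i <- s)
    (eta c 0 (x ord0 i - l ord0 i) * eta c 0 (u ord0 i - x ord0 i))); last exact.
elim=> [|i s ih].
  by under eq_fun do rewrite big_nil; exact: Cn_cst.
under eq_fun do rewrite big_cons.
apply: (@Cn_mul _ _ _ (fun x => eta c 0 (x ord0 i - l ord0 i) *
  eta c 0 (u ord0 i - x ord0 i))) => //.
apply: Cn_mul.
  by under eq_fun do rewrite -[x in x - _]mul1r; exact: Cn_eta_coord.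
by under eq_fun do rewrite addrC -mulN1r; exact: Cn_eta_coord.
Qed.

Lemma bump_out l u c x : ~ rbox l u x -> bump l u c x = 0.
Proof.
move=> /existsNP[i /negP]; rewrite negb_and -!leNgt => /orP[h|h];
  rewrite /bump (bigD1 i)//= /eta !ltNge.
  by rewrite subr_le0 h/= !mul0r.
by rewrite [X in _ * (if ~~ X then _ else _)]subr_le0 h/= mulr0 mul0r.
Qed.

Lemma bump01 l u c x : 0 < c -> 0 <= bump l u c x <= 1.
Proof.
move=> c0; have e1 t : 0 <= eta c 0 t <= 1.
  rewrite eta_ge0/= /eta; case: ifP => // t0.
  by rewrite expr0 mul1r -expR0 ler_expR oppr_le0 mulr_ge0 ?invr_ge0 ?ltW.
have m1 (y z : R) : 0 <= y <= 1 -> 0 <= z <= 1 -> 0 <= y * z <= 1.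
  by move=> /andP[y0 y1] /andP[z0 z1]; rewrite mulr_ge0//= mulr_ile1.
apply: (big_ind (fun y => 0 <= y <= 1)) => //.
  by rewrite ler01 lexx.
by move=> i _; exact: m1.
Qed.

Lemma bump_cvg l u x : rbox l u x ->
  bump l u k.+1%:R^-1 x @[k --> \oo] --> (1 : R).
Proof.
move=> xlu.
have e1 (t : R) : 0 < t -> eta k.+1%:R^-1 0 t @[k --> \oo] --> (1 : R).
  move=> t0; rewrite -[X in _ --> X](@expR0 R).
  rewrite (_ : (fun k => _) = expR \o (fun k : nat => - (k.+1%:R^-1 * t^-1))); last first.
    by apply/funext => k; rewrite /eta t0 expr0 mul1r /=.
  apply: continuous_cvg; first exact: continuous_expR.
  rewrite -[X in _ --> X]oppr0; apply: cvgN; rewrite -(mul0r t^-1).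
  by apply: cvgM; [exact: cvg_harmonic|exact: cvg_cst].
rewrite [X in _ --> X](_ : _ = \prod_(i < n) (1 : R)); last by rewrite big1.
apply: cvg_big => [|i _]; first exact: mul_continuous.
have /andP[li ui] := xlu i.
by rewrite -[X in _ --> X]mulr1; apply: cvgM; apply: e1; rewrite subr_gt0.
Qed.

End BumpRV.

(** * The fundamental lemma of the calculus of variations *)

Section FundamentalLemma.
Context {R : realType} {n : nat}.
Local Notation leb := (lebesgue_rV n).
Implicit Types (l u a x : 'rV[R]_n).

Lemma bump_test_fun (Omega : set 'rV[R]_n) l u a (e c : R) : 0 < c ->
  rbox l u `<=` cbox a e -> cbox a e `<=` Omega -> test_fun Omega (bump l u c).
Proof.
move=> c0 lue eO.
have sub : closure [set x | bump l u c x != 0] `<=` cbox a e.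
  have cK : closed (cbox a e).
    by apply: compact_closed; [exact: norm_hausdorff|exact: compact_cbox].
  rewrite [X in _ `<=` X]((closure_id _).1 cK); apply: closureS => x /= fx.
  by apply: lue; apply: contrapT => /(@bump_out R n l u c x)/eqP; exact/negP.
split; first exact: bump_smooth.
  by apply: (@subclosed_compact _ _ (cbox a e)); [exact: closed_closure|exact: compact_cbox|exact: sub].
exact: subset_trans sub eO.
Qed.

Lemma rboxI l u l' u' : rbox l u `&` rbox l' u' =
  rbox (\row_i Num.max (l ord0 i) (l' ord0 i)) (\row_i Num.min (u ord0 i) (u' ord0 i)).
Proof.
apply/seteqP; split => [x [h h'] i|x h].
  have /andP[h1 h2] := h i; have /andP[h1' h2'] := h' i.
  by rewrite !mxE gt_max lt_min h1 h1' h2 h2'.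
by split => i; have := h i; rewrite !mxE gt_max lt_min => /andP[/andP[h1 h2] /andP[h3 h4]];
  rewrite ?h1 ?h2 ?h3 ?h4.
Qed.

Lemma oboxE a (e : R) : obox a e = rbox (\row_i (a ord0 i - e)) (\row_i (a ord0 i + e)).
Proof.
apply/seteqP; split => x h i; have := h i; rewrite ?mxE; first by rewrite distrC ltr_distlC.
by rewrite -ltr_distlC distrC.
Qed.

Lemma measurable_rbox l u : measurable (rbox l u).
Proof.
rewrite (_ : rbox l u = [set x : 'rV[R]_n | forall i,
    `](l ord0 i), (u ord0 i)[%classic (x ord0 i)]).
  apply: (@measurable_rV_box R n
    (fun i => `](l ord0 i), (u ord0 i)[%classic)) => i.
  exact: measurable_itv.
by apply/seteqP; split => x h i; move: (h i); rewrite /= in_itv/=.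
Qed.

Let G : set (set 'rV[R]_n) := [set A | exists l u, A = rbox l u].

(** Open boxes generate the Borel sets and are stable under intersection, which
    makes Dynkin's theorem applicable. *)
Lemma rV_measurableE : (@measurable _ 'rV[R]_n) = <<s G >>.
Proof.
have Gopen (U : set 'rV[R]_n) : open U -> <<s G >> U.
  move=> oU; have [c [e [P [e0 PU UP]]]] := open_rV_boxes oU.
  rewrite (_ : U = \bigcup_k (if `[< P k >] then obox (c k) (e k) else set0)).
    apply: sigma_algebra_bigcup => k; case: asboolP => _.
      by apply: sub_sigma_algebra; rewrite oboxE; do 2 eexists.
    exact: sigma_algebra0.
  apply/seteqP; split => [x /UP[k Pk xk]|x [k _]].
    by exists k => //; rewrite asboolT.
  case: asboolP => // Pk xk; apply: (PU k Pk) => i; exact/ltW/xk.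
apply/seteqP; split; last first.
  apply: smallest_sub; first exact: sigma_algebra_measurable.
  by move=> _ [l [u ->]]; exact: measurable_rbox.
apply: smallest_sub; first exact: smallest_sigma_algebra.
rewrite -bigcup_seq => A [i _] [B mB <-].
have : measurable_fun setT
    (rV_coord i : g_sigma_algebraType G -> measurableTypeR R).
  apply: (measurability _ (RGenOpens.measurableE R)).
  move=> _ [_ [a [b ->] <-]]; rewrite setTI; apply: Gopen.
  apply: open_comp => [x _|]; last exact: interval_open.
  exact: coord_continuous.
by move=> /(_ measurableT _ mB).
Qed.

Lemma rbox_setI_closed : setI_closed G.
Proof. by move=> _ _ [l [u ->]] [l' [u' ->]]; rewrite rboxI; do 2 eexists. Qed.

Variable Omega : set 'rV[R]_n.
Hypothesis Omega_open : open Omega.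
Variable w : 'rV[R]_n -> R.
Hypothesis mw : measurable_fun setT w.
Hypothesis w_int : forall a e, cbox a e `<=` Omega ->
  leb.-integrable (cbox a e) (EFin \o w).
Hypothesis w_test : forall psi, test_fun Omega psi ->
  (\int[leb]_(x in Omega) (w x * psi x)%:E = 0)%E.

Lemma integral_rbox_eq0 l u a (e : R) : rbox l u `<=` cbox a e ->
  cbox a e `<=` Omega -> (\int[leb]_(x in rbox l u) (w x)%:E = 0)%E.
Proof.
move=> lue eO; have mB := measurable_rbox l u.
have iw : leb.-integrable (rbox l u) (EFin \o w).
  by apply: integrableS (w_int eO) => //; exact: measurable_cbox.
have k0 k : 0 < k.+1%:R^-1 :> R by rewrite invr_gt0.
have mb k : measurable_fun setT (bump l u k.+1%:R^-1).
  apply: continuous_measurable_rV; exact: (bump_smooth l u (k0 k) 0%N).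
have [//|||||_ cv] := @Rintegral_dominated_cvg _ _ _ leb (rbox l u) mB
  (fun k x => w x * bump l u k.+1%:R^-1 x) w (fun x => `|w x|).
- by move=> k; apply: measurable_funM; exact: measurable_funTS.
- exact: measurable_funTS.
- exact: integrable_norm.
- apply: aeW => x xlu; rewrite -[X in _ --> X]mulr1.
  by apply: cvgM; [exact: cvg_cst|exact: bump_cvg].
- move=> k; apply: aeW => x _; have /andP[b0 b1] := bump01 l u x (k0 k).
  by rewrite normrM (ger0_norm b0) ler_piMr.
have z k : \int[leb]_(x in rbox l u) (w x * bump l u k.+1%:R^-1 x) = 0.
  rewrite /Rintegral; have := w_test (bump_test_fun (k0 k) lue eO).
  rewrite (_ : (\int[leb]_(x in Omega) _ = \int[leb]_(x in rbox l u)
     (w x * bump l u k.+1%:R^-1 x)%:E)%E) => [->//|].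
  rewrite integral_mkcond [RHS]integral_mkcond; apply: eq_integral => x _.
  rewrite !patchE; case: ifPn => [/set_mem xO|xO].
    by case: ifPn => // /negP xlu; rewrite bump_out ?mulr0// => h; apply: xlu; rewrite inE.
  by rewrite memNset// => /lue/eO h; case/negP: xO; rewrite inE.
have : \int[leb]_(x in rbox l u) w x = 0.
  have := cvg_lim _ cv; under eq_fun do rewrite z.
  by rewrite lim_cst//; move=> <-.
by rewrite /Rintegral => h; rewrite -[LHS]fineK ?h//; exact: integrable_fin_num.
Qed.

Lemma ae_eq0_obox a (e : R) : cbox a e `<=` Omega ->
  {ae leb, forall x, obox a e x -> w x = 0}.
Proof.
move=> eO; have mD := measurable_obox a e.
have De : obox a e `<=` cbox a e by move=> x h i; exact/ltW/h.
have iw : leb.-integrable (obox a e) (EFin \o w).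
  by apply: integrableS (w_int eO) => //; exact: measurable_cbox.
have iwS S : measurable S -> leb.-integrable (S `&` obox a e) (EFin \o w).
  by move=> mS; apply: integrableS iw => //; exact: measurableI.
have D0 : (\int[leb]_(x in obox a e) (w x)%:E = 0)%E.
  by rewrite oboxE in De *; exact: integral_rbox_eq0 De eO.
have all0 S : measurable S -> (\int[leb]_(x in S `&` obox a e) (w x)%:E = 0)%E.
  move=> mS; have : <<s G >> S by rewrite -rV_measurableE.
  apply: (@dynkin_induction _ _ G
    (fun S => \int[leb]_(x in S `&` obox a e) (w x)%:E = 0)%E) => {S mS} //.
  - exact: rV_measurableE.
  - exact: rbox_setI_closed.
  - by rewrite setTI.
  - move=> _ [l [u ->]]; rewrite oboxE rboxI; apply: integral_rbox_eq0 eO.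
    by rewrite -rboxI -oboxE => x [_ /De].
  - move=> S mS S0.
    have := @integral_setU _ _ _ leb (S `&` obox a e) (~` S `&` obox a e)
      (EFin \o w).
    rewrite -setIUl setUv setTI D0 S0 add0e => h; rewrite -h//.
    - exact: measurableI.
    - by apply: measurableI => //; exact: measurableC.
    - by apply/measurable_EFinP; exact: measurable_funTS.
    - by apply/disj_setPS => x [[Sx _] [nSx _]].
  - move=> F mF tF F0; rewrite setI_bigcupl integral_bigcup//.
    + by rewrite eseries0.
    + exact: trivIset_setIr.
    + by move=> k; exact: measurableI.
    + by rewrite -setI_bigcupl; apply: iwS; exact: bigcup_measurable.
have := @integral_ae_eq _ _ _ leb (obox a e) mD (cst 0)%E (EFin \o w) iw.
move=> h; have : ae_eq leb (obox a e) (EFin \o w) (cst 0)%E.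
  apply: h => // E ED mE.
  by rewrite integral0 -[E in LHS](setIidl ED) all0.
by apply: filterS => x xE /xE [].
Qed.

(** Tested against bumps, [w] has zero integral over every box contained in a
    fixed cube inside [Omega], hence over every Borel subset of that cube. *)
Lemma fundamental_lemma : {ae leb, forall x, Omega x -> w x = 0}.
Proof.
have [c [e [P [e0 PU UP]]]] := open_rV_boxes Omega_open.
have : forall k, {ae leb, forall x, P k -> obox (c k) (e k) x -> w x = 0}.
  move=> k; have [Pk|nPk] := pselect (P k); last by apply: aeW => x /nPk.
  by apply: filterS (ae_eq0_obox (PU k Pk)) => x h _; exact: h.
move=> /ae_foralln; apply: filterS => x h /UP[k Pk xk]; exact: h Pk xk.
Qed.

End FundamentalLemma.

(** * Dominated convergence in Lebesgue spaces *)

Section DominatedLq.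
Context d (T : measurableType d) (R : realType).
Variables (mu : {measure set T -> \bar R}) (D : set T).
Hypotheses (mD : measurable D) (finD : (mu D < +oo)%E).
Implicit Types q : R.

Definition Lq q (f : T -> R) := measurable_fun setT f /\
  mu.-integrable D (fun x => (`|f x| `^ q)%:E).

Lemma measurable_normpow q (f : T -> R) : measurable_fun setT f ->
  measurable_fun setT (fun x => `|f x| `^ q).
Proof. by move=> mf; apply: measurable_powR_fun; exact: measurableT_comp. Qed.

Lemma Lq_lty q (f : T -> R) : measurable_fun setT f ->
  (\int[mu]_(x in D) (`|f x| `^ q)%:E < +oo)%E -> Lq q f.
Proof.
move=> mf fq; split => //; apply/integrableP; split.
  by apply/measurable_EFinP/measurable_funTS; exact: measurable_normpow.
by under eq_integral do rewrite gee0_abs ?lee_fin ?powR_ge0//.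
Qed.

Lemma Lq_ae_le q (f M : T -> R) : 0 <= q -> measurable_fun setT f -> Lq q M ->
  {ae mu, forall x, D x -> `|f x| <= `|M x|} -> Lq q f.
Proof.
move=> q0 mf [mM iM] fM; split => //.
apply: (@le_integrable_ae _ _ _ mu D mD _ (fun x => `|M x| `^ q)) => //.
  by apply: measurable_funTS; exact: measurable_normpow.
apply: filterS fM => x h /h {}h.
by rewrite ger0_norm ?powR_ge0//; apply: ge0_ler_powR; rewrite ?nnegrE.
Qed.

Lemma powR_add_le q (a b : R) : 0 <= q -> 0 <= a -> 0 <= b ->
  (a + b) `^ q <= 2 `^ q * (a `^ q + b `^ q).
Proof.
move=> q0; wlog ab : a b / a <= b => [h a0 b0|a0 b0].
  have [ab|/ltW ba] := leP a b; first exact: h.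
  by rewrite addrC [X in _ * X]addrC; exact: h.
apply: (@le_trans _ _ ((2 * b) `^ q)).
  by apply: ge0_ler_powR; rewrite ?nnegrE ?addr_ge0 ?mulr_ge0//; lra.
by rewrite powRM// ler_wpM2l ?powR_ge0// lerDr powR_ge0.
Qed.

Lemma LqD q f g : 0 <= q -> Lq q f -> Lq q g -> Lq q (fun x => f x + g x).
Proof.
move=> q0 [mf if_] [mg ig].
have mfg : measurable_fun setT (fun x => f x + g x) by exact: measurable_funD.
split => //; have := integrableZl mD (2 `^ q) (integrableD mD if_ ig).
apply: le_integrable => //.
  by apply/measurable_EFinP/measurable_funTS; exact: measurable_normpow.
move=> x _; rewrite -EFinD -EFinM lee_fin ger0_norm ?powR_ge0//.
rewrite ger0_norm ?mulr_ge0 ?addr_ge0 ?powR_ge0//.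
apply: le_trans (powR_add_le _ _ _) => //.
by apply: ge0_ler_powR; rewrite ?nnegrE ?addr_ge0// ler_normD.
Qed.

Lemma LqZ q (c : R) (f : T -> R) : Lq q f -> Lq q (fun x => c * f x).
Proof.
move=> [mf if_]; split; first exact: measurable_funM.
rewrite (_ : (fun x => _) = (fun x => (`|c| `^ q)%:E * (`|f x| `^ q)%:E)%E).
  exact: integrableZl.
by apply/funext => x; rewrite normrM powRM.
Qed.

Lemma Lq_norm q f : Lq q f -> Lq q (fun x => `|f x|).
Proof.
move=> [mf if_]; split; first exact: measurableT_comp.
by under eq_fun do rewrite normr_id.
Qed.

Lemma Lq_cst q (c : R) : Lq q (fun=> c).
Proof.
split; first exact: measurable_cst.
apply: (@measurable_bounded_integrable _ _ _ mu (fun=> `|c| `^ q) D mD finD).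
  exact: measurable_cst.
by exists (`|c| `^ q); split => // M /ltW cM x _; rewrite /= ger0_norm ?powR_ge0.
Qed.

Lemma Lq_sub2 q f : 2 <= q -> Lq q f -> Lq 2 f.
Proof.
move=> q2 [mf if_]; split => //.
have := integrableD mD (Lq_cst 1 1).2 if_.
apply: le_integrable => //.
  by apply/measurable_EFinP/measurable_funTS; exact: measurable_normpow.
move=> x _; rewrite -EFinD lee_fin ger0_norm ?powR_ge0// normr1 powR1.
rewrite [leRHS]ger0_norm ?addr_ge0 ?powR_ge0//.
have [f1|f1] := leP `|f x| 1.
  rewrite -[leLHS]addr0 lerD ?powR_ge0//.
  have := @ge0_ler_powR _ 2 _ `|f x| 1; rewrite powR1; apply => //; rewrite ?nnegrE//.
by rewrite -[leLHS]add0r lerD// ler_powR// ltW.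
Qed.

Lemma Lq2_mul_integrable (a : T -> R) (L : R) (f g : T -> R) :
  measurable_fun setT a -> {ae mu, forall x, D x -> `|a x| <= L} ->
  Lq 2 f -> Lq 2 g -> mu.-integrable D (EFin \o (fun x => a x * f x * g x)).
Proof.
move=> ma aL [mf if_] [mg ig].
apply: (@le_integrable_ae _ _ _ mu D mD _
  (fun x => L * (`|f x| `^ 2 + `|g x| `^ 2))).
- by apply: measurable_funTS; do 2 apply: measurable_funM => //.
- have := integrableZl mD L (integrableD mD if_ ig).
  by apply: eq_integrable => // x _; rewrite /= -EFinD -EFinM.
apply: filterS aL => x h /h {}h; rewrite !normrM -mulrA.
rewrite !powR_mulrn//; have := normr_ge0 (a x).
have := normr_ge0 (f x); have := normr_ge0 (g x).
move: h; move: `|a x| `|f x| `|g x| => A F E AL E0 F0 A0.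
have EF : F * E <= F ^+ 2 + E ^+ 2 by nra.
by apply: ler_pM => //; exact: mulr_ge0.
Qed.

(** Convergence at a geometric rate relative to a single dominating function.
    Every limit passage below is an instance of dominated convergence along such
    sequences. *)
Definition dcvg q (f_ : nat -> T -> R) (f : T -> R) :=
  [/\ forall k, measurable_fun setT (f_ k), measurable_fun setT f &
    exists2 M, Lq q M & (forall x, `|f x| <= M x) /\
      forall k, {ae mu, forall x, D x -> `|f_ k x - f x| <= M x * 2^-1 ^+ k}].

Lemma dcvg_cst q f : Lq q f -> dcvg q (fun=> f) f.
Proof.
move=> Lf; split; [by move=> _; exact: Lf.1|exact: Lf.1|].
exists (fun x => `|f x|); first exact: Lq_norm.
split => // k; apply: aeW => x _; by rewrite subrr normr0 mulr_ge0.
Qed.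

Lemma dcvg_Lq q f_ f : 0 <= q -> dcvg q f_ f -> Lq q f.
Proof.
move=> q0 [_ mf [M LM [fM _]]]; apply: (Lq_ae_le q0 mf LM).
by apply: aeW => x _; rewrite (le_trans (fM x))// ler_norm.
Qed.

Lemma dcvg_lin q (a : R) f_ f g_ g : 0 <= q -> dcvg q f_ f -> dcvg q g_ g ->
  dcvg q (fun k x => a * f_ k x + g_ k x) (fun x => a * f x + g x).
Proof.
move=> q0 [mf_ mf [M LM [fM cM]]] [mg_ mg [N LN [gN cN]]].
have mlin (u v : T -> R) : measurable_fun setT u -> measurable_fun setT v ->
    measurable_fun setT (fun x => a * u x + v x).
  by move=> mu' mv; apply: measurable_funD => //; exact: measurable_funM.
split; [by move=> k; exact: mlin|exact: mlin|].
exists (fun x => `|a| * M x + N x); first by apply: LqD => //; exact: LqZ.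
split=> [x|k].
  by rewrite (le_trans (ler_normD _ _))// lerD// normrM ler_wpM2l.
apply: filterS2 (cM k) (cN k) => x h1 h2 Dx.
rewrite (_ : _ - _ = a * (f_ k x - f x) + (g_ k x - g x)); last by ring.
rewrite (le_trans (ler_normD _ _))// mulrDl lerD ?h2// normrM -mulrA ler_wpM2l//.
exact: h1.
Qed.

Lemma dcvg_ptws q f_ f : dcvg q f_ f ->
  {ae mu, forall x, D x -> f_ ^~ x @ \oo --> f x}.
Proof.
move=> [_ _ [M _ [_ cM]]].
apply: filterS (ae_foralln cM) => x h Dx.
have z : (fun k => M x * 2^-1 ^+ k) @ \oo --> (0 : R).
  apply: (@cvg_geometric R (M x) 2^-1).
  by rewrite ger0_norm ?invr_ge0// invf_lt1// ltr1n.
apply/cvgrPdist_le => e e0.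
move/cvgrPdist_le : z => /(_ e e0); apply: filterS => k hk.
rewrite distrC (le_trans (h k Dx))//; apply: le_trans hk.
by rewrite sub0r normrN ler_norm.
Qed.

Lemma dcvg_bound q f_ f : dcvg q f_ f -> exists2 M, Lq q M &
  [/\ forall x, 0 <= M x, forall x, `|f x| <= M x &
    forall k, {ae mu, forall x, D x -> `|f_ k x| <= M x}].
Proof.
move=> [mf_ mf [M LM [fM cM]]]; exists (fun x => 2 * M x); first exact: LqZ.
have M0 x : 0 <= M x by exact: le_trans (fM x).
split=> [x|x|k]; first by rewrite mulr_ge0.
  by have := fM x; have := M0 x; lra.
apply: filterS (cM k) => x h /h {}h.
have e1 : 2^-1 ^+ k <= 1 :> R by rewrite exprn_ile1 ?invr_ge0// invf_le1// ler1n.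
have := fM x; have := M0 x; have := ler_normD (f_ k x - f x) (f x).
rewrite subrK => h1 h2 h3; have : M x * 2^-1 ^+ k <= M x by rewrite ler_piMr.
lra.
Qed.

Lemma cvg_integral_mul (a : T -> R) (L : R) f_ f g_ g :
  measurable_fun setT a -> {ae mu, forall x, D x -> `|a x| <= L} ->
  dcvg 2 f_ f -> dcvg 2 g_ g ->
  \int[mu]_(x in D) (a x * f_ k x * g_ k x) @[k --> \oo] -->
  \int[mu]_(x in D) (a x * f x * g x).
Proof.
move=> ma aL cf cg; have [mf_ mf _] := cf; have [mg_ mg _] := cg.
have [M LM [M0 fM f_M]] := dcvg_bound cf.
have [N LN [N0 gN g_N]] := dcvg_bound cg.
have [|||||_ cv] := @Rintegral_dominated_cvg _ _ _ mu D mD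
  (fun k x => a x * f_ k x * g_ k x) (fun x => a x * f x * g x)
  (fun x => `|L| * M x * N x).
- by move=> k; apply: measurable_funTS; do 2 apply: measurable_funM => //.
- by apply: measurable_funTS; do 2 apply: measurable_funM => //.
- apply: (@Lq2_mul_integrable _ `|L|) => //.
  by apply: aeW => x _; rewrite normr_id.
- apply: filterS2 (dcvg_ptws cf) (dcvg_ptws cg) => x h1 h2 Dx.
  apply: cvgM; last exact: h2.
  by apply: cvgM; [exact: cvg_cst|exact: h1].
- move=> k; apply: filterS3 aL (f_M k) (g_N k) => x h1 h2 h3 Dx.
  rewrite !normrM; apply: ler_pM => //; last exact: h3.
  apply: ler_pM => //; last exact: h2.
  by rewrite (le_trans (h1 Dx))// ler_norm.
- exact: cv.
Qed.

(** The growth condition bounds a product because [g u] is only ever integrated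
    against a function of the same integrability; it supplies the dominating
    function. *)
Lemma cvg_integral_superposition q (g : R -> R) (C : R) u_ u v_ v :
  0 <= q -> continuous g ->
  (forall s t : R, `|g s| * `|t| <= C * (1 + `|s| `^ q + `|t| `^ q)) ->
  dcvg q u_ u -> dcvg q v_ v ->
  mu.-integrable D (EFin \o (fun x => g (u x) * v x)) /\
  \int[mu]_(x in D) (g (u_ k x) * v_ k x) @[k --> \oo] -->
  \int[mu]_(x in D) (g (u x) * v x).
Proof.
move=> q0 cg gC cu cv; have [mu_ mu' _] := cu; have [mv_ mv _] := cv.
have C0 : 0 <= C.
  by have := gC 0 0; rewrite normr0 mulr0; have := powR_ge0 (0 : R) q; nra.
have [M LM [M0 uM u_M]] := dcvg_bound cu.
have [N LN [N0 vN v_N]] := dcvg_bound cv.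
have mg : measurable_fun setT g by exact: continuous_measurable_fun.
have mgc (f : T -> R) : measurable_fun setT f -> measurable_fun setT (g \o f).
  by move=> mf; exact: measurableT_comp.
apply: (@Rintegral_dominated_cvg _ _ _ mu D mD
  (fun k x => g (u_ k x) * v_ k x) (fun x => g (u x) * v x)
  (fun x => C * (1 + `|M x| `^ q + `|N x| `^ q))).
- move=> k; apply: measurable_funTS; apply: measurable_funM => //; exact: mgc.
- apply: measurable_funTS; apply: measurable_funM => //; exact: mgc.
- have := integrableZl mD C (integrableD mD
    (integrableD mD (Lq_cst q 1).2 LM.2) LN.2).
  apply: eq_integrable => // x _.
  by rewrite /= normr1 powR1 -!EFinD -EFinM.
- apply: filterS2 (dcvg_ptws cu) (dcvg_ptws cv) => x h1 h2 Dx.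
  apply: cvgM; last exact: h2.
  by apply: continuous_cvg; [exact: cg|exact: h1].
- move=> k; apply: filterS2 (u_M k) (v_N k) => x h1 h2 Dx.
  rewrite normrM; apply: (le_trans (gC _ _)); apply: ler_wpM2l => //.
  rewrite (ger0_norm (M0 x)) (ger0_norm (N0 x)).
  by apply: lerD; [apply: lerD => //|]; apply: ge0_ler_powR; rewrite ?nnegrE// ?h1 ?h2.
Qed.

Lemma cvg_integral_source q (f F : T -> R) v_ v :
  0 <= q -> measurable_fun setT f -> mu.-integrable D (EFin \o F) ->
  (forall x (t : R), `|f x| * `|t| <= F x + `|t| `^ q) -> dcvg q v_ v ->
  mu.-integrable D (EFin \o (fun x => f x * v x)) /\
  \int[mu]_(x in D) (f x * v_ k x) @[k --> \oo] --> \int[mu]_(x in D) (f x * v x).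
Proof.
move=> q0 mf iF fF cv; have [mv_ mv _] := cv.
have [N LN [N0 vN v_N]] := dcvg_bound cv.
apply: (@Rintegral_dominated_cvg _ _ _ mu D mD
  (fun k x => f x * v_ k x) (fun x => f x * v x) (fun x => F x + `|N x| `^ q)).
- by move=> k; apply: measurable_funTS; exact: measurable_funM.
- by apply: measurable_funTS; exact: measurable_funM.
- have := integrableD mD iF LN.2.
  by apply: eq_integrable => // x _; rewrite /= -EFinD.
- apply: filterS (dcvg_ptws cv) => x h Dx.
  by apply: cvgM; [exact: cvg_cst|exact: h].
- move=> k; apply: filterS (v_N k) => x h Dx.
  rewrite normrM; apply: (le_trans (fF _ _)); apply: lerD => //.
  by rewrite (ger0_norm (N0 x)); apply: ge0_ler_powR; rewrite ?nnegrE// ?h.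
Qed.

End DominatedLq.

(** * The quadratic form of the operator *)

Section EnergyForm.
Context {R : realType} {n : nat}.
Variable Omega : set 'rV[R]_n.
Local Notation leb := (lebesgue_rV n).
Hypotheses (mO : measurable Omega) (finO : (leb Omega < +oo)%E).
Implicit Types (w v z : 'I_n -> 'rV[R]_n -> R).

Definition L2 w := forall i, Lq leb Omega 2 (w i).

Definition grad (phi : 'rV[R]_n -> R) : 'I_n -> 'rV[R]_n -> R := fun i => pd i phi.

Definition sqn w : R := \sum_i \int[leb]_(x in Omega) (w i x * w i x).

Lemma L2_lin (a : R) w v : L2 w -> L2 v -> L2 (fun i x => a * w i x + v i x).
Proof. by move=> Lw Lv i; apply: LqD => //; exact: LqZ. Qed.

Lemma L2_sqr_integrable f : Lq leb Omega 2 f ->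
  leb.-integrable Omega (EFin \o (fun x => f x * f x)).
Proof.
move=> Lf; have := @Lq2_mul_integrable _ _ _ leb Omega mO (cst 1) 1 f f.
under [X in (_ -> _ -> _ -> _ -> _.-integrable _ X)]eq_fun do rewrite /= mul1r.
by apply => //; apply: aeW => x _; rewrite normr1.
Qed.

Lemma test_fun_Lq phi (q : R) : 0 <= q -> test_fun Omega phi ->
  Lq leb Omega q phi /\ forall i, Lq leb Omega q (pd i phi).
Proof.
move=> q0 tphi; have [M Cphi] := test_fun_C1c tphi.
have [c _ cd phiM] := Cphi.
have H (psi : 'rV[R]_n -> R) : continuous psi ->
    (forall x, ~ cbox 0 M x -> psi x = 0) -> Lq leb Omega q psi.
  move=> cpsi psiM; have [B B0 hB] := continuous_supported_bounded cpsi psiM.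
  apply: (Lq_ae_le mO q0 _ (Lq_cst mO finO q B)).
    exact: continuous_measurable_rV.
  by apply: aeW => x _; rewrite (ger0_norm B0).
by split => [|i]; apply: H => // x; exact: pd_vanishes.
Qed.

Lemma grad_L2 phi : test_fun Omega phi -> L2 (grad phi).
Proof. by move=> tphi i; exact: (test_fun_Lq _ tphi).2. Qed.

Lemma grad_lin (a : R) phi psi : test_fun Omega phi -> test_fun Omega psi ->
  grad (fun x => a * phi x + psi x) = fun i x => a * grad phi i x + grad psi i x.
Proof.
by move=> t1 t2; apply/funext => i; apply/funext => x; exact: pd_lin t1 t2.
Qed.

Lemma sqn_ge0 w : 0 <= sqn w.
Proof. by apply: sumr_ge0 => i _; apply: Rintegral_ge0 => x _; rewrite -expr2 sqr_ge0. Qed.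

Lemma sqn_integral w : L2 w ->
  (\int[leb]_(x in Omega) (\sum_i (w i x) ^+ 2)%:E)%E = (sqn w)%:E.
Proof.
move=> Lw; rewrite /sqn -sumEFin.
under eq_integral do rewrite -sumEFin.
rewrite ge0_integral_sum//; last 2 first.
- move=> i; apply/measurable_EFinP/measurable_funTS/measurable_funX.
  exact: (Lw i).1.
- by move=> i x _; rewrite lee_fin sqr_ge0.
apply: eq_bigr => i _; rewrite /Rintegral fineK//.
exact: integrable_fin_num (L2_sqr_integrable (Lw i)).
Qed.

Variables (A : 'I_n -> 'I_n -> 'rV[R]_n -> R) (lam L : R).
Hypothesis mA : forall i j, measurable_fun setT (A i j).
Hypothesis A_bdd : forall i j, {ae leb, forall x, Omega x -> `|A i j x| <= L}.
Hypothesis A_sym : forall i j, {ae leb, forall x, Omega x -> A i j x = A j i x}.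
Hypothesis A_ell : {ae leb, forall x, Omega x -> forall xi : 'I_n -> R,
  lam * \sum_i xi i ^+ 2 <= \sum_i (\sum_j A i j x * xi j) * xi i}.

(** A double sum of integrals, so that bilinearity holds term by term;
    [ebil_integral] identifies it with the integral of the quadratic density. *)
Definition ebil w v : R :=
  \sum_i \sum_j \int[leb]_(x in Omega) (A i j x * w j x * v i x).

Lemma ebil_term_integrable w v i j : L2 w -> L2 v ->
  leb.-integrable Omega (EFin \o (fun x => A i j x * w j x * v i x)).
Proof. by move=> Lw Lv; exact: (Lq2_mul_integrable mO (mA i j) (A_bdd i j) (Lw j) (Lv i)). Qed.

Lemma ebil_integral w v : L2 w -> L2 v ->
  leb.-integrable Omega (EFin \o (fun x => \sum_i (\sum_j A i j x * w j x) * v i x)) /\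
  (\int[leb]_(x in Omega) (\sum_i (\sum_j A i j x * w j x) * v i x)%:E)%E
    = (ebil w v)%:E.
Proof.
move=> Lw Lv.
have it i j := ebil_term_integrable i j Lw Lv.
have E x : (\sum_i (\sum_j A i j x * w j x) * v i x)%:E =
    (\sum_i \sum_j (A i j x * w j x * v i x)%:E)%E.
  by rewrite -sumEFin; apply: eq_bigr => i _; rewrite mulr_suml -sumEFin.
have is_ i : leb.-integrable Omega (fun x => \sum_j (A i j x * w j x * v i x)%:E)%E.
  by apply: integrable_sum => // j _; exact: it.
split.
  rewrite (_ : EFin \o _ = fun x => \sum_i \sum_j (A i j x * w j x * v i x)%:E)%E.
    by apply: integrable_sum => // i _; exact: is_.
  by apply/funext => x; exact: E.
under eq_integral do rewrite E.
rewrite integral_sum// /ebil -sumEFin; apply: eq_bigr => i _.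
rewrite integral_sum//; last exact: it.
rewrite -sumEFin; apply: eq_bigr => j _.
by rewrite /Rintegral fineK//; exact: integrable_fin_num (it i j).
Qed.

Lemma ebil_linl (a : R) w v z : L2 w -> L2 v -> L2 z ->
  ebil (fun i x => a * w i x + v i x) z = a * ebil w z + ebil v z.
Proof.
move=> Lw Lv Lz; rewrite /ebil mulr_sumr -big_split; apply: eq_bigr => i _ /=.
rewrite mulr_sumr -big_split; apply: eq_bigr => j _ /=.
have i1 := ebil_term_integrable i j Lw Lz.
have i2 := ebil_term_integrable i j Lv Lz.
rewrite -RintegralZl// -RintegralD//; last exact: (integrableZl mO a i1).
by apply: eq_Rintegral => x _; ring.
Qed.

Lemma ebil_sym w v : ebil w v = ebil v w.
Proof.
rewrite /ebil exchange_big; apply: eq_bigr => i _; apply: eq_bigr => j _ /=.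
rewrite /Rintegral; congr fine; apply: ae_eq_integral_any.
by apply: filterS (A_sym j i) => x h /h ->; congr EFin; ring.
Qed.

Lemma ebil_linr (a : R) w v z : L2 w -> L2 v -> L2 z ->
  ebil z (fun i x => a * w i x + v i x) = a * ebil z w + ebil z v.
Proof. by move=> Lw Lv Lz; rewrite ebil_sym ebil_linl// !(ebil_sym z). Qed.

Lemma ebil_coercive w : L2 w -> lam * sqn w <= ebil w w.
Proof.
move=> Lw; rewrite -lee_fin EFinM -sqn_integral//.
have [iE <-] := ebil_integral Lw Lw.
have isq : leb.-integrable Omega (EFin \o (fun x => \sum_i (w i x) ^+ 2)).
  apply/integrableP; split.
    apply/measurable_EFinP/measurable_funTS/measurable_sum => i.
    by apply: measurable_funX; exact: (Lw i).1.
  under eq_integral => x _.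
    rewrite /= ger0_norm; last by apply: sumr_ge0 => i _; exact: sqr_ge0.
    over.
  by rewrite sqn_integral// ltry.
have ilsq := integrableZl mO lam isq.
have : \int[leb]_(x in Omega) (lam * \sum_i (w i x) ^+ 2) <=
    \int[leb]_(x in Omega) (\sum_i (\sum_j A i j x * w j x) * w i x).
  apply: le_Rintegral_ae => //.
  by apply: filterS A_ell => x h /h; exact.
rewrite -lee_fin /Rintegral !fineK; last 2 first.
- exact: integrable_fin_num iE.
- exact: integrable_fin_num ilsq.
by rewrite -integralZl.
Qed.

Lemma ebil_cvg (w_ v_ : nat -> 'I_n -> 'rV[R]_n -> R) w v :
  (forall i, dcvg leb Omega 2 (fun k => w_ k i) (w i)) ->
  (forall i, dcvg leb Omega 2 (fun k => v_ k i) (v i)) ->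
  ebil (w_ k) (v_ k) @[k --> \oo] --> ebil w v.
Proof.
move=> cw cv; rewrite /ebil; apply: cvg_big => [|i _]; first exact: add_continuous.
apply: cvg_big => [|j _]; first exact: add_continuous.
exact: cvg_integral_mul (mA i j) (A_bdd i j) (cw j) (cv i).
Qed.

End EnergyForm.

(** * Primitives of monotone functions *)

Section ConvexPrimitive.
Context {R : realType}.
Variable g : R -> R.
Hypotheses (cg : continuous g) (ndg : {homo g : x y / x <= y}).
Local Notation mu1 := (@lebesgue_measure R).

Let I (a b : R) : R := \int[mu1]_(x in `[a, b]) g x.

Let int_itv (a b : R) : mu1.-integrable `[a, b] (EFin \o g).
Proof.
by apply: continuous_compact_integrable; [exact: segment_compact|exact: continuous_subspaceT].
Qed.

Let I_bounds (a b : R) : a <= b -> g a * (b - a) <= I a b <= g b * (b - a).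
Proof.
move=> ab; have c (r : R) : \int[mu1]_(x in `[a, b]) (cst r x) = r * (b - a).
  rewrite Rintegral_cst//=; congr (_ * _).
  rewrite lebesgue_measure_itv/= lte_fin; case: ltP => // ba.
  by have -> : b = a; [apply/eqP; rewrite eq_le ab ba|rewrite subrr].
have ic (r : R) : mu1.-integrable `[a, b] (EFin \o cst r).
  apply: continuous_compact_integrable; first exact: segment_compact.
  exact/continuous_subspaceT/cst_continuous.
rewrite -!c; apply/andP; split; apply: le_Rintegral => // x /=;
  by rewrite in_itv/= => /andP[ax xb]; exact: ndg.
Qed.

Let I_split (a b c : R) : a <= b -> b <= c -> I a c = I a b + I b c.
Proof.
move=> ab bc.
have := @Rintegral_itvB R g (BLeft a) (BRight c) b (int_itv a c).
rewrite !bnd_simp => /(_ ab bc) h; rewrite /I [X in _ + X](_ : _ =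
    \int[mu1]_(x in [set` Interval (BRight b) (BRight c)]) g x).
  by rewrite -h addrC subrK.
rewrite Rintegral_itv_obnd_cbnd//.
by apply: integrableS (int_itv b c) => //; apply: subset_itvr; rewrite bnd_simp.
Qed.

(** The subgradient inequality expresses both that [G] is convex and that [g] is
    its derivative; continuity follows from it. *)
Lemma convex_primitive : exists G : R -> R, [/\ continuous G, G 0 = 0 &
  forall a b, g a * (b - a) <= G b - G a].
Proof.
pose G x := if 0 <= x then I 0 x else - I x 0.
have I00 : I 0 0 = 0.
  have := I_bounds (lexx 0); rewrite subrr !mulr0 => h; apply/eqP.
  by rewrite eq_le andbC.
have up a b : a <= b -> g a * (b - a) <= G b - G a <= g b * (b - a).
  move=> ab; rewrite /G; have [a0|a0] := leP 0 a; have [b0|b0] := leP 0 b.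
  - rewrite (I_split a0 ab) addrAC subrr add0r; exact: I_bounds.
  - by have := le_lt_trans ab b0; rewrite ltNge a0.
  - rewrite opprK; have /andP[h1 h2] := I_bounds b0; have /andP[h3 h4] := I_bounds (ltW a0).
    have g1 := ndg (ltW a0); have g2 := ndg b0.
    by apply/andP; split; nra.
  - rewrite (I_split ab (ltW b0)) opprK (_ : - _ + _ = I a b); [exact: I_bounds|ring].
have sub a b : g a * (b - a) <= G b - G a.
  have [ab|/ltW ba] := leP a b; first by have /andP[] := up a b ab.
  by have /andP[_] := up b a ba; lra.
exists G; split => //; last by rewrite /G lexx.
move=> a; suff : G b - G a @[b --> a] --> 0.
  by move=> h; apply/subr_cvg0.
have ba0 : b - a @[b --> a] --> (0 : R).
  by apply/subr_cvg0; exact: cvg_id.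
apply: (@squeeze_cvgr _ _ _ _ (fun b => g a * (b - a)) (fun b => g b * (b - a))).
- by apply: nearW => b; rewrite sub/=; have := sub b a; lra.
- have := cvgM (cvg_cst (g a)) ba0; rewrite mulr0; exact.
- have := cvgM (@cg a) ba0; rewrite mulr0; exact.
Qed.

End ConvexPrimitive.

(** * Limits of test functions *)

Section Approximable.
Context {R : realType} {n : nat}.
Variable Omega : set 'rV[R]_n.
Local Notation leb := (lebesgue_rV n).
Hypotheses (mO : measurable Omega) (finO : (leb Omega < +oo)%E).
Variables (p C : R).
Hypotheses (p2 : 2 <= p) (C0 : 0 < C).
Hypothesis sobolev : sobolev_bound Omega p C.

Let p0 : 0 <= p. Proof. by rewrite (le_trans _ p2). Qed.
Let p1 : 1 <= p. Proof. by rewrite (le_trans _ p2)// ler1n. Qed.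

(** The space [H^1_0] as the set of pairs of a function and a gradient that are
    approximated by test functions at a geometric rate. *)
Definition H10pair (u : 'rV[R]_n -> R) (w : 'I_n -> 'rV[R]_n -> R)
    (phi_ : nat -> 'rV[R]_n -> R) :=
  [/\ forall k, test_fun Omega (phi_ k), dcvg leb Omega p phi_ u &
    forall i, dcvg leb Omega 2 (fun k => pd i (phi_ k)) (w i)].

Lemma H10pair_test phi : test_fun Omega phi -> H10pair phi (grad phi) (fun=> phi).
Proof.
move=> tphi; split => // [|i].
  by apply: dcvg_cst; exact: (test_fun_Lq mO finO p0 tphi).1.
by apply: dcvg_cst; exact: (grad_L2 mO finO tphi).
Qed.

Lemma H10pair_lin (a : R) u w phi_ v z psi_ :
  H10pair u w phi_ -> H10pair v z psi_ ->
  H10pair (fun x => a * u x + v x) (fun i x => a * w i x + z i x)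
    (fun k x => a * phi_ k x + psi_ k x).
Proof.
move=> [t1 c1 d1] [t2 c2 d2]; split.
- by move=> k; exact: test_fun_lin.
- exact: dcvg_lin.
- move=> i; rewrite (_ : (fun k => _) =
    (fun k x => a * pd i (phi_ k) x + pd i (psi_ k) x)).
    exact: dcvg_lin.
  by apply/funext => k; apply/funext => x; exact: pd_lin.
Qed.

Lemma H10pair_L2 u w phi_ : H10pair u w phi_ -> L2 Omega w.
Proof. by move=> [_ _ c] i; exact: (dcvg_Lq mO _ (c i)). Qed.

Lemma H10pair_Lq u w phi_ : H10pair u w phi_ -> Lq leb Omega p u.
Proof. by move=> [_ c _]; exact: (dcvg_Lq mO p0 c). Qed.

Lemma fast_dcvg q (f_ : nat -> 'rV[R]_n -> R) : 1 <= q ->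
  Lq leb Omega q (f_ 0%N) -> (forall k, measurable_fun setT (f_ k)) ->
  forall K, 0 <= K ->
  (forall k, (\int[leb]_(x in Omega) (`|f_ k.+1 x - f_ k x| `^ q)%:E <=
     ((K * 4^-1 ^+ k) `^ q)%:E)%E) ->
  exists l, dcvg leb Omega q f_ l.
Proof.
move=> q1 L0 mf K K0 fK; have q0 : 0 <= q by exact: le_trans q1.
have [l [M [ml mM M0 Mq lM]]] := fast_cauchy_cvg mO q1 K0 mf fK.
have LM : Lq leb Omega q M.
  apply: Lq_lty => //; under eq_integral do rewrite ger0_norm//.
  exact: Mq.
have Ll : Lq leb Omega q l.
  apply: (Lq_ae_le mO q0 ml (LqD mO q0 (Lq_norm L0) LM)).
  apply: filterS (lM 0%N) => x h /h; rewrite expr0 mulr1 => {}h.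
  rewrite (ger0_norm (addr_ge0 _ _))//.
  have := ler_normB (f_ 0%N x) (f_ 0%N x - l x); rewrite opprB addrC subrK.
  by move=> /le_trans; apply; rewrite lerD2l.
exists l; split => //; exists (fun x => `|l x| + M x).
  by apply: LqD => //; exact: Lq_norm.
split => [x|k]; first by rewrite lerDl.
apply: filterS (lM k) => x h /h /le_trans; apply; rewrite ler_wpM2r ?exprn_ge0 ?invr_ge0//.
by rewrite lerDr.
Qed.

(** The Sobolev inequality turns fast convergence of the gradients into fast
    convergence of the functions themselves. *)
Lemma H10pair_complete (phi_ : nat -> 'rV[R]_n -> R) :
  (forall k, test_fun Omega (phi_ k)) ->
  (forall k, sqn Omega (grad (fun x => -1 * phi_ k x + phi_ k.+1 x)) <=
     (4^-1 ^+ k) ^+ 2) ->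
  exists u w, H10pair u w phi_.
Proof.
move=> tphi sq.
have e0 k : 0 < 4^-1 ^+ k :> R by rewrite exprn_gt0 ?invr_gt0.
have td k : test_fun Omega (fun x => -1 * phi_ k x + phi_ k.+1 x).
  exact: test_fun_lin.
have dE k x : phi_ k.+1 x - phi_ k x = -1 * phi_ k x + phi_ k.+1 x by ring.
have hsq k : (\int[leb]_(x in Omega)
    (\sum_i (pd i (fun x => -1 * phi_ k x + phi_ k.+1 x)%R x) ^+ 2)%:E <=
    ((4^-1 ^+ k) ^+ 2)%:E)%E.
  by rewrite (sqn_integral mO (grad_L2 mO finO (td k))) lee_fin.
have [u cu] : exists u, dcvg leb Omega p phi_ u.
  apply: (@fast_dcvg p phi_ p1 _ _ C (ltW C0)) => [|k|k].
  - exact: (test_fun_Lq mO finO p0 (tphi _)).1.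
  - exact: (test_fun_Lq mO finO p0 (tphi _)).1.1.
  - by under eq_integral do rewrite dE; exact: sobolev.
have /choice[w cw] i : exists w, dcvg leb Omega 2 (fun k => pd i (phi_ k)) w.
  apply: (@fast_dcvg 2 (fun k => pd i (phi_ k)) _ _ _ 1) => // [||k|k].
  - by rewrite ler1n.
  - exact: (grad_L2 mO finO (tphi _) i).
  - exact: (grad_L2 mO finO (tphi _) i).1.
  - rewrite mul1r powR_mulrn ?(ltW (e0 k))//; apply: le_trans (hsq k).
    apply: ge0_le_integral => //.
    + apply/measurable_EFinP/measurable_funTS/measurable_normpow.
      by apply: measurable_funB; exact: (grad_L2 mO finO (tphi _) i).1.
    + apply/measurable_EFinP/measurable_funTS/measurable_sum => j.
      by apply: measurable_funX; exact: (grad_L2 mO finO (td k) j).1.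
    move=> x _; rewrite lee_fin powR_mulrn// real_normK ?num_real//.
    rewrite (bigD1 i)//= (pd_lin _ _ _ (tphi k) (tphi k.+1)) (_ : -1 * _ + _ = pd i (phi_ k.+1) x - pd i (phi_ k) x).
      by rewrite lerDl sumr_ge0// => j _; exact: sqr_ge0.
    by ring.
by exists u, w.
Qed.

Lemma sqn_cvg u w phi_ : H10pair u w phi_ ->
  sqn Omega (grad (phi_ k)) @[k --> \oo] --> sqn Omega w.
Proof.
move=> [_ _ c]; rewrite /sqn; apply: cvg_big => [|i _]; first exact: add_continuous.
have E (h1 h2 : 'rV[R]_n -> R) : \int[leb]_(x in Omega) (cst 1 x * h1 x * h2 x) =
    \int[leb]_(x in Omega) (h1 x * h2 x).
  by apply: eq_Rintegral => x _; rewrite mul1r.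
rewrite -E; under eq_fun do rewrite -E.
apply: (@cvg_integral_mul _ _ _ leb Omega mO (cst 1) 1) => //;
  [|exact: (c i)|exact: (c i)].
by apply: aeW => x _; rewrite normr1.
Qed.

Section Source.
Variables (f F : 'rV[R]_n -> R).
Hypotheses (mf : measurable_fun setT f) (iF : leb.-integrable Omega (EFin \o F)).
Hypothesis fF : forall x (t : R), `|f x| * `|t| <= F x + `|t| `^ p.

Lemma source_integrable v : Lq leb Omega p v ->
  leb.-integrable Omega (EFin \o (fun x => f x * v x)).
Proof. by move=> Lv; exact: (cvg_integral_source mO p0 mf iF fF (dcvg_cst Lv)).1. Qed.

(** Boundedness of the source functional in the gradient norm, from the growth
    bound and the Sobolev inequality by homogeneity. *)
Lemma source_bound_test : exists2 K, 0 <= K & forall phi N, test_fun Omega phi ->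
  0 < N -> sqn Omega (grad phi) <= N ^+ 2 ->
  `|\int[leb]_(x in Omega) (f x * phi x)| <= K * N.
Proof.
have F0 x : 0 <= F x.
  have := fF x 0; rewrite normr0 mulr0 powR0 ?addr0//.
  by rewrite gt_eqF// (lt_le_trans _ p2).
exists (\int[leb]_(x in Omega) F x + C `^ p).
  by rewrite addr_ge0 ?powR_ge0//; apply: Rintegral_ge0.
move=> phi N tphi N0 sN.
have Lphi := (test_fun_Lq mO finO p0 tphi).1.
have sob := sobolev tphi N0; rewrite (sqn_integral mO (grad_L2 mO finO tphi)) lee_fin in sob.
have {}sob := sob sN.
have iphi := Lphi.2.
have b x : `|f x * phi x| <= N * (F x + N `^ (- p) * `|phi x| `^ p).
  have := fF x (N^-1 * phi x).
  rewrite [in X in X -> _]normrM (gtr0_norm (_ : 0 < N^-1)) ?invr_gt0//.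
  rewrite powRM ?invr_ge0 ?(ltW N0)// -powR_inv1 ?(ltW N0)// -powRrM mulN1r.
  rewrite powR_inv1 ?(ltW N0)// normrM => h.
  by rewrite -ler_pdivrMl// mulrCA.
have ig : leb.-integrable Omega
    (EFin \o (fun x => N * (F x + N `^ (- p) * `|phi x| `^ p))).
  have := integrableZl mO N (integrableD mO iF (integrableZl mO (N `^ (- p)) iphi)).
  by apply: eq_integrable => // x _; rewrite /= -EFinM -EFinD -EFinM.
apply: (le_trans (le_normr_Rintegral mO (source_integrable Lphi))).
have inorm := integrable_norm (source_integrable Lphi).
apply: (le_trans (le_Rintegral mO inorm ig (fun x _ => b x))).
have ipr : leb.-integrable Omega (EFin \o (fun x => N `^ (- p) * `|phi x| `^ p)).
  exact: (integrableZl mO (N `^ (- p)) iphi).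
rewrite RintegralZl//; last first.
  by have := integrableD mO iF ipr; apply: eq_integrable => // x _; rewrite /= -EFinD.
rewrite mulrC ler_pM2r// RintegralD// lerD2l RintegralZl//.
have X : \int[leb]_(x in Omega) (`|phi x| `^ p) <= (C * N) `^ p.
  by rewrite /Rintegral -lee_fin fineK//; exact: integrable_fin_num.
apply: (le_trans (ler_wpM2l (powR_ge0 _ _) X)).
by rewrite powRM ?(ltW C0) ?(ltW N0)// mulrCA -powRD ?addNr ?powRr0 ?mulr1// (gt_eqF N0) implybT.
Qed.

(** The bound on test functions passes to the limit at a slightly larger [N],
    since eventually the gradients of the approximations obey only a bound that
    is strict in the limit. *)
Lemma source_bound : exists2 K, 0 <= K & forall u w phi_ N, H10pair u w phi_ ->
  0 < N -> sqn Omega w <= N ^+ 2 ->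
  `|\int[leb]_(x in Omega) (f x * u x)| <= K * N.
Proof.
have [K K0 hK] := source_bound_test; exists K => // u w phi_ N uw N0 sN.
apply/ler_addgt0Pr => e e0.
pose N' := N + e / (K + 1).
have K1 : 0 < K + 1 by lra.
have NN' : N < N' by rewrite ltrDl divr_gt0.
have N'0 : 0 < N' by exact: lt_trans NN'.
apply: (@le_trans _ _ (K * N')); last first.
  rewrite mulrDr lerD2l mulrCA ler_piMr ?(ltW e0)// ler_pdivrMr// mul1r; lra.
have [t c _] := uw.
have cf := (cvg_integral_source mO p0 mf iF fF c).2.
have cs := sqn_cvg uw.
have sN' : sqn Omega w < N' ^+ 2.
  by apply: (le_lt_trans sN); rewrite ltr_sqr// nnegrE ltW.
apply: (@cvgr_to_le _ _ _ _ _ _ _ (cvg_norm cf)).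
have : \forall k \near \oo, sqn Omega (grad (phi_ k)) < N' ^+ 2.
  exact: (cvgr_lt _ cs).
by apply: filterS => k /ltW; exact: hK.
Qed.

End Source.

End Approximable.

(** * Minimisation of the energy *)

Section Minimisation.
Context {R : realType} {n : nat}.
Variable Omega : set 'rV[R]_n.
Local Notation leb := (lebesgue_rV n).
Hypotheses (mO : measurable Omega) (finO : (leb Omega < +oo)%E).
Variables (p C : R).
Hypotheses (p2 : 2 <= p) (C0 : 0 < C).
Hypothesis sobolev : sobolev_bound Omega p C.
Variables (A : 'I_n -> 'I_n -> 'rV[R]_n -> R) (lam L : R).
Hypothesis lam0 : 0 < lam.
Hypothesis mA : forall i j, measurable_fun setT (A i j).
Hypothesis A_bdd : forall i j, {ae leb, forall x, Omega x -> `|A i j x| <= L}.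
Hypothesis A_sym : forall i j, {ae leb, forall x, Omega x -> A i j x = A j i x}.
Hypothesis A_ell : {ae leb, forall x, Omega x -> forall xi : 'I_n -> R,
  lam * \sum_i xi i ^+ 2 <= \sum_i (\sum_j A i j x * xi j) * xi i}.
Variables (g : R -> R) (Cg : R).
Hypotheses (cg : continuous g) (ndg : {homo g : x y / x <= y}).
Hypothesis g_growth : forall s t : R,
  `|g s| * `|t| <= Cg * (1 + `|s| `^ p + `|t| `^ p).
Variables (f F : 'rV[R]_n -> R).
Hypotheses (mf : measurable_fun setT f) (iF : leb.-integrable Omega (EFin \o F)).
Hypothesis fF : forall x (t : R), `|f x| * `|t| <= F x + `|t| `^ p.

Let p0 : 0 <= p. Proof. by rewrite (le_trans _ p2). Qed.
Local Notation e := (ebil Omega A).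
Local Notation tf := (test_fun Omega).
Local Notation H1p := (H10pair Omega p).
Local Notation src u := (\int[leb]_(x in Omega) (f x * u x)).
Local Notation src0 u := (\int[leb]_(x in Omega) (g 0 * u x)).
Local Notation nonlin u v := (\int[leb]_(x in Omega) (g (u x) * v x)).
Local Notation eg phi psi := (e (grad phi) (grad psi)).

Let tLq phi (tphi : tf phi) : Lq leb Omega p phi := (test_fun_Lq mO finO p0 tphi).1.
Let tL2 phi (tphi : tf phi) : L2 Omega (grad phi) := grad_L2 mO finO tphi.

Lemma nonlinear_integrable u v : Lq leb Omega p u -> Lq leb Omega p v ->
  leb.-integrable Omega (EFin \o (fun x => g (u x) * v x)).
Proof.
move=> Lu Lv.
exact: (cvg_integral_superposition mO finO p0 cg g_growth
  (dcvg_cst Lu) (dcvg_cst Lv)).1.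
Qed.

(** Puts the constant function [g 0] within the scope of [source_bound]. *)
Lemma cst_growth (c : R) : 0 <= c -> forall (x : 'rV[R]_n) (t : R),
  `|cst c x| * `|t| <= c * (c + 1) + `|t| `^ p.
Proof.
move=> c0 x t; rewrite /= ger0_norm//; have [tc|ct] := leP `|t| (c + 1).
  by rewrite -[leLHS]addr0 lerD ?powR_ge0// ler_wpM2l.
have t1 : 1 <= `|t| by lra.
apply: (@le_trans _ _ (`|t| `^ 2)); last first.
  rewrite -[leLHS]add0r lerD ?mulr_ge0 ?addr_ge0//.
  by rewrite ler_powR.
by rewrite powR_mulrn// expr2 ler_wpM2r//; lra.
Qed.

(** The bound [K] involves the Sobolev constant but not the coefficients of the
    operator; the uniformity in [eps] of the final estimate originates here. *)
Lemma pair_bound : exists2 K, 0 <= K & forall u w phi_ N, H1p u w phi_ ->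
  0 < N -> sqn Omega w <= N ^+ 2 ->
  `|src u| + `|src0 u| <= K * N.
Proof.
have [K1 K10 h1] := source_bound mO finO p2 C0 sobolev mf iF fF.
have icst : leb.-integrable Omega (EFin \o cst (`|g 0| * (`|g 0| + 1))).
  apply: (@measurable_bounded_integrable _ _ _ leb) => //.
  exact: bounded_cst.
have [K2 K20 h2] := source_bound mO finO p2 C0 sobolev
  (@measurable_cst _ _ _ _ setT (`|g 0|)) icst (cst_growth (normr_ge0 (g 0))).
exists (K1 + K2); first exact: addr_ge0.
move=> u w phi_ N uw N0 sN; rewrite mulrDl lerD ?(h1 _ _ _ _ uw)//.
have := h2 _ _ _ _ uw N0 sN.
have Lu := H10pair_Lq mO p2 uw.
have iu : leb.-integrable Omega (EFin \o u).
  have := source_integrable mO p2 (@measurable_cst _ _ _ _ setT (1 : R)) _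
    (cst_growth ler01) Lu.
  rewrite (_ : (fun x => cst 1 x * u x) = u); last by apply/funext => x; rewrite mul1r.
  apply; apply: (@measurable_bounded_integrable _ _ _ leb) => //.
  exact: bounded_cst.
by rewrite !RintegralZl// !normrM normr_id.
Qed.

Section Primitive.
Variable G : R -> R.
Hypotheses (cG : continuous G) (G0 : G 0 = 0)
  (subG : forall a b, g a * (b - a) <= G b - G a).

Lemma primitive_integrable phi : tf phi ->
  leb.-integrable Omega (EFin \o (fun x => G (phi x))).
Proof.
move=> tphi; have Lphi := tLq tphi.
have i1 := nonlinear_integrable Lphi Lphi.
have i2 : leb.-integrable Omega (EFin \o (fun x => g 0 * phi x)).
  have := @nonlinear_integrable (cst 0) phi (Lq_cst mO finO p 0) Lphi.
  exact.
have := integrableD mO (integrable_norm i2) (integrable_norm i1).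
apply: le_integrable => //.
  apply/measurable_EFinP/measurable_funTS/measurableT_comp; last exact: Lphi.1.
  exact: continuous_measurable_fun.
move=> x _; rewrite /= lee_fin [leRHS]ger0_norm ?addr_ge0//.
have h1 := subG 0 (phi x); have h2 := subG (phi x) 0.
rewrite G0 !subr0 in h1; rewrite G0 !sub0r mulrN lerN2 in h2.
rewrite ler_norml; apply/andP; split.
  by have := ler_norm (- (g 0 * phi x)); rewrite normrN;
     have := normr_ge0 (g (phi x) * phi x); lra.
by have := ler_norm (g (phi x) * phi x);
   have := normr_ge0 (g 0 * phi x); lra.
Qed.

Definition energy phi : R :=
  2^-1 * eg phi phi + \int[leb]_(x in Omega) G (phi x) - src phi.

Lemma energy_line (t : R) phi psi : tf phi -> tf psi ->
  energy (fun x => t * psi x + phi x) =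
  2^-1 * (eg phi phi + 2 * t * eg phi psi + t ^+ 2 * eg psi psi) +
  \int[leb]_(x in Omega) G (t * psi x + phi x) -
  (t * src psi + src phi).
Proof.
move=> t1 t2; rewrite /energy (grad_lin _ t2 t1).
have L1 := tL2 t1; have L2_ := tL2 t2.
have L3 := L2_lin mO t L2_ L1.
rewrite (ebil_linl mO mA A_bdd)// !(ebil_linr mO mA A_bdd A_sym)//.
rewrite (ebil_sym A_sym (grad psi) (grad phi)).
have if_ u : tf u -> leb.-integrable Omega (EFin \o (fun x => f x * u x)).
  move=> tu; refine (source_integrable mO p2 mf iF fF (tLq tu)).
have -> : \int[leb]_(x in Omega) (f x * (t * psi x + phi x)) =
    t * src psi + src phi.
  rewrite -RintegralZl//; last exact: if_.
  rewrite -RintegralD//; [|exact: (integrableZl mO t (if_ _ t2))|exact: if_].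
  by apply: eq_Rintegral => x _; rewrite mulrDr mulrCA.
move: (eg phi phi) (eg phi psi) (eg psi psi).
move=> a b c; congr (_ + _ - _); ring.
Qed.

(** Strong convexity: the defect of midpoint convexity controls the energy of
    the difference, which makes minimising sequences Cauchy. *)
Lemma energy_midpoint phi psi : tf phi -> tf psi ->
  4^-1 * eg psi psi <=
  energy phi + energy (fun x => 1 * psi x + phi x) -
  2 * energy (fun x => 2^-1 * psi x + phi x).
Proof.
move=> t1 t2; rewrite !energy_line// {1}/energy.
have ig0 := primitive_integrable t1.
have ig1 := primitive_integrable (test_fun_lin 1 t2 t1).
have ig2 := primitive_integrable (test_fun_lin 2^-1 t2 t1).
suff : 2 * \int[leb]_(x in Omega) G (2^-1 * psi x + phi x) <=
  \int[leb]_(x in Omega) G (phi x) + \int[leb]_(x in Omega) G (1 * psi x + phi x).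
  move: (eg phi phi) (eg phi psi) (eg psi psi) (src psi) (src phi)
    (\int[leb]_(x in Omega) G (phi x))
    (\int[leb]_(x in Omega) G (1 * psi x + phi x))
    (\int[leb]_(x in Omega) G (2^-1 * psi x + phi x)).
  by move=> *; lra.
rewrite -RintegralZl// -RintegralD//; apply: le_Rintegral => //.
- exact: (integrableZl mO 2 ig2).
- by have := integrableD mO ig0 ig1; apply: eq_integrable => // x _; rewrite /= -EFinD.
move=> x _; have h1 := subG (2^-1 * psi x + phi x) (phi x).
have h2 := subG (2^-1 * psi x + phi x) (1 * psi x + phi x).
by move: h1 h2; set m := g _; set Gm := G (2^-1 * _ + _); nra.
Qed.

(** A one-sided difference quotient, with the nonlinearity evaluated at the far
    end: only the subgradient inequality for [G] is available. *)
Lemma energy_increment (t : R) phi psi : 0 <= t -> tf phi -> tf psi ->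
  energy (fun x => t * psi x + phi x) - energy phi <=
  t * eg phi psi + t ^+ 2 / 2 * eg psi psi +
  t * \int[leb]_(x in Omega) (g (t * psi x + phi x) * psi x) -
  t * src psi.
Proof.
move=> t0 t1 t2; rewrite energy_line// /energy.
have ig0 := primitive_integrable t1.
have ig1 := primitive_integrable (test_fun_lin t t2 t1).
have ig := nonlinear_integrable (tLq (test_fun_lin t t2 t1)) (tLq t2).
suff : \int[leb]_(x in Omega) G (t * psi x + phi x) <=
    \int[leb]_(x in Omega) G (phi x) +
    t * \int[leb]_(x in Omega) (g (t * psi x + phi x) * psi x).
  move: (eg phi phi) (eg phi psi) (eg psi psi) (src psi) (src phi)
    (\int[leb]_(x in Omega) G (phi x))
    (\int[leb]_(x in Omega) G (t * psi x + phi x))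
    (\int[leb]_(x in Omega) (g (t * psi x + phi x) * psi x)).
  by move=> *; lra.
rewrite -RintegralZl// -RintegralD//; last exact: (integrableZl mO t ig).
apply: le_Rintegral => //.
  have := integrableD mO ig0 (integrableZl mO t ig).
  by apply: eq_integrable => // x _; rewrite /= -EFinM -EFinD.
move=> x _; have := subG (t * psi x + phi x) (phi x); nra.
Qed.

(** Ellipticity makes the energy quadratic in the gradient norm from below, while
    the source and [g 0] contribute linearly. *)
Lemma energy_bounded_below : exists m, forall phi, tf phi -> m <= energy phi.
Proof.
have [K K0 hK] := pair_bound.
exists (- K - K ^+ 2 / (2 * lam)) => phi tphi.
pose s := Num.sqrt (sqn Omega (grad phi)).
have s0 : 0 <= s by exact: sqrtr_ge0.
have sE : s ^+ 2 = sqn Omega (grad phi) by rewrite sqr_sqrtr// sqn_ge0.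
have := hK _ _ _ (s + 1) (H10pair_test mO finO p2 tphi).
rewrite -sE ltr_wpDl// => /(_ isT) h.
have {}h : `|src phi| + `|src0 phi| <= K * (s + 1) by apply: h; nra.
have i2 : leb.-integrable Omega (EFin \o (fun x => g 0 * phi x)).
  exact: (@nonlinear_integrable (cst 0) phi (Lq_cst mO finO p 0) (tLq tphi)).
have hG : src0 phi <= \int[leb]_(x in Omega) G (phi x).
  apply: le_Rintegral => //; first exact: primitive_integrable.
  by move=> x _; have := subG 0 (phi x); rewrite G0 !subr0.
have co := ebil_coercive mO mA A_bdd A_ell (tL2 tphi); rewrite -sE in co.
have a1 := ler_norm (src phi).
have a2 := ler_norm (- src0 phi).
rewrite normrN in a2; rewrite /energy.
(* completing the square *)
have sq : - (K ^+ 2 / (2 * lam)) <= 2^-1 * (lam * s ^+ 2) - K * s.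
  have -> : 2^-1 * (lam * s ^+ 2) - K * s =
    2^-1 / lam * (lam * s - K) ^+ 2 - K ^+ 2 / (2 * lam).
    by field; rewrite gt_eqF.
  by rewrite -subr_ge0 opprK subrK mulr_ge0 ?sqr_ge0// divr_ge0// ltW.
lra.
Qed.

(** By [energy_midpoint] a minimising sequence is Cauchy; the accuracy
    [lam / 8 * 16^-k] yields the rate that [H10pair_complete] asks for. *)
Lemma minimising_pair : exists phi_ u w m, [/\ H1p u w phi_,
  forall phi, tf phi -> m <= energy phi &
  forall k, energy (phi_ k) <= m + lam / 8 * (4^-1 ^+ k) ^+ 2].
Proof.
have [b hb] := energy_bounded_below.
pose S := [set energy phi | phi in tf].
have hS : has_inf S.
  split; first by exists (energy (fun=> 0)), (fun=> 0) => //; exact: test_fun0.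
  by exists b => _ [phi tphi <-]; exact: hb.
pose m := inf S.
have mle phi : tf phi -> m <= energy phi.
  by move=> tphi; apply: (ge_inf hS.2); exists phi.
have d0 (k : nat) : 0 < lam / 8 * (4^-1 ^+ k) ^+ 2.
  by rewrite mulr_gt0 ?divr_gt0// !exprn_gt0// invr_gt0.
have /choice[phi_ phiP] (k : nat) : exists phi,
    tf phi /\ energy phi <= m + lam / 8 * (4^-1 ^+ k) ^+ 2.
  have [_ [phi tphi <-] h] := inf_adherent (d0 k) hS.
  by exists phi; split => //; exact: ltW.
have tphi k : tf (phi_ k) by exact: (phiP k).1.
have [u [w uw]] : exists u w, H1p u w phi_.
  apply: (H10pair_complete mO finO p2 C0 sobolev tphi) => k.
  have td := test_fun_lin (-1) (tphi k) (tphi k.+1).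
  have := energy_midpoint (tphi k) td.
  rewrite (_ : (fun x => 1 * _ + _) = phi_ k.+1); last first.
    by apply/funext => x; ring.
  have := mle _ (test_fun_lin 2^-1 td (tphi k)).
  have := (phiP k).2; have := (phiP k.+1).2.
  have := ebil_coercive mO mA A_bdd A_ell (tL2 td).
  have ek : (4^-1 ^+ k.+1) ^+ 2 <= (4^-1 ^+ k) ^+ 2 :> R.
    by rewrite [4^-1 ^+ k.+1]exprS exprMn ler_piMl ?sqr_ge0//; lra.
  set q := sqn _ _ => co e1 e2 e3 e4.
  rewrite -(ler_pM2l lam0); rewrite -(ler_pM2l lam0) in ek.
  move: (4^-1 ^+ k.+1 ^+ 2) (4^-1 ^+ k ^+ 2) ek e1 e2 => X Y ek e1 e2; lra.
exists phi_, u, w, m; split => // k; exact: (phiP k).2.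
Qed.

(** The Euler-Lagrange inequality at the minimiser: the increment inequality is
    used along the minimising sequence at a fixed step [t], so that the energy
    of the limit itself is never considered. *)
Lemma euler_lagrange_test phi_ u w m : H1p u w phi_ ->
  (forall phi, tf phi -> m <= energy phi) ->
  (forall k, energy (phi_ k) <= m + lam / 8 * (4^-1 ^+ k) ^+ 2) ->
  forall psi, tf psi ->
  0 <= e w (grad psi) + nonlin u psi - src psi.
Proof.
move=> uw mle phim psi tpsi; have [tphi cu cw] := uw.
have Lu := H10pair_Lq mO p2 uw.
have psi_pair := H10pair_test mO finO p2 tpsi.
have cpsi : dcvg leb Omega p (fun=> psi) psi by exact: dcvg_cst (tLq tpsi).
have step (t : R) : 0 < t -> 0 <= e w (grad psi) + t / 2 * eg psi psi +
    \int[leb]_(x in Omega) (g (t * psi x + u x) * psi x) - src psi.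
  move=> t0.
  have c1 : e (grad (phi_ k)) (grad psi) @[k --> \oo] --> e w (grad psi).
    apply: (ebil_cvg mO mA A_bdd) => // i.
    exact: dcvg_cst (tL2 tpsi i).
  have c2 := (cvg_integral_superposition mO finO p0 cg g_growth
    (dcvg_lin mO t p0 cpsi cu) cpsi).2.
  have c3 : (lam / 8 * (4^-1 ^+ k) ^+ 2) / t @[k --> \oo] --> (0 : R).
    rewrite (_ : (fun k => _) = geometric (lam / 8 / t) (4^-1 ^+ 2)).
      by apply: cvg_geometric; rewrite ger0_norm ?sqr_ge0//; lra.
    by apply/funext => k; rewrite /geometric /= -!exprM mulnC mulrAC.
  have c4 := cvgD (cvgD c1 (cvg_cst (t / 2 * eg psi psi - src psi))) (cvgD c2 c3).
  rewrite addr0 in c4.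
  have {}c4 := c4 eventually_filter eventually_filter eventually_filter eventually_filter.
  rewrite [leRHS](_ : _ = e w (grad psi) + (t / 2 * eg psi psi - src psi) +
    \int[leb]_(x in Omega) (g (t * psi x + u x) * psi x)); last by ring.
  apply: (cvgr_to_ge c4); apply: nearW => k /=.
  have h1 := energy_increment (ltW t0) (tphi k) tpsi.
  have h2 := mle _ (test_fun_lin t tpsi (tphi k)).
  have h3 := phim k.
  rewrite -(pmulr_rge0 _ t0).
  rewrite !mulrDr (mulrC t (_ / t)) divfK ?gt_eqF//.
  move: h1 h2 h3.
  move: (energy (phi_ k)) (energy (fun x => t * psi x + phi_ k x)) (4^-1 ^+ k ^+ 2)
    (e (grad (phi_ k)) (grad psi)) (eg psi psi) (src psi)
    (\int[leb]_(x in Omega) (g (t * psi x + phi_ k x) * psi x)) => *; lra.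
(* it remains to let the step tend to zero, along [t = 2^-k] *)
have cu' : dcvg leb Omega p (fun k x => 2^-1 ^+ k * psi x + u x) u.
  have [mu_ iu] := Lu; have [mpsi _] := tLq tpsi; split => //.
    by move=> k; apply: measurable_funD => //; exact: measurable_funM.
  exists (fun x => `|psi x| + `|u x|).
    by apply: LqD => //; apply: Lq_norm => //; exact: tLq.
  split => [x|k]; first by rewrite lerDr.
  apply: aeW => x _; rewrite addrK normrM mulrC [`|2^-1 ^+ k|]ger0_norm ?exprn_ge0 ?invr_ge0//.
  by rewrite ler_wpM2r ?exprn_ge0 ?invr_ge0// lerDl.
have c2 := (cvg_integral_superposition mO finO p0 cg g_growth cu' cpsi).2.
have c3 : 2^-1 ^+ k / 2 * eg psi psi @[k --> \oo] --> (0 : R).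
  rewrite (_ : (fun k => _) = geometric (2^-1 * eg psi psi) 2^-1).
    by apply: cvg_geometric; rewrite ger0_norm ?invr_ge0// invf_lt1// ltr1n.
  apply/funext => k; rewrite /geometric /= mulrC mulrA mulrAC; congr (_ * _).
  exact: mulrC.
have c4 := cvgD (cvgD (cvg_cst (e w (grad psi) - src psi)) c3) c2.
rewrite addr0 in c4.
have {}c4 := c4 eventually_filter eventually_filter eventually_filter.
rewrite [leRHS](_ : _ = e w (grad psi) - src psi + nonlin u psi); last by ring.
apply: (cvgr_to_ge c4); apply: nearW => k /=.
have := step (2^-1 ^+ k) _; rewrite exprn_gt0 ?invr_gt0// => /(_ isT).
rewrite !fctE; move: (e w (grad psi)) (eg psi psi) (2^-1 ^+ k) (src psi) => *; lra.
Qed.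

End Primitive.

Definition pair_solution u w := forall v z psi_, H1p v z psi_ ->
  e w z + nonlin u v = src v.

(** Testing with [psi] and [- psi] turns the Euler-Lagrange inequality into an
    equality, which extends from test functions to their limits. *)
Lemma pair_existence : exists u w phi_, H1p u w phi_ /\ pair_solution u w.
Proof.
have [G [cG G0 subG]] := convex_primitive cg ndg.
have [phi_ [u [w [m [uw mle phim]]]]] := minimising_pair cG G0 subG.
have EL := euler_lagrange_test cG G0 subG uw mle phim.
exists u, w, phi_; split => // v z psi_ vz.
have Lw := H10pair_L2 mO uw; have Lu := H10pair_Lq mO p2 uw.
have ELeq psi : tf psi -> e w (grad psi) + nonlin u psi = src psi.
  move=> tpsi; have t0 := test_fun0 Omega.
  have := EL _ (test_fun_lin (-1) tpsi t0); have := EL _ tpsi.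
  rewrite (grad_lin _ tpsi t0) (ebil_linr mO mA A_bdd A_sym)//; [|exact: tL2|exact: tL2].
  have -> : e w (grad (fun=> 0)) = 0.
    have := ebil_linr mO mA A_bdd A_sym (-1) (tL2 t0) (tL2 t0) Lw.
    rewrite -(grad_lin _ t0 t0) (_ : (fun x => -1 * 0 + 0) = fun=> 0); last first.
      by apply/funext => x; rewrite mulr0 addr0.
    by rewrite mulN1r addNr.
  have neg (h : 'rV[R]_n -> R) : leb.-integrable Omega (EFin \o (fun x => h x * psi x)) ->
      \int[leb]_(x in Omega) (h x * (-1 * psi x + 0)) =
      - \int[leb]_(x in Omega) (h x * psi x).
    move=> ih; rewrite -[RHS]mulN1r -RintegralZl//; apply: eq_Rintegral => x _; ring.
  rewrite (neg (fun x => g (u x)) (nonlinear_integrable Lu (tLq tpsi))).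
  rewrite (neg f (source_integrable mO p2 mf iF fF (tLq tpsi))).
  move: (e w (grad psi)) (src psi) (nonlin u psi) => a b c h1 h2.
  by apply/eqP; rewrite eq_le; apply/andP; split; lra.
have [tpsi cv cz] := vz.
have c1 : e w (grad (psi_ k)) @[k --> \oo] --> e w z.
  by apply: (ebil_cvg mO mA A_bdd) => // i; exact: dcvg_cst (Lw i).
have c2 := (cvg_integral_superposition mO finO p0 cg g_growth (dcvg_cst Lu) cv).2.
have c3 := (cvg_integral_source mO p0 mf iF fF cv).2.
have c12 : (fun k => \int[leb]_(x in Omega) (f x * psi_ k x)) @ \oo -->
    e w z + nonlin u v.
  rewrite (_ : (fun k => _) = (fun k => e w (grad (psi_ k)) +
    \int[leb]_(x in Omega) (g (u x) * psi_ k x))); first exact: cvgD.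
  by apply/funext => k; rewrite ELeq.
by rewrite -(cvg_lim _ c3)// (cvg_lim _ c12).
Qed.

(** By [source_bound] for the bounded source [v / (1 + v^2)], with arbitrarily
    small [N], the integral of [v^2 / (1 + v^2)] is zero. *)
Lemma pair_grad0 v z psi_ : H1p v z psi_ -> sqn Omega z <= 0 ->
  {ae leb, forall x, Omega x -> v x = 0}.
Proof.
move=> vz z0; have Lv := H10pair_Lq mO p2 vz.
pose b (s : R) := s / (1 + s ^+ 2).
have s1 (s : R) : 0 < 1 + s ^+ 2 by rewrite ltr_pwDl ?sqr_ge0.
have cb : continuous b.
  move=> s; apply: (@cvgM _ _ _ _ id (fun s => (1 + s ^+ 2)^-1)); first exact: cvg_id.
  apply: cvgV; first by rewrite gt_eqF.
  by apply: cvgD; [exact: cvg_cst|exact: exprn_continuous].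
have b1 (s : R) : `|b s| <= 1.
  rewrite normrM normfV (gtr0_norm (s1 s)) ler_pdivrMr// mul1r.
  by rewrite -real_normK ?num_real//; have := sqr_ge0 (`|s| - 1); nra.
have mb : measurable_fun setT (b \o v).
  by apply: measurableT_comp Lv.1; exact: continuous_measurable_fun.
have icst : leb.-integrable Omega (EFin \o cst (1 * (1 + 1))).
  apply: (@measurable_bounded_integrable _ _ _ leb) => //; exact: bounded_cst.
have bF x (t : R) : `|(b \o v) x| * `|t| <= cst (1 * (1 + 1)) x + `|t| `^ p.
  apply: le_trans (cst_growth ler01 x t); apply: ler_wpM2r => //.
  by rewrite normr1; exact: b1.
have [K K0 hK] := source_bound mO finO p2 C0 sobolev mb icst bF.
have ib := source_integrable mO p2 mb icst bF Lv.
have bv0 x : 0 <= b (v x) * v x.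
  by rewrite /b mulrAC -expr2 divr_ge0 ?sqr_ge0 ?ltW.
have I0 : \int[leb]_(x in Omega) ((b \o v) x * v x) = 0.
  apply/eqP; rewrite eq_le; apply/andP; split; last first.
    by apply: Rintegral_ge0 => x _; exact: bv0.
  apply/ler_addgt0Pr => d d0; rewrite add0r.
  have N0 : 0 < d / (K + 1) by rewrite divr_gt0// ltr_wpDl.
  apply: (le_trans (ler_norm _)); apply: (le_trans (hK _ _ _ _ vz N0 _)).
    by rewrite (le_trans z0)// sqr_ge0.
  by rewrite mulrCA ler_piMr ?(ltW d0)// ler_pdivrMr ?mul1r ?ltr_wpDl//; lra.
have : (\int[leb]_(x in Omega) `|((b \o v) x * v x)%:E| = 0)%E.
  rewrite (eq_integral (fun x => ((b \o v) x * v x)%:E)); last first.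
    by move=> x _; rewrite gee0_abs// lee_fin; exact: bv0.
  by rewrite -[LHS]fineK; [congr EFin; exact: I0|exact: integrable_fin_num ib].
move/(ae_eq_integral_abs _ mO) => h.
have : ae_eq leb Omega (fun x => ((b \o v) x * v x)%:E) (cst 0%E).
  by apply/h; exact: measurable_int ib.
apply: filterS => x h' /h' [/eqP]; rewrite /b /= mulf_eq0 mulf_eq0 invr_eq0.
by rewrite (gt_eqF (s1 _)) orbF orbb => /eqP.
Qed.

(** The two equations are tested with the difference of the solutions; by
    monotonicity of [g], only the gradient term survives the subtraction. *)
Lemma pair_uniqueness u w phi_ u' w' phi'_ :
  H1p u w phi_ -> H1p u' w' phi'_ ->
  pair_solution u w -> pair_solution u' w' ->
  {ae leb, forall x, Omega x -> u' x = u x}.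
Proof.
move=> uw uw' E E'.
have vz := H10pair_lin mO p2 (-1) uw' uw.
have Lz := H10pair_L2 mO vz; have Lv := H10pair_Lq mO p2 vz.
have Lu := H10pair_Lq mO p2 uw; have Lu' := H10pair_Lq mO p2 uw'.
have Ezz := ebil_linl mO mA A_bdd (-1) (H10pair_L2 mO uw') (H10pair_L2 mO uw) Lz.
have e1 := E _ _ _ vz; have e2 := E' _ _ _ vz.
have mono : \int[leb]_(x in Omega) (g (u' x) * (-1 * u' x + u x)) <=
    \int[leb]_(x in Omega) (g (u x) * (-1 * u' x + u x)).
  apply: le_Rintegral => //; [exact: nonlinear_integrable|exact: nonlinear_integrable|].
  move=> x _; have [uu|/ltW uu] := leP (u x) (u' x); have := ndg uu; nra.
have co := ebil_coercive mO mA A_bdd A_ell Lz.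
have z0 : sqn Omega (fun i x => -1 * w' i x + w i x) <= 0.
  rewrite -(pmulr_rle0 _ lam0); apply: (le_trans co); rewrite Ezz.
  move: e1 e2 mono; lra.
by apply: filterS (pair_grad0 vz z0) => x h /h; lra.
Qed.

(** When [u] itself is the test function, monotonicity allows [g u] to be
    replaced by [g 0], and what remains is a quadratic inequality for the
    gradient norm. *)
Lemma pair_estimate K u w phi_ : 0 <= K -> H1p u w phi_ ->
  (forall N, 0 < N -> sqn Omega w <= N ^+ 2 ->
    `|src u| + `|src0 u| <= K * N) ->
  e w w + nonlin u u =
    src u ->
  sqn Omega w <= (K / lam) ^+ 2 + 2 * (K / lam).
Proof.
move=> K0 uw hK E; have Lu := H10pair_Lq mO p2 uw.
have co := ebil_coercive mO mA A_bdd A_ell (H10pair_L2 mO uw).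
pose s := Num.sqrt (sqn Omega w).
have s0 : 0 <= s by exact: sqrtr_ge0.
have sE : s ^+ 2 = sqn Omega w by rewrite sqr_sqrtr// sqn_ge0.
have mono : src0 u <= nonlin u u.
  apply: le_Rintegral => //.
  - exact: (@nonlinear_integrable (cst 0) u (Lq_cst mO finO p 0) Lu).
  - exact: nonlinear_integrable.
  by move=> x _; have [uu|/ltW uu] := leP 0 (u x); have := ndg uu; nra.
have {}hK : `|src u| + `|src0 u| <= K * (s + 1).
  by apply: hK; [rewrite ltr_wpDl|rewrite -sE; nra].
have a1 := ler_norm (src u).
have a2 := ler_norm (- src0 u); rewrite normrN in a2.
have h : lam * s ^+ 2 <= K * (s + 1).
  rewrite sE; move: co E mono hK a1 a2; lra.
rewrite -sE; have {}h : s ^+ 2 <= K / lam * (s + 1).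
  by rewrite mulrAC ler_pdivlMr// mulrC.
have B0 : 0 <= K / lam by rewrite divr_ge0// ltW.
move: (K / lam) B0 h => B B0 h; have := sqr_ge0 (s - B); nra.
Qed.

End Minimisation.

(** * Weak derivatives *)

Section WeakDerivative.
Context {R : realType} {n : nat}.
Variable Omega : set 'rV[R]_n.
Local Notation leb := (lebesgue_rV n).
Hypothesis oO : open Omega.
Implicit Types (u v w z : 'rV[R]_n -> R).

Let mO : measurable Omega. Proof. exact: open_measurable_rV. Qed.

Lemma ae_eq_lmeasurable u v : u = v %[ae leb in Omega] ->
  lmeasurable Omega u -> lmeasurable Omega v.
Proof.
move=> uv [u' mu' uu']; exists u' => //.
by apply: filterS2 uv uu' => x h1 h2 Ox; rewrite -h1// h2.
Qed.

Lemma ae_eq_loc_integrable u v : u = v %[ae leb in Omega] ->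
  loc_integrable Omega u -> loc_integrable Omega v.
Proof.
move=> uv [mu' iu]; split; first exact: ae_eq_lmeasurable mu'.
move=> K cK KO; rewrite -(@ae_eq_integral_any _ _ _ leb K (fun x => `|u x|%:E)).
  exact: iu.
by apply: filterS uv => x h /KO/h ->.
Qed.

Lemma compact_measurable_rV (K : set 'rV[R]_n) : compact K -> measurable K.
Proof.
move=> cK; apply: closed_measurable_rV.
by apply: compact_closed => //; exact: norm_hausdorff.
Qed.

Lemma loc_integrable_mul u (psi : 'rV[R]_n -> R) (K : set 'rV[R]_n) (B : R) :
  measurable_fun setT u -> loc_integrable Omega u -> measurable_fun setT psi ->
  compact K -> K `<=` Omega -> (forall x, ~ K x -> psi x = 0) ->
  (forall x, `|psi x| <= B) ->
  leb.-integrable Omega (EFin \o (fun x => u x * psi x)).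
Proof.
move=> mu' [_ iu] mpsi cK KO psi0 psiB.
have mK := compact_measurable_rV cK.
have m1 : measurable_fun setT (fun x => u x * psi x) by exact: measurable_funM.
apply/integrableP; split; first by apply/measurable_EFinP; exact: measurable_funTS.
rewrite (_ : (\int[leb]_(x in Omega) _ = \int[leb]_(x in K) `|(u x * psi x)%:E|)%E); last first.
  rewrite integral_mkcond [RHS]integral_mkcond; apply: eq_integral => x _.
  rewrite !patchE; case: ifPn => [/set_mem xO|xO].
    case: ifPn => // /negP xK /=; rewrite psi0 ?mulr0 ?normr0// => h.
    by apply: xK; rewrite inE.
  by rewrite memNset// => /KO h; case/negP: xO; rewrite inE.
apply: (@le_lt_trans _ _ (\int[leb]_(x in K) (`|B|%:E * `|u x|%:E))%E).
  apply: ge0_le_integral => //.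
  - by apply/measurable_EFinP; apply: measurableT_comp => //; exact: measurable_funTS.
  - apply: measurable_funeM; apply/measurable_EFinP.
    by apply: measurableT_comp => //; exact: measurable_funTS.
  move=> x _; rewrite -EFinM lee_fin normrM mulrC ler_wpM2r//.
  by rewrite (le_trans (psiB x))// ler_norm.
rewrite ge0_integralZl_EFin//; last first.
  by apply/measurable_EFinP; apply: measurableT_comp => //; exact: measurable_funTS.
by rewrite lte_mul_pinfty// iu.
Qed.

Lemma test_fun_support psi : test_fun Omega psi -> exists K B,
  [/\ compact K, K `<=` Omega &
    [/\ measurable_fun setT psi, forall x, ~ K x -> psi x = 0 & forall x, `|psi x| <= B] /\
    forall i, [/\ measurable_fun setT (pd i psi), forall x, ~ K x -> pd i psi x = 0 &
      forall x, `|pd i psi x| <= B]].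
Proof.
move=> tpsi; have [M Cpsi] := test_fun_C1c tpsi; have [c d cd psiM] := Cpsi.
have [_ cK KO] := tpsi.
have [B0 B00 hB0] := continuous_supported_bounded c psiM.
have /choice[B1 hB1] i : exists B, forall x, `|pd i psi x| <= B.
  have [|B _ hB] := @continuous_supported_bounded _ _ (pd i psi) M (cd i).
    by move=> x; exact: pd_vanishes.
  by exists B.
pose K := closure [set x | psi x != 0].
have tK : test_fun K psi by case: tpsi => *; split.
exists K, (B0 + \sum_i `|B1 i|); split => //; split.
  split.
  - exact: continuous_measurable_rV.
  - by move=> x /(test_fun_out tK)[].
  - by move=> x; rewrite (le_trans (hB0 x))// lerDl sumr_ge0.
move=> i; split.
- exact: continuous_measurable_rV.
- by move=> x /(test_fun_out tK)[_].
- move=> x; rewrite (le_trans (hB1 i x))// (le_trans (ler_norm _))//.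
  by rewrite (bigD1 i)//= addrCA lerDl addr_ge0// sumr_ge0.
Qed.

Lemma ae_eq_weak_pd i u v w z : u = v %[ae leb in Omega] ->
  w = z %[ae leb in Omega] -> is_weak_pd Omega i u w -> is_weak_pd Omega i v z.
Proof.
move=> uv wz [iu iw uw]; split.
- exact: ae_eq_loc_integrable iu.
- exact: ae_eq_loc_integrable iw.
move=> psi tpsi.
rewrite -(@ae_eq_integral_any _ _ _ leb Omega (fun x => (u x * pd i psi x)%:E)); last first.
  by apply: filterS uv => x h /h ->.
rewrite -(@ae_eq_integral_any _ _ _ leb Omega (fun x => (w x * psi x)%:E) (fun x => (z x * psi x)%:E)); last first.
  by apply: filterS wz => x h /h ->.
exact: uw.
Qed.

Lemma loc_integrable_rep u : loc_integrable Omega u -> exists2 u',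
  measurable_fun setT u' & u = u' %[ae leb in Omega] /\ loc_integrable Omega u'.
Proof.
move=> lu; have [[u' mu' uu'] _] := lu; exists u' => //; split => //.
exact: ae_eq_loc_integrable lu.
Qed.

Lemma loc_integrable_sub u v : loc_integrable Omega u -> loc_integrable Omega v ->
  loc_integrable Omega (fun x => u x - v x).
Proof.
move=> /loc_integrable_rep[u' mu' [uu' lu]] /loc_integrable_rep[v' mv [vv' lv]].
apply: (@ae_eq_loc_integrable (fun x => u' x - v' x)).
  by apply: filterS2 uu' vv' => x h1 h2 Ox; rewrite h1// h2.
split.
  by exists (fun x => u' x - v' x); [exact: measurable_funB|exact: aeW].
move=> K cK KO; have mK := compact_measurable_rV cK.
apply: (@le_lt_trans _ _ (\int[leb]_(x in K) (`|u' x|%:E + `|v' x|%:E))%E).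
  apply: ge0_le_integral => //.
  - apply/measurable_EFinP/measurable_funTS/measurableT_comp => //.
    exact: measurable_funB.
  - by apply: emeasurable_funD; apply/measurable_EFinP/measurable_funTS;
      exact: measurableT_comp.
  by move=> x _; rewrite -EFinD lee_fin ler_normB.
rewrite ge0_integralD//; last 2 first.
- by apply/measurable_EFinP/measurable_funTS/measurableT_comp.
- by apply/measurable_EFinP/measurable_funTS/measurableT_comp.
by rewrite lte_add_pinfty ?lu.2 ?lv.2.
Qed.

Lemma weak_pd_sub i u v w z : is_weak_pd Omega i u w -> is_weak_pd Omega i v z ->
  is_weak_pd Omega i (fun x => u x - v x) (fun x => w x - z x).
Proof.
move=> uw vz; have [lu lw _] := uw; have [lv lz _] := vz.
have [u' mu' [uu' lu']] := loc_integrable_rep lu.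
have [v' mv' [vv' lv']] := loc_integrable_rep lv.
have [w' mw' [ww' lw']] := loc_integrable_rep lw.
have [z' mz' [zz' lz']] := loc_integrable_rep lz.
have [_ _ uw'] := ae_eq_weak_pd uu' ww' uw.
have [_ _ vz'] := ae_eq_weak_pd vv' zz' vz.
apply: (@ae_eq_weak_pd i (fun x => u' x - v' x) _ (fun x => w' x - z' x)).
- by apply: filterS2 uu' vv' => x h1 h2 Ox; rewrite h1// h2.
- by apply: filterS2 ww' zz' => x h1 h2 Ox; rewrite h1// h2.
split; [exact: loc_integrable_sub|exact: loc_integrable_sub|].
move=> psi tpsi.
have [K [B [cK KO [[m1 o1 b1] /(_ i)[m2 o2 b2]]]]] := test_fun_support tpsi.
have iu := loc_integrable_mul mu' lu' m2 cK KO o2 b2.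
have iv := loc_integrable_mul mv' lv' m2 cK KO o2 b2.
have iw := loc_integrable_mul mw' lw' m1 cK KO o1 b1.
have iz := loc_integrable_mul mz' lz' m1 cK KO o1 b1.
have e1 := uw' _ tpsi; have e2 := vz' _ tpsi.
rewrite (eq_integral (fun x => (u' x * pd i psi x)%:E - (v' x * pd i psi x)%:E)%E); last first.
  by move=> x _; rewrite -EFinB -mulrBl.
rewrite integralB// [in RHS](eq_integral (fun x => (w' x * psi x)%:E - (z' x * psi x)%:E)%E); last first.
  by move=> x _; rewrite -EFinB -mulrBl.
rewrite integralB// fin_num_oppeB; last exact: integrable_fin_num iz.
by rewrite -e1 addeC -[X in (_ = _ + X)%E]oppeK -e2 addeC.
Qed.

(** Two weak derivatives of the same function differ by a function that is
    orthogonal to all test functions. *)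
Lemma weak_pd_unique i u w z : is_weak_pd Omega i u w -> is_weak_pd Omega i u z ->
  w = z %[ae leb in Omega].
Proof.
move=> uw uz; have [_ l0 h0] := weak_pd_sub uw uz.
have [y my [yy ly]] := loc_integrable_rep l0.
have := @fundamental_lemma _ _ Omega oO y my.
move=> h; have : {ae leb, forall x, Omega x -> y x = 0}.
  apply: h => [a e aO|psi tpsi].
    have mK := measurable_cbox a e.
    apply/integrableP; split.
      by apply/measurable_EFinP; exact: measurable_funTS.
    by apply: ly.2 => //; exact: compact_cbox.
  rewrite -(@ae_eq_integral_any _ _ _ leb Omega (fun x => ((w x - z x) * psi x)%:E)); last first.
    by apply: filterS yy => x hx /hx ->.
  apply: oppe_inj; rewrite -h0// oppe0; apply: integral0_eq => x _.
  by rewrite subrr mul0r.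
apply: filterS2 yy => x h1 h2 Ox.
by apply/eqP; rewrite -subr_eq0 h1// h2.
Qed.

Lemma weak_pdE i u w : is_weak_pd Omega i u w -> weak_pd Omega i u = w %[ae leb in Omega].
Proof.
move=> uw; apply: (@weak_pd_unique i u) => //.
by rewrite /weak_pd; case: xgetP => [y -> //|/(_ w)/(_ uw)].
Qed.

End WeakDerivative.

(** * The space H10 as the set of limits of test functions *)

Section Lpnorm.
Context {R : realType} {n : nat}.
Variable Omega : set 'rV[R]_n.
Local Notation leb := (lebesgue_rV n).
Implicit Types (f : 'rV[R]_n -> R).

Lemma Lpnorm_powR q f : q != 0 ->
  (Lpnorm Omega q f `^ q = \int[leb]_(x in Omega) (`|f x| `^ q)%:E)%E.
Proof.
move=> q0; rewrite /Lpnorm.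
rewrite poweR_Lnorm.
  2: exact: q0.
rewrite [RHS]integral_mkcond.
apply: eq_integral => x _; rewrite /= !patchE.
by case: ifP => //= _; rewrite normr0 powR0.
Qed.

Lemma poweR_sqr (x : \bar R) : (0 <= x)%E -> (x `^ 2 = x ^+ 2)%E.
Proof.
case: x => [r|//|//].
  by rewrite lee_fin => r0; rewrite poweR_EFin powR_mulrn// EFin_expe.
by move=> _; rewrite poweRyr ?pnatr_eq0// expe2 mulyy.
Qed.

Lemma Lpnorm_sqr f :
  (Lpnorm Omega 2 f ^+ 2 = \int[leb]_(x in Omega) (f x ^+ 2)%:E)%E.
Proof.
rewrite -poweR_sqr ?Lnorm_ge0// Lpnorm_powR ?pnatr_eq0//.
by apply: eq_integral => x _; rewrite powR_mulrn// real_normK// num_real.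
Qed.

Lemma Lp_rep q f : 0 < q -> Lp Omega q f ->
  exists2 f', Lq leb Omega q f' & f = f' %[ae leb in Omega].
Proof.
move=> q0 [[f' mf' ff'] fq]; exists f' => //; apply: Lq_lty => //.
rewrite -(@ae_eq_integral_any _ _ _ leb Omega (fun x => (`|f x| `^ q)%:E)).
  by rewrite -Lpnorm_powR ?gt_eqF// poweR_lty.
by apply: filterS ff' => x h /h ->.
Qed.

Lemma Lq_Lp q f f' : 0 < q -> Lq leb Omega q f' -> f = f' %[ae leb in Omega] ->
  Lp Omega q f.
Proof.
move=> q0 [mf' if'] ff'; split; first by exists f'.
apply: (@lty_poweRy _ _ q); rewrite ?gt_eqF// Lpnorm_powR ?gt_eqF//.
rewrite (@ae_eq_integral_any _ _ _ leb Omega _ (fun x => (`|f' x| `^ q)%:E)); last first.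
  by apply: filterS ff' => x h /h ->.
have /integrableP[_] := if'.
by under eq_integral do rewrite gee0_abs ?lee_fin ?powR_ge0//.
Qed.

Lemma sqrte_lt (x : \bar R) (e : R) : 0 < e -> (0 <= x)%E ->
  (sqrte x < e%:E)%E = (x < (e ^+ 2)%:E)%E.
Proof.
move=> e0; case: x => [r|//|//]; rewrite lee_fin !lte_fin => r0.
by rewrite -{1}(gtr0_norm e0) -sqrtr_sqr ltr_sqrt// exprn_gt0.
Qed.

End Lpnorm.

Section Pairs.
Context {R : realType} {n : nat}.
Variable Omega : set 'rV[R]_n.
Local Notation leb := (lebesgue_rV n).
Hypotheses (oO : open Omega) (finO : (leb Omega < +oo)%E).
Variables (p : R).
Hypothesis p2 : 2 <= p.
Implicit Types (u v f : 'rV[R]_n -> R) (w z : 'I_n -> 'rV[R]_n -> R).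

Let mO : measurable Omega. Proof. exact: open_measurable_rV. Qed.
Let p0 : 0 <= p. Proof. by rewrite (le_trans _ p2). Qed.
Local Notation L2f := (Lq leb Omega 2).

Lemma dcvg_sub2 q (f_ : nat -> 'rV[R]_n -> R) f : 2 <= q ->
  dcvg leb Omega q f_ f -> dcvg leb Omega 2 f_ f.
Proof.
move=> q2 [m1 m2 [M LM h]]; split => //.
by exists M => //; exact: Lq_sub2 LM.
Qed.

Lemma quarter_step (t : R) :
  2 * (2^-1 * t) ^+ 2 + 2 * (2^-1 * (4^-1 * t)) ^+ 2 <= t ^+ 2.
Proof.
rewrite (_ : 2 * _ + _ = 17 / 32 * t ^+ 2); last by field.
by have := sqr_ge0 t; lra.
Qed.

Lemma half_quarter_sqr_le k : (2^-1 * 4^-1 ^+ k) ^+ 2 <= 4^-1 ^+ k :> R.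
Proof.
have : 0 <= (4^-1 ^+ k : R) by rewrite exprn_ge0.
have : (4^-1 ^+ k : R) <= 1 by rewrite exprn_ile1// invf_le1 ?ler1n.
by move: (4^-1 ^+ k) => t t1 t0; rewrite exprMn; nra.
Qed.

Definition int2 f : R := \int[leb]_(x in Omega) (f x * f x).

Lemma int2_ge0 f : 0 <= int2 f.
Proof. by apply: Rintegral_ge0 => x _; rewrite -expr2 sqr_ge0. Qed.

Lemma int2E f : L2f f -> (\int[leb]_(x in Omega) (f x ^+ 2)%:E = (int2 f)%:E)%E.
Proof.
move=> Lf; rewrite /int2 /Rintegral fineK; last first.
  by apply: integrable_fin_num => //; exact: (L2_sqr_integrable mO Lf).
by apply: eq_integral => x _; rewrite expr2.
Qed.

Lemma L2fB f1 f2 : L2f f1 -> L2f f2 -> L2f (fun x => f1 x - f2 x).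
Proof.
move=> L1 L2; have := LqD mO (ler0n R 2) L1 (LqZ mO (-1) L2).
by rewrite (_ : (fun x => _ + _) = (fun x => f1 x - f2 x))//;
  apply/funext => x; rewrite mulN1r.
Qed.

Lemma int2_sub_le f1 f2 : L2f f1 -> L2f f2 ->
  int2 (fun x => f1 x - f2 x) <= 2 * int2 f1 + 2 * int2 f2.
Proof.
move=> L1 L2; have i1 := L2_sqr_integrable mO L1; have i2 := L2_sqr_integrable mO L2.
rewrite /int2 -!RintegralZl// -RintegralD//; last 2 first.
- exact: (integrableZl mO 2 i1).
- exact: (integrableZl mO 2 i2).
apply: le_Rintegral => //.
- exact: L2_sqr_integrable (L2fB L1 L2).
- have := integrableD mO (integrableZl mO 2 i1) (integrableZl mO 2 i2).
  by apply: eq_integrable => // x _; rewrite /= -!EFinM -EFinD.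
- by move=> x _; have := sqr_ge0 (f1 x + f2 x); nra.
Qed.

Lemma sqn_sub_le w z : L2 Omega w -> L2 Omega z ->
  sqn Omega (fun i x => w i x - z i x) <= 2 * sqn Omega w + 2 * sqn Omega z.
Proof.
move=> Lw Lz; rewrite /sqn !mulr_sumr -big_split /=; apply: ler_sum => i _.
exact: int2_sub_le (Lw i) (Lz i).
Qed.

Lemma int2_eq0 f : L2f f -> int2 f = 0 -> {ae leb, forall x, Omega x -> f x = 0}.
Proof.
move=> Lf f0; have := int2E Lf; rewrite f0.
have m2 : measurable_fun Omega (fun x => (f x ^+ 2)%:E).
  apply/measurable_EFinP/measurable_funTS/measurable_funX; exact: Lf.1.
have := (ae_eq_integral_abs leb mO m2).1.
under eq_integral do rewrite gee0_abs ?lee_fin ?sqr_ge0//.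
move=> h /h; apply: filterS => x hx Ox.
by have [/eqP] := hx Ox; rewrite sqrf_eq0 => /eqP.
Qed.

Lemma dcvg_int2 (f_ : nat -> 'rV[R]_n -> R) f : dcvg leb Omega 2 f_ f ->
  int2 (fun x => f x - f_ k x) @[k --> \oo] --> (0 : R).
Proof.
move=> cf; have Lf := dcvg_Lq mO (ler0n R 2) cf.
have c1 := dcvg_lin mO (-1) (ler0n R 2) cf (dcvg_cst Lf).
have b1 : {ae leb, forall x, Omega x -> `|cst (1 : R) x| <= 1}.
  by apply: aeW => x _; rewrite normr1.
have cc := cvg_integral_mul mO (@measurable_cst _ _ _ _ setT (1 : R)) b1 c1 c1.
rewrite [X in _ --> X](_ : _ = 0) in cc; last first.
  by under eq_Rintegral do rewrite mulN1r addNr mulr0; rewrite Rintegral_cst// mul0r.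
apply: cvg_trans cc; apply: near_eq_cvg; near=> k.
by rewrite /int2; apply: eq_Rintegral => x _; rewrite /= mul1r mulN1r [- _ + _]addrC.
Unshelve. all: by end_near. Qed.

Lemma L2f_integrable f : L2f f -> leb.-integrable Omega (EFin \o f).
Proof.
move=> Lf; have := Lq2_mul_integrable mO (@measurable_cst _ _ _ _ setT (1 : R)) (L := 1)
  _ Lf (Lq_cst mO finO 2 1).
rewrite (_ : (fun x => _) = f); last by apply/funext => x; rewrite /= mul1r mulr1.
by apply; apply: aeW => x _; rewrite /= normr1.
Qed.

Lemma L2f_loc_integrable f : L2f f -> loc_integrable Omega f.
Proof.
move=> Lf; split; first by exists f; [exact: Lf.1|exact: aeW].
move=> K cK KO; have /integrableP[mf] := L2f_integrable Lf.
apply: le_lt_trans; apply: ge0_subset_integral => //.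
- exact: compact_measurable_rV.
- by apply/measurable_EFinP/measurable_funTS/measurableT_comp => //; exact: Lf.1.
Qed.

(** Integration by parts passes to the limit along the approximations. *)
Lemma weak_pd_limit (phi_ : nat -> 'rV[R]_n -> R) u (w : 'rV[R]_n -> R) i :
  (forall k, test_fun Omega (phi_ k)) -> dcvg leb Omega 2 phi_ u ->
  dcvg leb Omega 2 (fun k => pd i (phi_ k)) w -> is_weak_pd Omega i u w.
Proof.
move=> tphi cu cw.
have Lu := dcvg_Lq mO (ler0n R 2) cu; have Lw := dcvg_Lq mO (ler0n R 2) cw.
split; [exact: L2f_loc_integrable|exact: L2f_loc_integrable|move=> psi tpsi].
have [Lpsi /(_ i) Ldpsi] := test_fun_Lq mO finO (ler0n R 2) tpsi.
have b1 : {ae leb, forall x, Omega x -> `|cst (1 : R) x| <= 1}.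
  by apply: aeW => x _; rewrite normr1.
have m1 := @measurable_cst _ _ _ _ [set: 'rV[R]_n] (1 : R).
have E f1 f2 : L2f f1 -> L2f f2 -> (\int[leb]_(x in Omega) (f1 x * f2 x)%:E =
    (\int[leb]_(x in Omega) (cst 1 x * f1 x * f2 x))%:E)%E.
  move=> L1 L2; have i12 := Lq2_mul_integrable mO m1 b1 L1 L2.
  rewrite /Rintegral fineK; last exact: integrable_fin_num.
  by apply: eq_integral => x _; rewrite /= mul1r.
rewrite !E// -EFinN; congr EFin.
have h1 := cvg_integral_mul mO m1 b1 cu (dcvg_cst Ldpsi).
have h2 := cvgN (cvg_integral_mul mO m1 b1 cw (dcvg_cst Lpsi)).
rewrite -(cvg_lim _ h1)//; apply: cvg_lim => //.
apply: cvg_trans (h2 eventually_filter); apply: near_eq_cvg; near=> k.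
have [Lphi /(_ i) Ldphi] := test_fun_Lq mO finO (ler0n R 2) (tphi k).
have ibp := integration_by_parts_pd i (tphi k) tpsi.
have := etrans (esym (E _ _ Lphi Ldpsi)) (etrans ibp (congr1 oppe (E _ _ Ldphi Lpsi))).
by move=> /(@EFin_inj R) /= ->.
Unshelve. all: by end_near. Qed.

Lemma test_weak_pd phi i : test_fun Omega phi -> is_weak_pd Omega i phi (pd i phi).
Proof.
move=> tphi; have [L1 L2] := test_fun_Lq mO finO (ler0n R 2) tphi.
apply: (@weak_pd_limit (fun=> phi)) => //; exact: dcvg_cst.
Qed.

Lemma H10pair_weak_pd u w phi_ i : H10pair Omega p u w phi_ ->
  is_weak_pd Omega i u (w i).
Proof. by move=> [t c d]; apply: weak_pd_limit t (dcvg_sub2 p2 c) (d i). Qed.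

Lemma enorm_sqr (x : 'rV[R]_n) : enorm x ^+ 2 = \sum_i (x ord0 i) ^+ 2.
Proof.
rewrite /enorm sqr_sqrtr; first by apply: eq_bigr => i _; rewrite expr2.
by apply: sumr_ge0 => i _; rewrite -expr2 sqr_ge0.
Qed.

Lemma weak_grad_norm v w : (forall i, is_weak_pd Omega i v (w i)) -> L2 Omega w ->
  (Lpnorm Omega 2 (enorm \o weak_grad Omega v) ^+ 2 = (sqn Omega w)%:E)%E.
Proof.
move=> vw Lw; rewrite Lpnorm_sqr -sqn_integral//; apply: ae_eq_integral_any.
have ae_w : {ae leb, forall x i, Omega x -> weak_pd Omega i v x = w i x}.
  by apply: filter_forall => i; exact: (weak_pdE oO (vw i)).
apply: filterS ae_w => x h Ox /=; rewrite enorm_sqr; congr EFin.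
by apply: eq_bigr => i _; rewrite mxE h.
Qed.

(** Replaces the arbitrarily chosen weak derivatives in the H1 norm by given
    Borel representatives. *)
Lemma H1norm_sub v u w phi : v = u %[ae leb in Omega] -> L2f u -> L2 Omega w ->
  (forall i, is_weak_pd Omega i v (w i)) -> test_fun Omega phi ->
  H1norm Omega (v \- phi) = sqrte ((int2 (fun x => u x - phi x))%:E +
    (sqn Omega (fun i x => w i x - pd i phi x))%:E)%E.
Proof.
move=> vu Lu Lw vw tphi; have [L1 L2] := test_fun_Lq mO finO (ler0n R 2) tphi.
rewrite /H1norm; congr (sqrte (_ + _)%E).
  rewrite Lpnorm_sqr -int2E; last exact: L2fB.
  by apply: ae_eq_integral_any; apply: filterS vu => x h /h /= ->.
apply: weak_grad_norm => i; last exact: L2fB.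
exact: weak_pd_sub (vw i) (test_weak_pd i tphi).
Qed.

(** The approximating test functions converge in the H1 norm. *)
Lemma H10pair_H10 v u w phi_ : v = u %[ae leb in Omega] ->
  H10pair Omega p u w phi_ ->
  H10 Omega v /\ forall i, is_weak_pd Omega i v (w i).
Proof.
move=> vu uw; have [t c d] := uw.
have Lw := H10pair_L2 mO uw.
have Lu := Lq_sub2 mO finO p2 (H10pair_Lq mO p2 uw).
have uv : u = v %[ae leb in Omega] by apply: filterS vu => x h Ox; rewrite h.
have vw i : is_weak_pd Omega i v (w i).
  by apply: ae_eq_weak_pd uv _ (H10pair_weak_pd i uw); exact: aeW.
split => //; split.
  split; first exact: Lq_Lp Lu vu.
  by move=> i; exists (w i) => //; apply: Lq_Lp (Lw i) _ => //; exact: aeW.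
move=> e e0.
have : int2 (fun x => u x - phi_ k x) + \sum_i int2 (fun x => w i x - pd i (phi_ k) x)
    @[k --> \oo] --> (0 : R) + \sum_(i < n) (0 : R).
  apply: cvgD; first exact: dcvg_int2 (dcvg_sub2 p2 c).
  apply: cvg_big => [|i _]; first exact: add_continuous.
  exact: dcvg_int2 (d i).
rewrite big1// addr0 => /cvgr0Pnorm_lt/(_ (e ^+ 2)).
rewrite exprn_gt0// => /(_ isT)[k _ /(_ k (leqnn k)) hk].
exists (phi_ k) => //.
rewrite (@H1norm_sub v u w)// sqrte_lt//.
  by rewrite -EFinD lte_fin; exact: le_lt_trans (ler_norm _) hk.
by rewrite -EFinD lee_fin addr_ge0 ?sqn_ge0 ?int2_ge0.
Qed.

Variable C : R.
Hypothesis C0 : 0 < C.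
Hypothesis sobolev : sobolev_bound Omega p C.

(** Test functions that approximate [v] in the H1 norm at the rate [4^-k] have
    fast converging gradients, hence a limit in the sense of [H10pair]; it agrees
    with [v] because both are limits in [L^2]. *)
Lemma H10_H10pair v : H10 Omega v -> exists u w phi_,
  v = u %[ae leb in Omega] /\ H10pair Omega p u w phi_.
Proof.
move=> [[Lv dv] hv].
have [u Lu vu] := Lp_rep (ltr0n R 2) Lv.
have /choice[w hw] i : exists y, is_weak_pd Omega i v y /\ L2f y.
  have [w0 vw0 Lw0] := dv i; have [w Lw ww] := Lp_rep (ltr0n R 2) Lw0.
  by exists w; split => //; apply: ae_eq_weak_pd ww vw0; exact: aeW.
have Lw : L2 Omega w by move=> i; exact: (hw i).2.
have vw i := (hw i).1.
pose e k : R := 2^-1 * 4^-1 ^+ k.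
have e0 k : 0 < e k by rewrite mulr_gt0// ?invr_gt0// exprn_gt0// invr_gt0.
have /choice[phi_ hphi] k : exists phi, test_fun Omega phi /\
    (H1norm Omega (v \- phi)%R < (e k)%:E)%E.
  by have [phi] := hv _ (e0 k); exists phi.
have tphi k := (hphi k).1.
have {}hphi k : int2 (fun x => u x - phi_ k x) < e k ^+ 2 /\
    sqn Omega (fun i x => w i x - pd i (phi_ k) x) < e k ^+ 2.
  have s1 := int2_ge0 (fun x => u x - phi_ k x).
  have s2 := sqn_ge0 Omega (fun i x => w i x - pd i (phi_ k) x).
  have [_] := hphi k; rewrite (@H1norm_sub v u w)// sqrte_lt//; last first.
    by rewrite -EFinD lee_fin addr_ge0.
  rewrite -EFinD lte_fin => h.
  by split; apply: le_lt_trans h; rewrite ?lerDl ?lerDr.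
have L2phi k : L2f (phi_ k) := (test_fun_Lq mO finO (ler0n R 2) (tphi k)).1.
have L2dphi k i : L2f (pd i (phi_ k)) := (test_fun_Lq mO finO (ler0n R 2) (tphi k)).2 i.
have [k|u0 [w1 uw]] := @H10pair_complete _ _ _ mO finO _ _ p2 C0 sobolev phi_ tphi.
  rewrite (grad_lin _ (tphi k) (tphi k.+1)) (_ : (fun i x => _) = (fun i x => (w i x - pd i (phi_ k) x) -
      (w i x - pd i (phi_ k.+1) x))); last first.
    by apply/funext => i; apply/funext => x; rewrite /grad; ring.
  apply: (@le_trans _ _ (2 * sqn Omega (fun i x => w i x - pd i (phi_ k) x) +
    2 * sqn Omega (fun i x => w i x - pd i (phi_ k.+1) x))).
    by apply: (@sqn_sub_le (fun i x => w i x - pd i (phi_ k) x)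
      (fun i x => w i x - pd i (phi_ k.+1) x)) => i; exact: L2fB.
  have [_ h1] := hphi k; have [_ h2] := hphi k.+1.
  have := lerD (ler_wpM2l (ler0n R 2) (ltW h1)) (ler_wpM2l (ler0n R 2) (ltW h2)).
  by move/le_trans; apply; rewrite /e [4^-1 ^+ k.+1]exprS quarter_step.
exists u0, w1, phi_; split => //.
have [_ c _] := uw; have cu := dcvg_int2 (dcvg_sub2 p2 c).
have Lu0 := Lq_sub2 mO finO p2 (H10pair_Lq mO p2 uw).
have b k : int2 (fun x => u x - u0 x) <=
    2 * (4^-1 ^+ k) + 2 * int2 (fun x => u0 x - phi_ k x).
  have := int2_sub_le (L2fB Lu (L2phi k)) (L2fB Lu0 (L2phi k)).
  rewrite (_ : (fun x => _ - _ - _) = (fun x => u x - u0 x)); last first.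
    by apply/funext => x; ring.
  move/le_trans; apply; rewrite lerD2r ler_pM2l// (le_trans (ltW (hphi k).1))//.
  exact: half_quarter_sqr_le.
have l0 : int2 (fun x => u x - u0 x) <= 0.
  have c1 : 2 * (4^-1 ^+ k : R) + 2 * int2 (fun x => u0 x - phi_ k x) @[k --> \oo] -->
      2 * (0 : R) + 2 * 0.
    apply: cvgD; apply: cvgMl_tmp => //.
    by apply: cvg_expr; rewrite ger0_norm ?invf_lt1 ?ltr1n.
  rewrite mulr0 addr0 in c1.
  by apply: (cvgr_to_ge c1); near=> k; exact: b.
have : int2 (fun x => u x - u0 x) = 0.
  by apply/eqP; rewrite eq_le l0 int2_ge0.
move=> /(int2_eq0 (L2fB Lu Lu0)) uu0.
apply: filterS2 vu uu0 => x h1 h2 Ox; rewrite h1//.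
by apply/eqP; rewrite -subr_eq0 h2.
Unshelve. all: by end_near. Qed.

End Pairs.

(** * Dilations of R^n *)

Section Dilation.
Context {R : realType}.
Variable c : R.
Hypothesis c0 : 0 < c.
Local Notation mu1 := (@lebesgue_measure R).

Lemma measurable_dilation1 : measurable_fun setT (fun t : measurableTypeR R => c * t : measurableTypeR R).
Proof. exact: measurable_funM. Qed.

(** The scaled image of the Lebesgue measure agrees with the Lebesgue measure on
    half-open intervals. *)
Lemma integral_dilation1 (G : measurableTypeR R -> \bar R) :
  measurable_fun setT G -> (forall t, 0 <= G t)%E ->
  (\int[mu1]_t G t = c%:E * \int[mu1]_t G (c * t)%R)%E.
Proof.
move=> mG G0.
pose push : {measure set (measurableTypeR R) -> \bar R} :=
  @measure_function_pushforward__canonical__measure_function_Measure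
    _ _ _ _ R mu1 _ measurable_dilation1.
pose m1 : {measure set (measurableTypeR R) -> \bar R} := mscale (NngNum (ltW c0)) push.
have E A : measurable A -> mu1 A = m1 A.
  apply: lebesgue_measure_unique => _ [[a b] _ <-].
  rewrite lebesgue_measure_itv /= /mscale /= /pushforward /=.
  rewrite (_ : _ @^-1` _ = `]c^-1 * a, c^-1 * b]%classic).
    rewrite lebesgue_measure_itv /= !lte_fin ltr_pM2l ?invr_gt0//.
    case: ifP => _; last by rewrite mule0.
    by rewrite -!EFinB -EFinM -mulrBr mulrA divff ?mul1r ?gt_eqF.
  apply/seteqP; split => t /=; rewrite !in_itv /= => /andP[h1 h2].
    by rewrite ltr_pdivrMl// h1 ler_pdivlMl// h2.
  by rewrite -ltr_pdivrMl// h1 -ler_pdivlMl// h2.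
rewrite (eq_measure_integral m1); last by move=> A mA _; exact: E.
rewrite ge0_integral_mscale//=; congr (_ * _)%E.
have h := @ge0_integral_pushforward _ _ _ _ R _ measurable_dilation1 mu1 setT G
  measurableT mG (fun y _ => G0 y).
by rewrite preimage_setT in h; exact: h.
Qed.

Lemma measurable_dilation n : measurable_fun setT (fun x : 'rV[R]_n => c *: x).
Proof.
apply: measurable_fun_rVP => i.
rewrite (_ : _ \o _ = fun x : 'rV[R]_n => c * rV_coord i x).
  by apply: measurable_funM => //; exact: measurable_rV_coord.
by apply/funext => x; rewrite /= /rV_coord mxE.
Qed.

Lemma dilation_cons n (t : measurableTypeR R) (x : 'rV[R]_n) :
  c *: rV_cons (t, x) = rV_cons ((c * t : measurableTypeR R), c *: x).
Proof.
apply/rowP => k; rewrite mxE; case: (unliftP ord0 k) => [j|] ->.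
  by rewrite !rV_consS mxE.
by rewrite !rV_cons0.
Qed.

Lemma integral_dilation n (F : 'rV[R]_n -> \bar R) :
  measurable_fun setT F -> (forall x, 0 <= F x)%E ->
  (\int[lebesgue_rV n]_x F x = (c ^+ n)%:E * \int[lebesgue_rV n]_x F (c *: x)%R)%E.
Proof.
elim: n F => [|n ih] F mF F0.
  rewrite expr0 mul1e; apply: eq_integral => x _; congr F.
  by apply/rowP => -[].
have mFc : measurable_fun setT (fun x : 'rV[R]_n.+1 => F (c *: x)).
  exact: (measurableT_comp mF (@measurable_dilation n.+1)).
rewrite !tonelli_rVS// integral_dilation1//; last 2 first.
- exact: measurable_section_integral.
- by move=> t; exact: integral_ge0.
rewrite exprS EFinM -muleA; congr (_ * _)%E.
rewrite -ge0_integralZl_EFin//; last 3 first.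
- by move=> t _; exact: integral_ge0.
- exact: measurable_section_integral mFc _.
- by rewrite exprn_ge0// ltW.
apply: eq_integral => t _; rewrite ih//.
  by congr (_ * _)%E; apply: eq_integral => x _; rewrite -dilation_cons.
exact: (measurableT_comp mF (measurable_rV_cons2 _)).
Qed.

(** Carries the properties of the coefficients that hold up to null sets over to
    the rescaled coefficients. *)
Lemma ae_dilation n (P : 'rV[R]_n -> Prop) :
  {ae lebesgue_rV n, forall x, P x} -> {ae lebesgue_rV n, forall x, P (c *: x)}.
Proof.
move=> [N [mN N0 hN]].
have mNc : measurable ((fun x : 'rV[R]_n => c *: x) @^-1` N).
  by rewrite -[X in measurable X]setTI; exact: measurable_dilation.
exists ((fun x : 'rV[R]_n => c *: x) @^-1` N); split => //; last by move=> x; exact: hN.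
have m1N : measurable_fun setT (fun x : 'rV[R]_n => (\1_N x : R)%:E).
  by apply/measurable_EFinP; exact: measurable_indic.
have h1N (x : 'rV[R]_n) : (0 <= (\1_N x : R)%:E)%E by rewrite lee_fin.
have h := integral_dilation m1N h1N.
have e1 : (\int[lebesgue_rV n]_x (\1_N x : R)%:E = 0)%E by rewrite integral_indic// setIT.
have e2 : (\int[lebesgue_rV n]_x (\1_N (c *: x) : R)%:E =
    lebesgue_rV n ((fun x : 'rV[R]_n => c *: x) @^-1` N))%E.
  transitivity (\int[lebesgue_rV n]_x
      (\1_((fun x : 'rV[R]_n => c *: x) @^-1` N) x : R)%:E)%E.
    by apply: eq_integral => x _; rewrite !indicE.
  by rewrite integral_indic// setIT.
have /esym/eqP := etrans (esym e1) h; rewrite e2.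
by rewrite mule_eq0 eqe gt_eqF ?exprn_gt0//= => /eqP.
Qed.

Lemma lmeasurable_dilation n (f : 'rV[R]_n -> R) : lmeasurable setT f ->
  lmeasurable setT (fun x : 'rV[R]_n => f (c *: x)).
Proof.
move=> [f' mf' ff']; exists (fun x : 'rV[R]_n => f' (c *: x)).
  exact: (measurableT_comp mf' (@measurable_dilation n)).
by apply: (@ae_dilation n (fun x => [set: 'rV[R]_n] x -> f x = f' x)).
Qed.

End Dilation.

(** * Exponents, growth and coefficients *)

Section Data.
Context {R : realType}.

Lemma sobolev_exponents_conj n (ps pc : R) : sobolev_exponents n.+2 ps pc ->
  0 < pc /\ pc^-1 + ps^-1 = 1.
Proof.
rewrite /sobolev_exponents; case: n => [|n] /=.
  move=> [p2 ->]; have p1 : 0 < ps - 1 by lra.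
  split; first by rewrite divr_gt0//; lra.
  by field; rewrite !gt_eqF//; lra.
move=> [-> ->]; have n0 : (0 : R) <= n%:R by [].
have e : n.+3%:R = n%:R + 3 :> R by rewrite -natrD addn3.
have -> : n.+3%:R - 2 = n%:R + 1 :> R by rewrite e; lra.
rewrite e; split; first by rewrite divr_gt0 ?mulr_gt0//; lra.
by field; rewrite !gt_eqF//; lra.
Qed.

Lemma young_powR (a b ps pc : R) : 0 < pc -> 0 < ps -> pc^-1 + ps^-1 = 1 ->
  `|a| * `|b| <= `|a| `^ pc + `|b| `^ ps.
Proof.
move=> pc0 ps0 e; have := conjugate_powR (normr_ge0 a) (normr_ge0 b) pc0 ps0 e.
move/le_trans; apply.
have c1 : 0 < pc^-1 by rewrite invr_gt0.
have s1 : 0 < ps^-1 by rewrite invr_gt0.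
by rewrite lerD// ler_piMr ?powR_ge0//; lra.
Qed.

(** Between consecutive integers a monotone function is controlled by its
    values at the integers, so a bound at countably many points suffices. *)
Lemma monotone_growth (g : R -> R) (Cg H p q : R) :
  {homo g : x y / x <= y} -> 0 <= Cg -> 0 <= H -> 1 <= q -> q <= p ->
  (forall k : nat, `|g k%:R| <= Cg * (k%:R `^ (q - 1) + H) /\
    `|g (- k%:R)| <= Cg * (k%:R `^ (q - 1) + H)) ->
  exists C, forall s t : R, `|g s| * `|t| <= C * (1 + `|s| `^ p + `|t| `^ p).
Proof.
move=> ndg Cg0 H0 q1 qp gk.
have p0 : 0 <= p by lra.
exists (2 * Cg * (2 `^ p + 1 + H)) => s t.
have [k k1 k2] : exists2 k : nat, `|s| <= k%:R & k%:R <= `|s| + 1.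
  exists (Num.truncn `|s|).+1; first by rewrite ltW// truncnS_gt.
  by rewrite -natr1 lerD2r truncn_le.
have gs : `|g s| <= 2 * Cg * ((`|s| + 1) `^ (p - 1) + H).
  have h1 : `|g s| <= `|g k%:R| + `|g (- k%:R)|.
    move: k1; rewrite ler_norml => /andP[/ndg h1 /ndg h2].
    have := ler_norm (g k%:R); have := ler_norm (- g (- k%:R)); rewrite normrN.
    have := normr_ge0 (g k%:R); have := normr_ge0 (g (- k%:R)).
    by move=> *; rewrite ler_norml; apply/andP; split; lra.
  have [h2 h3] := gk k.
  have h4 : k%:R `^ (q - 1) <= (`|s| + 1) `^ (p - 1).
    apply: (@le_trans _ _ ((`|s| + 1) `^ (q - 1))).
      by apply: ge0_ler_powR => //; rewrite ?nnegrE ?subr_ge0 ?addr_ge0.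
    by rewrite ler_powR ?lerDr//; lra.
  have h5 := ler_wpM2l Cg0 (lerD h4 (lexx H)).
  by lra.
have ht : (`|s| + 1) `^ (p - 1) * `|t| <= (`|s| + 1) `^ p + `|t| `^ p.
  have a0 : 0 < `|s| + 1 by rewrite ltr_wpDl.
  have [ts|st] := leP `|t| (`|s| + 1).
    rewrite -[leLHS]addr0 lerD ?powR_ge0//.
    rewrite (le_trans (ler_wpM2l (powR_ge0 _ _) ts))//.
    by rewrite -{2}(powRr1 (ltW a0)) -powRD ?subrK// (gt_eqF a0) implybT.
  have t0 : 0 < `|t| by exact: lt_trans st.
  rewrite -[leLHS]add0r lerD ?powR_ge0//.
  apply: (@le_trans _ _ (`|t| `^ (p - 1) * `|t|)).
    by rewrite ler_wpM2r//; apply: ge0_ler_powR; rewrite ?nnegrE ?(ltW a0) ?(ltW st) ?subr_ge0//; exact: le_trans qp.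
  by rewrite -{2}(powRr1 (ltW t0)) -powRD ?subrK// (gt_eqF t0) implybT.
have hs : (`|s| + 1) `^ p <= 2 `^ p * (`|s| `^ p + 1).
  by have := powR_add_le p0 (normr_ge0 s) ler01; rewrite powR1.
have t1 : `|t| <= 1 + `|t| `^ p.
  have [h|/ltW h] := leP `|t| 1; first by rewrite (le_trans h)// lerDl powR_ge0.
  rewrite -[leLHS]add0r lerD// -{1}(powRr1 (normr_ge0 t)) ler_powR//.
  exact: le_trans qp.
apply: (le_trans (ler_wpM2r (normr_ge0 t) gs)).
rewrite -!mulrA ler_wpM2l// ler_wpM2l// mulrDl.
have a1 := powR_ge0 `|s| p; have b1 := powR_ge0 `|t| p.
have d1 := powR_ge0 2 p; have := ler_wpM2l H0 t1.
move: (2 `^ p) (`|s| `^ p) (`|t| `^ p) a1 b1 d1 hs ht.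
move=> D S T S0 T0 D0 hs ht hH.
have h1 := mulr_ge0 D0 T0; have h2 := mulr_ge0 H0 S0.
by apply: (@le_trans _ _ (D * (S + 1) + T + (H * (1 + T)))); [lra|nra].
Qed.

Lemma ler_entry_norm m n (A : 'M[R]_(m, n)) i j : `|A i j| <= `|A|.
Proof.
rewrite [leRHS]mx_normrE.
exact: (@le_bigmax _ _ _ 0 (fun ij => `|A ij.1 ij.2|) (i, j)).
Qed.

Lemma ae_norm_le_Lnormy n (a : 'rV[R]_n -> 'M[R]_n) (L : R) :
  ('N[lebesgue_rV n]_(+oo)[(fun x => `|a x|%:E)] <= L%:E)%E ->
  {ae lebesgue_rV n, forall x, forall i j, `|a x i j| <= L}.
Proof.
rewrite unlock; case: ifPn => [m0 /ess_sup_inf.ess_supP|].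
  apply: filterS => x; rewrite /= normr_id lee_fin => h i j.
  exact: le_trans (ler_entry_norm _ _ _) h.
rewrite -leNgt => m0 _; exists setT; split => //.
by apply/eqP; rewrite eq_le m0 measure_ge0.
Qed.

Lemma dot_mxapp n (M : 'M[R]_n) x y :
  dot (mxapp M x) y = \sum_i (\sum_j M i j * x ord0 j) * y ord0 i.
Proof.
apply: eq_bigr => i _; rewrite !mxE; congr (_ * _).
by apply: eq_bigr => j _; rewrite mxE.
Qed.

End Data.

(** * Weak solutions *)

Section WeakFormulation.
Context {R : realType} {n : nat}.
Variable Omega : set 'rV[R]_n.
Local Notation leb := (lebesgue_rV n).
Hypotheses (oO : open Omega) (finO : (leb Omega < +oo)%E).
Variables (p C : R).
Hypotheses (p2 : 2 <= p) (C0 : 0 < C).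
Hypothesis sobolev : sobolev_bound Omega p C.
Variables (A : 'rV[R]_n -> 'M[R]_n) (lam L : R).
Hypothesis lam0 : 0 < lam.
Hypothesis A_meas : forall i j, lmeasurable setT (fun x => A x i j).
Hypothesis A_bdd : {ae leb, forall x, forall i j, `|A x i j| <= L}.
Hypothesis A_sym : forall x, (A x)^T = A x.
Hypothesis A_ell : forall x xi : 'rV[R]_n,
  lam * enorm xi ^+ 2 <= dot (mxapp (A x) xi) xi.
Variables (g : R -> R) (Cg : R).
Hypotheses (cg : continuous g) (ndg : {homo g : x y / x <= y}).
Hypothesis g_growth : forall s t : R,
  `|g s| * `|t| <= Cg * (1 + `|s| `^ p + `|t| `^ p).
Variables (f f' F : 'rV[R]_n -> R).
Hypotheses (ff' : f = f' %[ae leb in Omega]) (mf : measurable_fun setT f').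
Hypotheses (iF : leb.-integrable Omega (EFin \o F))
  (fF : forall x (t : R), `|f' x| * `|t| <= F x + `|t| `^ p).

Let mO : measurable Omega. Proof. exact: open_measurable_rV. Qed.
Let p0 : 0 <= p. Proof. by rewrite (le_trans _ p2). Qed.
Local Notation H1p := (H10pair Omega p).

Section BorelCoefficients.
Variable B : 'I_n -> 'I_n -> 'rV[R]_n -> R.
Hypotheses (mB : forall i j, measurable_fun setT (B i j))
  (AB : {ae leb, forall x, forall i j, A x i j = B i j x}).
Local Notation e := (ebil Omega B).

Let B_bdd i j : {ae leb, forall x, Omega x -> `|B i j x| <= L}.
Proof. by apply: filterS2 AB A_bdd => x h1 h2 _; rewrite -h1. Qed.

Let B_sym i j : {ae leb, forall x, Omega x -> B i j x = B j i x}.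
Proof. by apply: filterS AB => x h _; rewrite -!h -{1}A_sym mxE. Qed.

Let B_ell : {ae leb, forall x, Omega x -> forall xi : 'I_n -> R,
  lam * \sum_i xi i ^+ 2 <= \sum_i (\sum_j B i j x * xi j) * xi i}.
Proof.
apply: filterS AB => x h _ xi; have := A_ell x (\row_i xi i).
rewrite enorm_sqr dot_mxapp; under eq_bigr do rewrite mxE.
move/le_trans; apply; rewrite le_eqVlt; apply/orP; left; apply/eqP.
apply: eq_bigr => i _; rewrite mxE; congr (_ * _).
by apply: eq_bigr => j _; rewrite mxE h.
Qed.

(** The weak gradients agree almost everywhere with the Borel representatives
    [w] and [z]. *)
Lemma integral_diffusion u v w z : L2 Omega w -> L2 Omega z ->
  (forall i, is_weak_pd Omega i u (w i)) -> (forall i, is_weak_pd Omega i v (z i)) ->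
  (\int[leb]_(x in Omega)
    (dot (mxapp (A x) (weak_grad Omega u x)) (weak_grad Omega v x))%:E
   = (e w z)%:E)%E.
Proof.
move=> Lw Lz uw vz; rewrite -(ebil_integral mO mB B_bdd Lw Lz).2.
apply: ae_eq_integral_any.
have aew : {ae leb, forall x i, Omega x -> weak_pd Omega i u x = w i x}.
  by apply: filter_forall => i; exact: (weak_pdE oO (uw i)).
have aez : {ae leb, forall x i, Omega x -> weak_pd Omega i v x = z i x}.
  by apply: filter_forall => i; exact: (weak_pdE oO (vz i)).
apply: filterS3 AB aew aez => x h1 h2 h3 Ox; rewrite dot_mxapp; congr EFin.
apply: eq_bigr => i _; rewrite mxE h3//; congr (_ * _).
by apply: eq_bigr => j _; rewrite mxE h2// h1.
Qed.

(** All integrals in the notion of weak solution are finite and depend on the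
    functions only up to null sets, so that the extended-real identity for the
    members of H10 becomes a real one for their Borel representatives. *)
Lemma weak_solution_pair u u0 w phi_ : u = u0 %[ae leb in Omega] ->
  H1p u0 w phi_ ->
  weak_solution Omega A g f u <-> pair_solution Omega p B g f' u0 w.
Proof.
move=> uu0 uw; have [Hu du] := H10pair_H10 oO finO p2 uu0 uw.
have Lw := H10pair_L2 mO uw; have Lu := H10pair_Lq mO p2 uw.
have E v v0 z psi_ : v = v0 %[ae leb in Omega] -> H1p v0 z psi_ ->
    ((\int[leb]_(x in Omega)
      (dot (mxapp (A x) (weak_grad Omega u x)) (weak_grad Omega v x))%:E
     + \int[leb]_(x in Omega) (g (u x) * v x)%:E
     = \int[leb]_(x in Omega) (f x * v x)%:E)%E <->
    e w z + \int[leb]_(x in Omega) (g (u0 x) * v0 x) =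
    \int[leb]_(x in Omega) (f' x * v0 x)).
  move=> vv0 vz; have [_ dv] := H10pair_H10 oO finO p2 vv0 vz.
  have Lz := H10pair_L2 mO vz; have Lv := H10pair_Lq mO p2 vz.
  rewrite (integral_diffusion Lw Lz du dv).
  have -> : (\int[leb]_(x in Omega) (g (u x) * v x)%:E =
      (\int[leb]_(x in Omega) (g (u0 x) * v0 x))%:E)%E.
    have ig := nonlinear_integrable mO finO p2 cg g_growth Lu Lv.
    rewrite /Rintegral fineK; last exact: integrable_fin_num.
    by apply: ae_eq_integral_any; apply: filterS2 uu0 vv0 => x h1 h2 Ox; rewrite h1// h2.
  have -> : (\int[leb]_(x in Omega) (f x * v x)%:E =
      (\int[leb]_(x in Omega) (f' x * v0 x))%:E)%E.
    have if' := source_integrable mO p2 mf iF fF Lv.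
    rewrite /Rintegral fineK; last exact: integrable_fin_num.
    by apply: ae_eq_integral_any; apply: filterS2 ff' vv0 => x h1 h2 Ox; rewrite h1// h2.
  rewrite -EFinD; split; first by case.
  by move=> ->.
split => [[_ h] v z psi_ vz|h].
  apply/(E v v z psi_ _ vz); first exact: aeW.
  by apply: h; apply: (H10pair_H10 oO finO p2 _ vz).1; exact: aeW.
split => // v /(H10_H10pair oO finO p2 C0 sobolev)[v0 [z [psi_ [vv0 vz]]]].
by apply/(E _ _ _ _ vv0 vz); exact: h vz.
Qed.

Lemma weak_solution_exists_unique : exists2 u, weak_solution Omega A g f u &
  forall u', weak_solution Omega A g f u' -> u' = u %[ae leb in Omega].
Proof.
have [u [w [phi_ [uw hu]]]] := pair_existence mO finO p2 C0 sobolev lam0 mB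
  B_bdd B_sym B_ell cg ndg g_growth mf iF fF.
have uu : u = u %[ae leb in Omega] by exact: aeW.
exists u; first exact/(weak_solution_pair uu uw).
move=> u' su'; have [u1 [w1 [phi1 [u'u1 uw1]]]] :=
  H10_H10pair oO finO p2 C0 sobolev su'.1.
have hu1 := (weak_solution_pair u'u1 uw1).1 su'.
have := pair_uniqueness mO finO p2 C0 sobolev lam0 mB B_bdd B_ell cg ndg g_growth
  uw uw1 hu hu1.
by apply: filterS2 u'u1 => x h1 h2 Ox; rewrite h1// h2.
Qed.

Lemma weak_solution_gradient_bound K u : 0 <= K ->
  (forall u w phi_ N, H1p u w phi_ -> 0 < N -> sqn Omega w <= N ^+ 2 ->
    `|\int[leb]_(x in Omega) (f' x * u x)| +
    `|\int[leb]_(x in Omega) (g 0 * u x)| <= K * N) ->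
  weak_solution Omega A g f u ->
  (Lpnorm Omega 2 (enorm \o weak_grad Omega u) ^+ 2 <=
   ((K / lam) ^+ 2 + 2 * (K / lam))%:E)%E.
Proof.
move=> K0 hK su.
have [u1 [w1 [phi1 [uu1 uw1]]]] := H10_H10pair oO finO p2 C0 sobolev su.1.
have hu1 := (weak_solution_pair uu1 uw1).1 su.
have [_ du] := H10pair_H10 oO finO p2 uu1 uw1.
rewrite (weak_grad_norm oO du (H10pair_L2 mO uw1)) lee_fin.
apply: (pair_estimate mO finO p2 lam0 mB B_bdd B_ell cg ndg g_growth K0 uw1).
  by move=> N; exact: hK uw1.
exact: hu1 uw1.
Qed.

End BorelCoefficients.

Lemma borel_coefficients : exists B, (forall i j, measurable_fun setT (B i j)) /\
  {ae leb, forall x, forall i j, A x i j = B i j x}.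
Proof.
have /choice[B0 hB0] (ij : 'I_n * 'I_n) : exists b, measurable_fun setT b /\
    (fun x => A x ij.1 ij.2) = b %[ae leb in setT].
  by have [b mb hb] := A_meas ij.1 ij.2; exists b.
exists (fun i j => B0 (i, j)); split => [i j|]; first exact: (hB0 (i, j)).1.
apply: filter_forall => i; apply: filter_forall => j.
by apply: filterS (hB0 (i, j)).2 => x h; exact: h.
Qed.

End WeakFormulation.

(** If [Omega] is null, all integrals over it vanish and [g] may be replaced by
    zero.  Otherwise the growth condition holds for all integers simultaneously
    at a single point of [Omega], and [h] may be replaced by its value there. *)
Lemma superposition_growth (R : realType) n (Omega : set 'rV[R]_n)
    (Cg p q : R) (g : R -> R) (h : 'rV[R]_n -> R) :
  measurable Omega -> 0 < Cg -> 1 <= q -> q <= p ->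
  continuous g -> {homo g : x y / x <= y} ->
  (forall t : R, {ae lebesgue_rV n, forall x, Omega x ->
     `|g t| <= Cg * (`|t| `^ (q - 1) + h x)}) ->
  exists (g' : R -> R) (C' : R), [/\ continuous g', {homo g' : x y / x <= y},
    forall s t : R, `|g' s| * `|t| <= C' * (1 + `|s| `^ p + `|t| `^ p) &
    forall A f u, weak_solution Omega A g f u <-> weak_solution Omega A g' f u].
Proof.
move=> mO Cg0 q1 qp cg ndg growth.
have [nullO|nnullO] := pselect (forall P : 'rV[R]_n -> Prop,
    {ae lebesgue_rV n, forall x, Omega x -> P x}).
  exists (fun=> 0), 0; split => //.
  - by move=> x; exact: cvg_cst.
  - by move=> s t; rewrite normr0 !mul0r.
  move=> A f u; rewrite /weak_solution.
  have E v : (\int[lebesgue_rV n]_(x in Omega) (g (u x) * v x)%:E =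
      \int[lebesgue_rV n]_(x in Omega) (0 * v x)%:E)%E.
    by apply: ae_eq_integral_any; exact: nullO.
  by split => -[hu hv]; split => // v /hv; rewrite E.
have growthZ : {ae lebesgue_rV n, forall x, forall k : nat, Omega x ->
    `|g k%:R| <= Cg * (`|k%:R| `^ (q - 1) + h x) /\
    `|g (- k%:R)| <= Cg * (`|- k%:R| `^ (q - 1) + h x)}.
  apply: ae_foralln => k.
  by apply: filterS2 (growth k%:R) (growth (- k%:R)) => x h1 h2 Ox; split; auto.
have [x0 hx0] : exists x0, forall k : nat,
    `|g k%:R| <= Cg * (k%:R `^ (q - 1) + `|h x0|) /\
    `|g (- k%:R)| <= Cg * (k%:R `^ (q - 1) + `|h x0|).
  apply: contrapT => /forallNP hN; apply: nnullO => P.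
  apply: filterS growthZ => x hx Ox; exfalso; apply: (hN x) => k.
  have [h1 h2] := hx k Ox; rewrite normrN normr_nat in h1 h2.
  have hh : Cg * (k%:R `^ (q - 1) + h x) <= Cg * (k%:R `^ (q - 1) + `|h x|).
    by rewrite ler_pM2l// lerD2l ler_norm.
  by split; apply: le_trans hh.
have [C' hC'] := monotone_growth ndg (ltW Cg0) (normr_ge0 _) q1 qp hx0.
by exists g, C'; split.
Qed.

Theorem theorem1 (R : realType) (d : nat) (d_ge2 : (2 <= d)%N)
  (Omega : set 'rV[R]_d) (Omega_open : open Omega)
  (Omega_bounded : bounded_set Omega) (Omega_smooth : smooth_boundary Omega)
  (lam Lam : R) (lam_gt0 : 0 < lam) (Lam_gt0 : 0 < Lam)
  (a : 'rV[R]_d -> 'M[R]_d)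
  (a_meas : forall i j, lmeasurable setT (fun x => a x i j))
  (a_sym : forall x, (a x)^T = a x)
  (a_per : forall (z : 'rV[R]_d) (m : int) (k : 'I_d),
     a (z + m%:~R *: ebasis k) = a z)
  (a_bdd : ('N[lebesgue_rV d]_(+oo)[(fun x => `|a x|%:E)] <= Lam%:E)%E)
  (a_ell : forall x xi : 'rV[R]_d,
     lam * enorm xi ^+ 2 <= dot (mxapp (a x) xi) xi)
  (ps pc : R) (exps : sobolev_exponents d ps pc)
  (g : R -> R) (g_cont : continuous g) (g_nondecr : {homo g : x y / x <= y})
  (Cg q : R) (h : 'rV[R]_d -> R)
  (Cg_gt0 : 0 < Cg) (q_ge1 : 1 <= q) (q_le : q <= ps) (h_Lp : Lp Omega pc h)
  (g_growth : forall t : R, {ae lebesgue_rV d, forall x, Omega x ->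
     `|g t| <= Cg * (`|t| `^ (q - 1) + h x)})
  (f : 'rV[R]_d -> R) (f_Lp : Lp Omega pc f) :
  (forall eps : R, 0 < eps ->
     exists2 u : 'rV[R]_d -> R,
       weak_solution Omega (fun x => a (eps^-1 *: x)) g f u &
       forall u', weak_solution Omega (fun x => a (eps^-1 *: x)) g f u' ->
         u' = u %[ae lebesgue_rV d in Omega])
  /\
  exists2 C : R, 0 < C &
    forall eps : R, 0 < eps -> forall u : 'rV[R]_d -> R,
      weak_solution Omega (fun x => a (eps^-1 *: x)) g f u ->
      (Lpnorm Omega 2 (enorm \o weak_grad Omega u) ^+ 2 <=
       C%:E * (Lpnorm Omega pc f `^ pc + (`|g 0%R| `^ pc)%:E + 1))%E.
Proof.
have mO := open_measurable_rV Omega_open.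
have [r [Or rfin]] := bounded_rV_measure Omega_bounded.
have finO : (lebesgue_rV d Omega < +oo)%E.
  by apply: le_lt_trans rfin; apply: le_measure; rewrite ?inE//; exact: measurable_cbox.
have [ps2 pc0 conj [Cs Cs0 sobolev]] : [/\ 2 <= ps, 0 < pc, pc^-1 + ps^-1 = 1 &
    exists2 C, 0 < C & sobolev_bound Omega ps C].
  clear -d_ge2 exps Or.
  case: d d_ge2 Omega exps Or => [//|[//|n]] _ Omega exps Or.
  have [? ?] := sobolev_exponents_conj exps; split => //.
    exact: sobolev_exponents_ge2 exps.
  exact: sobolev_test exps Or.
have ps0 : 0 < ps by rewrite (lt_le_trans _ ps2).
have [f' Lf' ff'] := Lp_rep pc0 f_Lp.
have [mf' iF] := Lf'.
have fF x (t : R) : `|f' x| * `|t| <= `|f' x| `^ pc + `|t| `^ ps.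
  exact: young_powR.
have [g' [C' [cg' ndg' g'_growth gg']]] :=
  superposition_growth mO Cg_gt0 q_ge1 q_le g_cont g_nondecr g_growth.
have c0 (eps : R) : 0 < eps -> 0 < eps^-1 by rewrite invr_gt0.
pose ae_ eps x := a (eps^-1 *: x).
have ae_meas (eps : R) : 0 < eps -> forall i j, lmeasurable setT (fun x => ae_ eps x i j).
  move=> /c0 e0 i j; exact: (lmeasurable_dilation e0 (a_meas i j)).
have ae_bdd (eps : R) : 0 < eps ->
    {ae lebesgue_rV d, forall x, forall i j, `|ae_ eps x i j| <= Lam}.
  move=> /c0 e0; exact: (@ae_dilation _ _ e0 d (fun x => forall i j, `|a x i j| <= Lam) (ae_norm_le_Lnormy a_bdd)).
have ae_sym (eps : R) x : (ae_ eps x)^T = ae_ eps x by exact: a_sym.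
have ae_ell (eps : R) x xi : lam * enorm xi ^+ 2 <= dot (mxapp (ae_ eps x) xi) xi.
  exact: a_ell.
split.
  move=> eps eps0.
  have [B [mB AB]] := borel_coefficients (ae_meas _ eps0).
  have [u su uniq] := weak_solution_exists_unique Omega_open finO ps2 Cs0 sobolev
    lam_gt0 (ae_bdd _ eps0) (ae_sym eps) (ae_ell eps) cg' ndg' g'_growth ff' mf' iF fF
    mB AB.
  by exists u => [|u' su']; [exact/gg'|apply: uniq; exact/gg'].
have [K K0 hK] := pair_bound mO finO ps2 Cs0 sobolev g' mf' iF fF.
have K1 : 0 <= (K / lam) ^+ 2 + 2 * (K / lam).
  by rewrite addr_ge0 ?sqr_ge0// mulr_ge0// divr_ge0// ltW.
(* [K] is determined by [f], [g] and the domain, independently of [eps]; the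
   factor that multiplies the constant in the estimate is at least one. *)
exists ((K / lam) ^+ 2 + 2 * (K / lam) + 1); first by rewrite ltr_wpDl.
move=> eps eps0 u /gg' su.
have [B [mB AB]] := borel_coefficients (ae_meas _ eps0).
have := weak_solution_gradient_bound Omega_open finO ps2 Cs0 sobolev
  lam_gt0 (ae_bdd _ eps0) (ae_ell eps) cg' ndg' g'_growth ff' mf' iF fF
  mB AB K0 hK su.
move/le_trans; apply.
apply: (@le_trans _ _ (((K / lam) ^+ 2 + 2 * (K / lam) + 1)%:E * 1)%E).
  by rewrite mule1 lee_fin lerDl.
apply: lee_wpmul2l; first by rewrite lee_fin addr_ge0.
by rewrite leeDr// adde_ge0 ?poweR_ge0// lee_fin powR_ge0.
Qed.
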